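(* Let $k$ be a number field, let $E_1: y_1^2=x_1^3+a_2x_1^2+a_4x_1+a_6$ and $E_2: y_2^2=x_2^3+a_2'x_2^2+a_4'x_2+a_6'$ be elliptic curves over $k$ with $j(E_1)\neq j(E_2)$, and let $\varphi:E_1\to E_2$ be an isogeny defined over $k$ of degree $d\geq 2$, written as $\varphi(x_1,y_1)=(\varphi_x(x_1),\varphi_y(x_1)y_1)$. Let $C_u\subset\mathbb{P}^2$, the points $O,\bar O\in C_u$, the polynomials $p^{\pm}(x_1)$, and the points $Q_1^{\pm},\ldots,Q_r^{\pm}$ on $C_u$, where $r=\deg p^{\pm}(x_1)$, be as defined in the context. Then: (i) If $d$ is odd, then $r=\deg p^{\pm}(x_1)=(3d-3)/2$, and there exists a plane curve $C^{+}$ (resp. $C^{-}$) of degree $(d+1)/2$ passing through the $r+2$ points $Q_1^{+},\ldots,Q_r^{+}$ (resp. $Q_1^{-},\ldots,Q_r^{-}$), $O$ and $\bar O$. (ii) If $d$ is even, then $r=(3d-2)/2$, and there exists a plane curve $C^{+}$ (resp. $C^{-}$) of degree $d/2$ passing through the $r$ points $Q_1^{+},\ldots,Q_r^{+}$ (resp. $Q_1^{-},\ldots,Q_r^{-}$). (iii) Both for even $d=2l$ and for odd $d=2l-1$, there is a $3l$-th point $Q^{+}$ (resp. $Q^{-}$) on $C_u$, which is a $k(u)$-rational point, such that any curve $C^{+}$ (resp. $C^{-}$) as in (i) or (ii) passes through $Q^{+}$ (resp. $Q^{-}$).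
   Context: Let $u$ be an indeterminate over $k$. $C_u$ is the plane cubic curve over $k(u)$ in $\mathbb{P}^2=\{(x_1:x_2:z)\}$ defined by $$x_2^3+a_2'x_2^2z+a_4'x_2z^2+a_6'z^3=u^6\left(x_1^3+a_2x_1^2z+a_4x_1z^2+a_6z^3\right).$$ $O=(1:u^2:0)$ is a $k(u)$-rational point of $C_u$, and $\bar O$ is the third point of intersection of $C_u$ with the tangent line to $C_u$ at $O$. An isogeny $\varphi:E_1\to E_2$ over $k$ can be written as $(x_1,y_1)\mapsto(\varphi_x(x_1),\varphi_y(x_1)y_1)$ with rational functions $\varphi_x,\varphi_y\in k(x_1)$. $p^{+}(x_1)$ (resp. $p^{-}(x_1)$) is the numerator, as a polynomial in $x_1$ with coefficients in $k(u)$ (the fraction being written in lowest terms), of $\varphi_y(x_1)-u^3$ (resp. $\varphi_y(x_1)+u^3$), and $r=\deg p^{\pm}(x_1)$ is its degree in $x_1$. The points $Q_1^{\pm},\ldots,Q_r^{\pm}$ are the $\overline{k(u)}$-rational points of $C_u$ of the form $(x_1:\varphi_x(x_1):1)$, where $x_1$ runs over the $r$ roots of $p^{\pm}(x_1)=0$ in $\overline{k(u)}$. (These points lie on $C_u$ because $\varphi_x(x_1)^3+a_2'\varphi_x(x_1)^2+a_4'\varphi_x(x_1)+a_6'=\varphi_y(x_1)^2(x_1^3+a_2x_1^2+a_4x_1+a_6)$.) With $d=2l$ or $d=2l-1$, the curves $C^{\pm}$ in (i) and (ii) have degree $l$ and are required to pass through $3l-1$ prescribed points of $C_u$. The ''$3l$-th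 point'' $Q^{\pm}$ is the remaining point of the intersection: for a curve $C^{\pm}$ as in (i) or (ii) that does not contain $C_u$, the intersection divisor of $C^{\pm}$ with $C_u$ (of degree $3l$) is the sum of the $3l-1$ prescribed points and $Q^{\pm}$. The point $Q^{\pm}$ is the same for all such curves.
   Formalization: For even d it is additionally assumed that E_1[2] is not contained in ker φ; otherwise (e.g. φ a 2-isogeny composed with [2], d=8, r=12) one has r=3d/2 instead of (3d-2)/2, so (ii) is false. *)

(* Defs.v *)
From HB Require Import structures.
From mathcomp Require Import all_boot all_order all_algebra all_field.
From mathcomp Require Import generic_quotient fraction qpoly qfpoly mxpoly.
From mathcomp Require Export mpoly.

Set Implicit Arguments.
Unset Strict Implicit.
Unset Printing Implicit Defensive.

Import GRing.Theory.
Local Open Scope ring_scope.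
Local Open Scope quotient_scope.

Definition ratfun (F : fieldType) : fieldType := {fraction {poly F}}.
Notation "x %:F" := (@FracField.tofrac _ x) : ring_scope.

Definition ratC (F : fieldType) (c : F) : ratfun F := (c%:P)%:F.

HB.instance Definition _ (F : fieldType) :=
  GRing.RMorphism.copy (@ratC F) (@FracField.tofrac {poly F} \o polyC).

Definition ratX (F : fieldType) : ratfun F := 'X%:F.
Arguments ratX {F}.

(* Numerator and denominator in lowest terms; they are determined up to a
   common nonzero constant factor. *)
Definition fnum (F : fieldType) (f : {fraction {poly F}}) : {poly F} :=
  \n_(repr f) %/ gcdp \n_(repr f) \d_(repr f).

Definition fden (F : fieldType) (f : {fraction {poly F}}) : {poly F} :=
  \d_(repr f) %/ gcdp \n_(repr f) \d_(repr f).

Lemma coprimep_fnum_fden (F : fieldType) (f : ratfun F) :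
  coprimep (fnum f) (fden f).
Proof.
apply: coprimep_div_gcd; apply/orP; right; exact: denom_ratioP.
Qed.

Lemma fden_neq0 (F : fieldType) (f : ratfun F) : fden f != 0.
Proof.
rewrite dvdp_div_eq0 ?dvdp_gcdr //; exact: denom_ratioP.
Qed.

Lemma fnum_fdenE (F : fieldType) (f : ratfun F) :
  f = (fnum f)%:F / (fden f)%:F.
Proof.
have d0 : \d_(repr f) != 0 by exact: denom_ratioP.
have g0 : gcdp \n_(repr f) \d_(repr f) != 0 by rewrite gcdp_eq0 negb_and d0 orbT.
have pi_r (r : {ratio {poly F}}) : (\n_r)%:F = \pi_(ratfun F) r * (\d_r)%:F.
  unlock FracField.tofrac; rewrite -[RHS]FracField.pi_mul /FracField.mulf.
  apply/eqmodP; rewrite /= FracField.equivfE.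
  by rewrite !numden_Ratio ?mulf_neq0 ?oner_neq0 ?denom_ratioP // !mulr1 mul1r mulrC.
have := pi_r (repr f); rewrite reprK => e.
have den0 : (fden f)%:F != 0 by rewrite tofrac_eq0 fden_neq0.
apply: (canRL (mulfK den0)); apply: (mulIf (_ : (gcdp \n_(repr f) \d_(repr f))%:F != 0)).
  by rewrite tofrac_eq0.
by rewrite -mulrA -!tofracM !divpK ?dvdp_gcdl ?dvdp_gcdr.
Qed.

Definition ratfun_map (F F' : fieldType) (m : F -> F') (f : ratfun F) :
    ratfun F' :=
  (map_poly m (fnum f))%:F / (map_poly m (fden f))%:F.

Definition ratfun_eval (F K : fieldType) (m : F -> K) (f : ratfun F) (x : K) :
    K :=
  (map_poly m (fnum f)).[x] / (map_poly m (fden f)).[x].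

Section DiscAndJ.
Variables (k : fieldType) (a2 a4 a6 : k).

(* The standard quantities b2, b4, b6, b8, c4 with a1 = a3 = 0. *)
Definition w_b2 := 4%:R * a2.
Definition w_b4 := 2%:R * a4.
Definition w_b6 := 4%:R * a6.
Definition w_b8 := 4%:R * a2 * a6 - a4 ^+ 2.
Definition w_c4 := w_b2 ^+ 2 - 24%:R * w_b4.
Definition w_disc :=
  - w_b2 ^+ 2 * w_b8 - 8%:R * w_b4 ^+ 3 - 27%:R * w_b6 ^+ 2
  + 9%:R * w_b2 * w_b4 * w_b6.
Definition w_j := w_c4 ^+ 3 / w_disc.

End DiscAndJ.

Record ellcurve (k : fieldType) := EllCurve {
  ec_a2 : k;
  ec_a4 : k;
  ec_a6 : k;
  _ : w_disc ec_a2 ec_a4 ec_a6 != 0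
}.

Definition jinv (k : fieldType) (E : ellcurve k) : k :=
  w_j (ec_a2 E) (ec_a4 E) (ec_a6 E).

(* x^3 + a2 x^2 z + a4 x z^2 + a6 z^3, with coefficients mapped to R by m *)
Definition ec_cubic (k : fieldType) (E : ellcurve k) (R : comNzRingType)
    (m : k -> R) (x z : R) : R :=
  x ^+ 3 + m (ec_a2 E) * x ^+ 2 * z + m (ec_a4 E) * x * z ^+ 2
  + m (ec_a6 E) * z ^+ 3.

Section FunctionField.
Variables (k : fieldType) (E : ellcurve k).

Definition ff_poly : {poly ratfun k} :=
  'X^2 - (ec_cubic E (@ratC k) ratX 1)%:P.

Lemma ff_poly_irr : monic_irreducible_poly ff_poly.
Proof.
have sz : size ff_poly = 3.
  rewrite /ff_poly size_polyDl size_polyXn // size_polyN.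
  exact: leq_ltn_trans (size_polyC_leq1 _) _.
have mon : ff_poly \is monic.
  rewrite monicE /lead_coef sz /ff_poly coefB coefXn coefC subr0.
  by rewrite eqxx.
split=> //; apply: cubic_irreducible => [|f]; first by rewrite sz.
apply/negP; rewrite /root /ff_poly !hornerE subr_eq0 => /eqP h.
pose q : {poly k} := ec_cubic E polyC 'X 1.
have qE : ec_cubic E (@ratC k) ratX 1 = q%:F.
  by rewrite /q /ec_cubic /ratC /ratX !(tofracD, tofracM, tofracXn, tofrac1).
have szq : size q = 4.
  rewrite /q /ec_cubic !expr1n !mulr1 -!addrA size_polyDl size_polyXn //.
  have -> : (ec_a2 E)%:P * 'X^2 + ((ec_a4 E)%:P * 'X + (ec_a6 E)%:P) =
            Poly [:: ec_a6 E; ec_a4 E; ec_a2 E].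
    rewrite /= !cons_poly_def mul0r add0r expr2; rewrite mulrDl mulrA addrA.
    by rewrite -!addrA.
  exact: leq_ltn_trans (size_Poly _) _.
have d0 := fden_neq0 f.
have dF : (fden f)%:F ^+ 2 != 0 by rewrite expf_neq0 ?tofrac_eq0.
have e : fnum f ^+ 2 = q * fden f ^+ 2.
  apply/eqP; rewrite -tofrac_eq tofracXn (tofracM q) tofracXn -qE -h [X in X ^+ 2 * _](fnum_fdenE f).
  by rewrite expr_div_n divfK.
have q0 : q != 0 by rewrite -size_poly_eq0 szq.
have n0 : fnum f != 0.
  have : fnum f ^+ 2 != 0 by rewrite e mulf_neq0 ?expf_neq0.
  by rewrite expf_eq0.
have := congr1 (fun p : {poly k} => size p) e.
rewrite [in RHS]size_mul ?expf_neq0 // szq !expr2 !size_mul //.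
move: n0 d0; rewrite -!size_poly_gt0.
case: (size (fnum f)) => // a _; case: (size (fden f)) => // b _.
by rewrite !addSn !addnS /= => -[] /(congr1 odd); rewrite /= !oddD !addbb.
Qed.

(* The function field k(E) = k(x)[y] / (y^2 - (x^3 + a2 x^2 + a4 x + a6)),
   with ffC the inclusion of k(x) and ffy the class of y. *)
Definition funfield : fieldType := {poly %/ ff_poly with ff_poly_irr}.

Definition ffC (f : ratfun k) : funfield :=
  (f%:A : {poly %/ ff_poly with ff_poly_irr}).

Definition ffy : funfield := ('qX : {poly %/ ff_poly}).

End FunctionField.

Section FieldDegree.
Variable L : fieldType.

Inductive subfield_gen (S : L -> Prop) : L -> Prop :=
  | sg_gen x : S x -> subfield_gen S x
  | sg_one : subfield_gen S 1
  | sg_sub x y : subfield_gen S x -> subfield_gen S y -> subfield_gen S (x - y)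
  | sg_mul x y : subfield_gen S x -> subfield_gen S y -> subfield_gen S (x * y)
  | sg_inv x : subfield_gen S x -> subfield_gen S x^-1.

(* [L : F] = n, for a subfield F of L *)
Definition has_degree_over (F : L -> Prop) (n : nat) : Prop :=
  exists b : 'I_n -> L, forall z : L,
    exists! c : {ffun 'I_n -> L},
      (forall i, F (c i)) /\ z = \sum_i c i * b i.

End FieldDegree.

Section Isogeny.
Variables (k : fieldType) (E1 E2 : ellcurve k) (phi_x phi_y : ratfun k).

(* The coordinates x2 and y2 of E2 composed with
   (x1, y1) |-> (phi_x(x1), phi_y(x1) y1), as functions on E1. *)
Definition pull_x : funfield E1 := ffC E1 phi_x.
Definition pull_y : funfield E1 := ffC E1 phi_y * ffy E1.

(* The first condition says that (x1, y1) |-> (phi_x(x1), phi_y(x1) y1) is a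
   rational map, hence a morphism, from E1 to E2.  The second one says that
   this morphism maps the origin of E1 to the origin of E2: the function
   phi_x(x1) has a pole at the unique point of E1 above x1 = infinity.  Such a
   morphism is not constant, because phi_x is not. *)
Definition is_isogeny : Prop :=
  pull_y ^+ 2 = ec_cubic E2 (fun c => ffC E1 (ratC c)) pull_x 1 /\
  (size (fden phi_x) < size (fnum phi_x))%N.

(* phi^* k(E2), the subfield of k(E1) generated by k and the pull-backs of the
   two coordinate functions of E2 *)
Definition pullback_field : funfield E1 -> Prop :=
  subfield_gen (fun z => (exists c : k, z = ffC E1 (ratC c)) \/
                         z = pull_x \/ z = pull_y).

Definition isogeny_degree (d : nat) : Prop := has_degree_over pullback_field d.

(* E1[2] is contained in the kernel of the isogeny: the nonzero points of E1[2]
   are the (x, 0) with x a root of the cubic of E1, and an affine point (x, y)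
   is in the kernel exactly when phi_x has a pole at x. *)
Definition two_torsion_in_kernel (K : fieldType) (m : k -> K) : Prop :=
  forall x : K, ec_cubic E1 m x 1 = 0 -> root (map_poly m (fden phi_x)) x.

End Isogeny.

Definition pt (F : fieldType) (x y z : F) : 'rV[F]_3 :=
  \row_i [:: x; y; z]`_i.

Definition evalp (F : fieldType) (G : {mpoly F[3]}) (P : 'rV[F]_3) : F :=
  G.@[fun i => P 0 i].

Section PlaneCurves.
Variable K : fieldType.
Implicit Types (F G : {mpoly K[3]}) (P Q : 'rV[K]_3) (pts : seq 'rV[K]_3).

(* A point of the projective plane is represented by a nonzero vector; two
   vectors give the same point when they span the same line. *)
Definition same_point P Q : bool := (P == Q)%MS.

Definition plane_curve (l : nat) G : Prop := G != 0 /\ G \is l.-homog.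

Definition passes_through G pts : bool := all (fun P => evalp G P == 0) pts.

Definition contains_curve G F : Prop :=
  forall P, P != 0 -> evalp F P = 0 -> evalp G P = 0.

Definition tangent_line F P : {mpoly K[3]} :=
  \sum_i evalp F^`M(i) P *: 'X_i.

(* The local ring of the projective plane at P: fractions of homogeneous forms
   of the same degree whose denominator does not vanish at P. *)
Definition local_ring P (z : {fraction {mpoly K[3]}}) : Prop :=
  exists (n : nat) (a b : {mpoly K[3]}),
    [/\ a \is n.-homog, b \is n.-homog, evalp b P != 0 & z = a%:F / b%:F].

(* The ideal of the local ring at P generated by the local equations of the
   curves F = 0 and G = 0. *)
Definition local_ideal F G P (z : {fraction {mpoly K[3]}}) : Prop :=
  exists (n : nat) (a b A B : {mpoly K[3]}),
    [/\ a \is n.-homog, b \is n.-homog, evalp b P != 0,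
        a = A * F + B * G & z = a%:F / b%:F].

(* i(F, G; P) = n, where i(F, G; P) is the dimension over K of the quotient of
   the local ring at P by the ideal generated by F and G. *)
Definition intersection_mult F G P (n : nat) : Prop :=
  exists b : 'I_n -> {fraction {mpoly K[3]}},
    (forall i, local_ring P (b i)) /\
    forall z, local_ring P z ->
      exists! c : {ffun 'I_n -> K},
        local_ideal F G P (z - \sum_i ((c i)%:MP)%:F * b i).

(* The intersection divisor of F and G is the sum of the points in pts. *)
Definition intersection_divisor F G pts : Prop :=
  forall P, P != 0 -> intersection_mult F G P (count (same_point P) pts).

End PlaneCurves.

Section Cu.
Variables (k : fieldType) (E1 E2 : ellcurve k) (phi_x phi_y : ratfun k).

(* k(u), with the indeterminate u written ratX *)
Local Notation ku := (ratfun k).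
Local Notation u := (ratX : ku).

(* The homogeneous coordinates (x1 : x2 : z) are 'X_0, 'X_1, 'X_2. *)
Definition Cu : {mpoly ku[3]} :=
  let m (c : k) : {mpoly ku[3]} := (ratC c)%:MP in
  let x1 : {mpoly ku[3]} := 'X_0 in
  let x2 : {mpoly ku[3]} := 'X_1 in
  let z : {mpoly ku[3]} := 'X_2%:R in
  ec_cubic E2 m x2 z - (u ^+ 6)%:MP * ec_cubic E1 m x1 z.

Definition Opt : 'rV[ku]_3 := pt 1 (u ^+ 2) 0.

(* p^+ for s = false and p^- for s = true: the numerator of
   phi_y(x1) - u^3, resp. phi_y(x1) + u^3, in k(u)(x1). *)
Definition ppm (s : bool) : {poly ku} :=
  fnum (ratfun_map (@ratC k) phi_y - ratC ((-1) ^+ s * u ^+ 3)).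

Section Geometric.
Variables (K : closedFieldType) (iota : {rmorphism ku -> K}).

Definition CuK : {mpoly K[3]} := map_mpoly iota Cu.
Definition OptK : 'rV[K]_3 := map_mx iota Opt.

Definition is_Obar (Obar : 'rV[K]_3) : Prop :=
  Obar != 0 /\
  intersection_divisor CuK (tangent_line CuK OptK) [:: OptK; OptK; Obar].

Definition ppm_roots (s : bool) : seq K :=
  sval (closed_field_poly_normal (map_poly iota (ppm s))).

Definition Qpts (s : bool) : seq 'rV[K]_3 :=
  [seq pt x (ratfun_eval (fun c => iota (ratC c)) phi_x x) 1
     | x <- ppm_roots s].

Definition prescribed (d : nat) (Obar : 'rV[K]_3) (s : bool) :
    seq 'rV[K]_3 :=
  if odd d then Qpts s ++ [:: OptK; Obar] else Qpts s.

End Geometric.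
End Cu.

(* Main.v *)
From HB Require Import structures.
Require Import Defs.
From mathcomp Require Import all_boot all_order all_algebra all_field.
From mathcomp Require Import generic_quotient fraction qpoly qfpoly mxpoly.
From mathcomp Require Import ring zify.

(** Why the theorem holds.

    Let F be the equation of C_u over an algebraically closed field K that
    contains k(u).  In the chart x1 - b z = 1 of the plane, with coordinates
    t = z and y = x2, F is a monic cubic in y over K[t], so that a form of
    degree l becomes, modulo F, a polynomial C = c0 + c1 y + c2 y^2 whose
    coefficients have degrees at most l, l - 1 and l - 2: there are 3 l free
    coefficients.  Let N in K[t] be the norm of C from K[t][y] / (F), and D its
    cofactor, so that C D = N modulo F.

    Existence.  The prescribed points impose 3 l - 1 linear conditions on the
    coefficients, and these conditions are defined over k(u): C vanishes at
    all the Q_i if and only if p^+- divides a polynomial that is linear in c0,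
    c1, c2.  Hence a nonzero triple exists over k(u) [exists_triple].  The count
    needs the degree of p^+-, that is, of phi_y.  First, d is the degree of
    the numerator of phi_x, because the powers of x1 below it form a basis of
    k(E1) over the pull-back of k(E2) [pullback_degree].  Then the
    equation of the isogeny, homogenized, says that a polynomial H of degree
    3 d, the product over K of three coprime factors of degree d, is A^2 g with
    A the numerator of phi_y and g a divisor of the cubic of E1.  If d is odd,
    every factor has a zero in common with g, whence deg g = 3; if d is even,
    deg g is even, and deg g = 0 would put E1[2] in the kernel [isog_sizes].

    The norm.  F is irreducible over K(x1), since a root would be a linear
    function transforming one cubic into u^6 times the other, which forces both
    j-invariants to be 0 [no_linear_map].  So N is not 0, and for all but
    finitely many b it has degree exactly 3 l.  The prescribed points have
    distinct t-coordinates t_i, thus N = nu (t - t_Q) Pi with Pi the product of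
    the t - t_i.  As N and Pi are defined over k(u) up to constants, t_Q is in
    k(u) [rational_last_root]; the point Q above t_Q, read off D, is then
    rational as well [residual_point].

    Independence of the curve.  Let B be another form of degree l through the
    prescribed points.  Modulo F, B D vanishes on the fibres over the t_i, so
    it is Pi L with L the equation of a line by degree bounds.  Multiplying by
    C gives nu (t - t_Q) B = C L, and then L must be a constant times t - t_Q:
    modulo F, B is a constant times C [unique_up_to_scalar].  Therefore
    every admissible curve that does not contain C_u has the local intersections
    of C, which are all of multiplicity one or two, according to the order of
    N [mult_one_local, mult_two_local].

    The argument needs that the projection to t is unramified at the prescribed
    points.  At the Q_i this comes from transcendence: phi_y(x1) = +- u^3 makes
    x1 transcendental over k, so p^+- has simple roots and the points avoid the
    vertical tangents [transc_root, ppm_root_point].  O-bar is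
    explicit: with both cubics depressed, the tangent at O is X2 = u^2 X1 and
    the third point is obtained from a linear equation [obar_on, is_ObarP]. *)

Set Implicit Arguments.
Unset Strict Implicit.
Unset Printing Implicit Defensive.

Import GRing.Theory.
Local Open Scope ring_scope.

(** * Algebra of a monic cubic *)

HB.lock Definition cub (R : comNzRingType) (p q r : R) : {poly R} :=
  'X^3 + p%:P * 'X^2 + q%:P * 'X + r%:P.
HB.lock Definition quad (R : comNzRingType) (c0 c1 c2 : R) : {poly R} :=
  c0%:P + c1%:P * 'X + c2%:P * 'X^2.

(** D = adj0 + adj1 y + adj2 y^2 is the cofactor of C = c0 + c1 y + c2 y^2 modulo
    the cubic, and nrm the norm N of C: they come from the adjugate and the
    determinant of multiplication by C, and satisfy C D = N. *)
HB.lock Definition adj0 (R : comNzRingType) (p q r c0 c1 c2 : R) : R :=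
  (c0 - q * c2) * (c0 - q * c2 - p * (c1 - p * c2))
  - (c1 - p * c2) * (- r * c2 - q * (c1 - p * c2)).
HB.lock Definition adj1 (R : comNzRingType) (p q r c0 c1 c2 : R) : R :=
  c2 * (- r * c2 - q * (c1 - p * c2))
  - c1 * (c0 - q * c2 - p * (c1 - p * c2)).
HB.lock Definition adj2 (R : comNzRingType) (p q r c0 c1 c2 : R) : R :=
  c1 * (c1 - p * c2) - c2 * (c0 - q * c2).
HB.lock Definition nrm (R : comNzRingType) (p q r c0 c1 c2 : R) : R :=
  c0 * adj0 p q r c0 c1 c2 - r * c2 * adj1 p q r c0 c1 c2
  - r * (c1 - p * c2) * adj2 p q r c0 c1 c2.

Section CubicAlgebra.
Variable R : comNzRingType.
Implicit Types p q r : R.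

(** Reduction of a product: the coefficients of y^3 and y^4 are eliminated
    with the equation of the cubic. *)
Definition mulq0 p q r (a0 a1 a2 b0 b1 b2 : R) : R :=
  a0 * b0 - r * (a1 * b2 + a2 * b1) + p * r * (a2 * b2).
Definition mulq1 p q r (a0 a1 a2 b0 b1 b2 : R) : R :=
  a0 * b1 + a1 * b0 - q * (a1 * b2 + a2 * b1) + (p * q - r) * (a2 * b2).
Definition mulq2 p q r (a0 a1 a2 b0 b1 b2 : R) : R :=
  a0 * b2 + a1 * b1 + a2 * b0 - p * (a1 * b2 + a2 * b1)
  + (p ^+ 2 - q) * (a2 * b2).

Lemma quadM p q r (a0 a1 a2 b0 b1 b2 : R) :
  quad a0 a1 a2 * quad b0 b1 b2 =
  quad (mulq0 p q r a0 a1 a2 b0 b1 b2) (mulq1 p q r a0 a1 a2 b0 b1 b2)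
       (mulq2 p q r a0 a1 a2 b0 b1 b2)
  + cub p q r * ((a1 * b2 + a2 * b1 - p * (a2 * b2))%:P + (a2 * b2)%:P * 'X).
Proof.
rewrite quad.unlock cub.unlock /mulq0 /mulq1 /mulq2 !(polyCD, polyCM, polyCB, polyCN).
by rewrite ?polyC_exp; ring.
Qed.

Lemma quad_adj p q r (c0 c1 c2 : R) :
  quad c0 c1 c2 * quad (adj0 p q r c0 c1 c2) (adj1 p q r c0 c1 c2)
                       (adj2 p q r c0 c1 c2) =
  (nrm p q r c0 c1 c2)%:P + cub p q r *
  ((c1 * adj2 p q r c0 c1 c2 + c2 * adj1 p q r c0 c1 c2
    - p * (c2 * adj2 p q r c0 c1 c2))%:P + (c2 * adj2 p q r c0 c1 c2)%:P * 'X).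
Proof.
rewrite (quadM p q r); congr (_ + _).
have -> : mulq0 p q r c0 c1 c2 (adj0 p q r c0 c1 c2) (adj1 p q r c0 c1 c2)
                       (adj2 p q r c0 c1 c2) = nrm p q r c0 c1 c2.
  by rewrite /mulq0 nrm.unlock adj0.unlock adj1.unlock adj2.unlock; ring.
have -> : mulq1 p q r c0 c1 c2 (adj0 p q r c0 c1 c2) (adj1 p q r c0 c1 c2)
                       (adj2 p q r c0 c1 c2) = 0.
  by rewrite /mulq1 adj0.unlock adj1.unlock adj2.unlock; ring.
have -> : mulq2 p q r c0 c1 c2 (adj0 p q r c0 c1 c2) (adj1 p q r c0 c1 c2)
                       (adj2 p q r c0 c1 c2) = 0.
  by rewrite /mulq2 adj0.unlock adj1.unlock adj2.unlock; ring.
by rewrite quad.unlock !mul0r !addr0.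
Qed.

Lemma size_quad (c0 c1 c2 : R) : (size (quad c0 c1 c2) <= 3)%N.
Proof.
have -> : quad c0 c1 c2 = Poly [:: c0; c1; c2].
  by rewrite /= !cons_poly_def quad.unlock; ring.
exact: size_Poly.
Qed.

Lemma cub_monic p q r : cub p q r \is monic.
Proof.
have h : (size (quad r q p) < size ('X^3 : {poly R}))%N.
  by rewrite size_polyXn ltnS size_quad.
have -> : cub p q r = 'X^3 + quad r q p by rewrite cub.unlock quad.unlock; ring.
by rewrite monicE lead_coefDl // lead_coefXn.
Qed.

Lemma size_cub p q r : size (cub p q r) = 4.
Proof.
have h : (size (quad r q p) < size ('X^3 : {poly R}))%N.
  by rewrite size_polyXn ltnS size_quad.
have -> : cub p q r = 'X^3 + quad r q p by rewrite cub.unlock quad.unlock; ring.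
by rewrite size_polyDl // size_polyXn.
Qed.

Lemma coef_quad (c0 c1 c2 : R) :
  ((quad c0 c1 c2)`_0 = c0) * ((quad c0 c1 c2)`_1 = c1) *
  ((quad c0 c1 c2)`_2 = c2).
Proof.
by rewrite quad.unlock !coefD !coefCM !coefC !coefXn !coefX /= !(mulr0, mulr1, addr0, add0r).
Qed.

Lemma quad_eq0 (c0 c1 c2 : R) : quad c0 c1 c2 = 0 -> [/\ c0 = 0, c1 = 0 & c2 = 0].
Proof.
by move=> e; split; rewrite -(coef_quad c0 c1 c2) e coef0.
Qed.

(** A nonzero multiple of the cubic has degree at least 3. *)
Lemma quad_cub0 p q r (c0 c1 c2 : R) h :
  quad c0 c1 c2 = cub p q r * h -> [/\ c0 = 0, c1 = 0 & c2 = 0].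
Proof.
move=> e; apply: quad_eq0; rewrite e.
case: (eqVneq h 0) => [->|h0]; first by rewrite mulr0.
have := size_quad c0 c1 c2; rewrite e size_monicM ?cub_monic // size_cub.
by move: h0; rewrite -size_poly_gt0; lia.
Qed.

End CubicAlgebra.

Section Fibre.
Variable K : fieldType.
Variables p q r c0 c1 c2 : K.
Let F := cub p q r.
Let C := quad c0 c1 c2.
Let d0 := adj0 p q r c0 c1 c2.
Let d1 := adj1 p q r c0 c1 c2.
Let d2 := adj2 p q r c0 c1 c2.
Let D := quad d0 d1 d2.
Let n := nrm p q r c0 c1 c2.

(** When its adjugate vanishes, multiplication by C has rank at most one, so
    that y C is a multiple of C modulo F: this gives the linear factor. *)
Lemma adj_eq0_factor : d0 = 0 -> d1 = 0 -> d2 = 0 -> C != 0 ->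
  c2 != 0 /\ F = ('X - (c1 / c2 - p)%:P) * (c2^-1 *: C).
Proof.
rewrite /d0 /d1 /d2 /C /F => h0 h1 h2 C0.
have [c20|c20] := eqVneq c2 0.
  move: h0 h1 h2; rewrite adj0.unlock adj2.unlock c20 !(mulr0, mul0r, subr0).
  move=> h0 _ /eqP; rewrite mulf_eq0 orbb => /eqP c10.
  move: h0; rewrite c10 !(mulr0, mul0r, subr0) => /eqP.
  rewrite mulf_eq0 orbb => /eqP c00.
  by move: C0; rewrite c00 c10 c20 quad.unlock !mul0r !addr0 eqxx.
split=> //; set s := c1 / c2; pose w := c0 / c2.
have e1 : c1 = s * c2 by rewrite divfK.
have e0 : c0 = w * c2 by rewrite divfK.
have hq : q = w - s * (s - p).
  apply/eqP; rewrite -subr_eq0 -(mulrI_eq0 _ (mulfI (expf_neq0 2 c20))) -h2.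
  by apply/eqP; rewrite adj2.unlock e0 e1; ring.
have hr : r = (p - s) * w.
  apply/eqP; rewrite -subr_eq0 -(mulrI_eq0 _ (mulfI (expf_neq0 2 c20))).
  rewrite -oppr_eq0 -h1; apply/eqP.
  by rewrite adj1.unlock e0 e1 hq; ring.
have -> : c2^-1 *: quad c0 c1 c2 = quad w s 1.
  rewrite quad.unlock !scalerDr -!mul_polyC !mulrA -!polyCM mulVf // /w /s.
  by rewrite ![_ / c2]mulrC.
by rewrite hq hr cub.unlock quad.unlock !(polyCB, polyCM, polyCD); ring.
Qed.

Lemma dvd_adj : n = 0 -> F %| C * D.
Proof.
rewrite /n /F /C /D /d0 /d1 /d2 => n0.
by rewrite quad_adj n0 add0r dvdp_mulr.
Qed.

Lemma dvd_quad b0 b1 b2 : F %| quad b0 b1 b2 -> quad b0 b1 b2 = 0.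
Proof.
case/dvdpP=> h; rewrite mulrC => /(quad_cub0) [-> -> ->].
by rewrite quad.unlock !mul0r !addr0.
Qed.

End Fibre.

Section ClosedFibre.
Variable K : closedFieldType.
Variables p q r c0 c1 c2 : K.
Let F := cub p q r.
Let C := quad c0 c1 c2.
Let d0 := adj0 p q r c0 c1 c2.
Let d1 := adj1 p q r c0 c1 c2.
Let d2 := adj2 p q r c0 c1 c2.
Let D := quad d0 d1 d2.
Let n := nrm p q r c0 c1 c2.

(** If D = 0 then C is a scalar times a factor of F, and otherwise F does not
    divide D although it divides C D. *)
Lemma exists_common_root : n = 0 -> exists y, root F y && root C y.
Proof.
move=> n0; have sF : size F = 4 by exact: size_cub.
have ex (f : {poly K}) : size f != 1 -> exists y, root f y.
  by move=> /closed_rootP.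
have : size (gcdp F C) != 1.
  apply/negP=> cFC; have cop : coprimep F C by [].
  have := dvd_adj n0; rewrite Gauss_dvdpr // => /dvd_quad /quad_eq0 [z0 z1 z2].
  have [C0|C0] := eqVneq C 0; first by move: cFC; rewrite C0 gcdp0 sF.
  have [c20 eF] := adj_eq0_factor z0 z1 z2 C0.
  have : C %| F by rewrite /F eF dvdp_mull // dvdpZr // invr_eq0.
  move/dvdp_gcd_idr/eqp_size; rewrite (eqP cFC) => sC.
  have : C`_2 = 0 by rewrite nth_default // -sC.
  by rewrite /C !coef_quad => /eqP; rewrite (negPf c20).
by case/ex=> y; rewrite root_gcd => yr; exists y.
Qed.

(** Otherwise the gcd of F and C is C, of degree 2, and computing D from the
    factorization of F gives 0. *)
Lemma bezout_fibre y : n = 0 -> D != 0 -> root F y -> root C y ->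
  exists u v, 'X - y%:P = u * F + v * C.
Proof.
move=> n0 D0 rF rC.
have C0 : C != 0.
  apply: contraNneq D0 => /quad_eq0 [z0 z1 z2].
  rewrite /D /d0 /d1 /d2 adj0.unlock adj1.unlock adj2.unlock z0 z1 z2.
  by rewrite !(mulr0, mul0r, subr0, add0r, addr0, oppr0) quad.unlock !mul0r !addr0.
have g0 : gcdp F C != 0 by rewrite gcdp_eq0 (negPf C0) andbF.
have dg : 'X - y%:P %| gcdp F C by rewrite dvdp_gcd !dvdp_XsubCl rF.
have eg : 'X - y%:P %= gcdp F C.
  rewrite -(dvdp_size_eqp dg) size_XsubC eqn_leq.
  rewrite -{1}(size_XsubC y) dvdp_leq //= leqNgt; apply: contra D0 => sg.
  have dC : C %| F.
    have : gcdp F C %= C.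
      rewrite -(dvdp_size_eqp (dvdp_gcdr F C)) eqn_leq dvdp_leq ?dvdp_gcdr //=.
      exact: leq_trans (size_quad _ _ _) sg.
    by move/eqp_dvdl <-; rewrite dvdp_gcdl.
  have sC : size C = 3.
    apply/eqP; rewrite eqn_leq size_quad /=.
    by apply: leq_trans sg _; rewrite dvdp_leq ?dvdp_gcdr.
  have c20 : c2 != 0.
    by have := coef_quad c0 c1 c2 => -[_ <-]; rewrite -lead_coef_eq0 /lead_coef sC in C0.
  (* C divides F, so that q and r are functions of p and of the ratios s, w *)
  case/dvdpP: dC => h eF.
  pose s := c1 / c2; pose w := c0 / c2.
  have e1 : c1 = s * c2 by rewrite divfK.
  have e0 : c0 = w * c2 by rewrite divfK.
  have eq2 : F - ('X + (p - s)%:P) * (c2^-1 *: C) =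
    quad (r - (p - s) * w) (q - w - (p - s) * s) 0.
    have -> : c2^-1 *: C = quad w s 1.
      rewrite /C quad.unlock !scalerDr -!mul_polyC !mulrA -!polyCM mulVf // /w /s.
      by rewrite ![_ / c2]mulrC.
    by rewrite /F cub.unlock quad.unlock !(polyCB, polyCM, polyCD); ring.
  have : quad (r - (p - s) * w) (q - w - (p - s) * s) 0 = 0.
    rewrite -eq2; apply/eqP; rewrite -size_poly_eq0 -leqn0 leqNgt.
    apply/negP => pos.
    have : C %| F - ('X + (p - s)%:P) * (c2^-1 *: C).
      by rewrite dvdp_sub // ?eF ?dvdp_mull // dvdpZr // invr_eq0.
    move/dvdp_leq; rewrite -size_poly_gt0 pos sC => /(_ isT).
    rewrite eq2 ltnNge; case/negP.
    rewrite quad.unlock mul0r addr0; apply: leq_trans (size_polyD _ _) _.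
    rewrite geq_max (leq_trans (size_polyC_leq1 _)) //.
    by apply: leq_trans (size_polyMleq _ _) _; rewrite size_polyX addn2 ltnS size_polyC_leq1.
  case/quad_eq0 => hr hq _.
  have {}hr : r = (p - s) * w by apply/eqP; rewrite -subr_eq0 hr.
  have {}hq : q = w + (p - s) * s.
    by apply/eqP; rewrite -subr_eq0 opprD addrA hq.
  rewrite /D /d0 /d1 /d2 adj0.unlock adj1.unlock adj2.unlock e0 e1 hq hr.
  apply/eqP/polyP=> i; rewrite quad.unlock.
  have -> : forall a b c : K, a = 0 -> b = 0 -> c = 0 ->
     a%:P + b%:P * 'X + c%:P * 'X^2 = 0 :> {poly K}.
    by move=> a b c -> -> ->; rewrite !mul0r !addr0.
  - by [].
  - by ring.
  - by ring.
  - by ring.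
have [[u v] /= uv] := Bezoutp F C.
move: uv; rewrite -(eqp_rtrans eg) => /eqpP [[a b] /= /andP[a0 b0] e].
exists ((a / b) *: u), ((a / b) *: v).
rewrite -!scalerAl -scalerDr mulrC -scalerA e scalerA mulVf ?scale1r //.
Qed.

End ClosedFibre.

(** * Fibres, evaluation and degree bounds *)

Section QuadLinear.
Variable R : comNzRingType.

Lemma quadZ (a c0 c1 c2 : R) : quad (a * c0) (a * c1) (a * c2) = a%:P * quad c0 c1 c2.
Proof. by rewrite quad.unlock !polyCM; ring. Qed.

Lemma quadC (c0 : R) : quad c0 0 0 = c0%:P.
Proof. by rewrite quad.unlock !mul0r !addr0. Qed.

Lemma quadB (a0 a1 a2 b0 b1 b2 : R) :
  quad (a0 - b0) (a1 - b1) (a2 - b2) = quad a0 a1 a2 - quad b0 b1 b2.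
Proof. by rewrite quad.unlock !polyCB; ring. Qed.
End QuadLinear.

Section FibreMap.
Variable K : fieldType.
Implicit Types (t y : K) (G : {poly {poly K}}).

(** For polynomials in y over K[t]: fib t is the restriction to the line over t,
    and ev t y the value at a point. *)
Definition fib t : {poly {poly K}} -> {poly K} := map_poly (horner_eval t).
HB.instance Definition _ t := GRing.RMorphism.copy (fib t) (map_poly (horner_eval t)).

Lemma fibC t (a : {poly K}) : fib t a%:P = (a.[t])%:P.
Proof. by rewrite /fib map_polyC. Qed.

Lemma fibX t : fib t 'X = 'X.
Proof. by rewrite /fib map_polyX. Qed.

Lemma fibD t G H : fib t (G + H) = fib t G + fib t H.
Proof. exact: rmorphD. Qed.
Lemma fibN t G : fib t (- G) = - fib t G.
Proof. exact: rmorphN. Qed.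
Lemma fibM t G H : fib t (G * H) = fib t G * fib t H.
Proof. exact: rmorphM. Qed.
Lemma fib1 t : fib t 1 = 1.
Proof. exact: rmorph1. Qed.
Definition fibE := (fibD, fibN, fibM, fib1, fibC, fibX).

Definition ev t y G := (fib t G).[y].
Lemma evD t y G H : ev t y (G + H) = ev t y G + ev t y H.
Proof. by rewrite /ev fibD hornerD. Qed.
Lemma evN t y G : ev t y (- G) = - ev t y G.
Proof. by rewrite /ev fibN hornerN. Qed.
Lemma evM t y G H : ev t y (G * H) = ev t y G * ev t y H.
Proof. by rewrite /ev fibM hornerM. Qed.
Lemma ev1 t y : ev t y 1 = 1.
Proof. by rewrite /ev fib1 hornerC. Qed.
Lemma evC t y (a : {poly K}) : ev t y a%:P = a.[t].
Proof. by rewrite /ev fibC hornerC. Qed.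
Lemma evX t y : ev t y 'X = y.
Proof. by rewrite /ev fibX hornerX. Qed.
Lemma root_fib t y G : root (fib t G) y = (ev t y G == 0).
Proof. by []. Qed.
Lemma ev_fib t y G : ev t y G = (fib t G).[y].
Proof. by []. Qed.
Definition evE := (evD, evN, evM, ev1, evC, evX).

Lemma fib_cub t p q r : fib t (cub p q r) = cub p.[t] q.[t] r.[t].
Proof. by rewrite cub.unlock !(rmorphD, rmorphM, rmorphXn) /= !fibC !fibX. Qed.

Lemma fib_quad t c0 c1 c2 : fib t (quad c0 c1 c2) = quad c0.[t] c1.[t] c2.[t].
Proof. by rewrite quad.unlock !(rmorphD, rmorphM, rmorphXn) /= !fibC !fibX. Qed.

Lemma fib_lift t (g : {poly K}) : fib t (map_poly polyC g) = g.
Proof.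
apply/polyP=> i; rewrite /fib -map_poly_comp coef_map_id0 /= /horner_eval ?hornerC //.
Qed.

Lemma fib_eq0 t G : fib t G = 0 -> exists H, G = ('X - t%:P)%:P * H.
Proof.
move=> e; exists (map_poly (fun g => g %/ ('X - t%:P)) G).
apply/polyP => i; rewrite coefCM coef_map_id0 ?div0p // mulrC divpK //.
by rewrite dvdp_XsubCl /root; have /polyP/(_ i) := e; rewrite coef_map coef0 /= /horner_eval => ->.
Qed.

Variables p q r : {poly K}.

(** The remainder of G in the division by the monic cubic is killed by the
    nonzero polynomial a. *)
Lemma cub_cancel (a : {poly K}) G H :
  a != 0 -> a%:P * G = cub p q r * H -> exists H', G = cub p q r * H'.
Proof.
move=> a0 e; have mF := cub_monic p q r.
have eG := Pdiv.RingMonic.rdivp_eq mF G; set Q := Pdiv.Ring.rdivp _ _ in eG.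
set S := Pdiv.Ring.rmodp _ _ in eG.
suff S0 : S = 0 by exists Q; rewrite {1}eG S0 addr0 mulrC.
have sS : (size S < size (cub p q r))%N.
  by apply: Pdiv.Ring.ltn_rmodpN0; rewrite // monic_neq0.
have eS : a%:P * S = cub p q r * (H - a%:P * Q).
  rewrite mulrBr -e {1}eG; ring.
apply/eqP; rewrite -(mulrI_eq0 _ (mulfI (_ : a%:P != 0))) ?polyC_eq0 // eS.
have [->|n0] := eqVneq (H - a%:P * Q) 0; first by rewrite mulr0.
have : (size (a%:P * S)%R < size (cub p q r))%N.
  by rewrite mul_polyC (leq_ltn_trans (size_scale_leq _ _)).
rewrite eS size_monicM // size_cub; move: n0; rewrite -size_poly_gt0.
by case: (size _) => // s _; rewrite addnS /= addSn !ltnS ltnNge leq_addr.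
Qed.

End FibreMap.

Section Norms.
Variable K : fieldType.
Variables (p q r c0 c1 c2 : {poly K}) (t : K).

Lemma horner_adj0 :
  (adj0 p q r c0 c1 c2).[t] = adj0 p.[t] q.[t] r.[t] c0.[t] c1.[t] c2.[t].
Proof. by rewrite adj0.unlock !(hornerE, hornerM). Qed.
Lemma horner_adj1 :
  (adj1 p q r c0 c1 c2).[t] = adj1 p.[t] q.[t] r.[t] c0.[t] c1.[t] c2.[t].
Proof. by rewrite adj1.unlock !(hornerE, hornerM). Qed.
Lemma horner_adj2 :
  (adj2 p q r c0 c1 c2).[t] = adj2 p.[t] q.[t] r.[t] c0.[t] c1.[t] c2.[t].
Proof. by rewrite adj2.unlock !(hornerE, hornerM). Qed.
Lemma horner_nrm :
  (nrm p q r c0 c1 c2).[t] = nrm p.[t] q.[t] r.[t] c0.[t] c1.[t] c2.[t].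
Proof. by rewrite nrm.unlock adj0.unlock adj1.unlock adj2.unlock !hornerE. Qed.
End Norms.

Section Tops.
Variable K : fieldType.
Implicit Types f g : {poly K}.

Definition topd (m : nat) (x : K) f := (size f <= m.+1)%N /\ f`_m = x.

Lemma topdM m n x y f g : topd m x f -> topd n y g -> topd (m + n) (x * y) (f * g).
Proof.
move=> [sf <-] [sg <-]; split.
  apply: leq_trans (size_polyMleq _ _) _; lia.
rewrite coefM (bigD1 (inord m)) //= inordK ?ltnS ?leq_addr // addKn.
rewrite big1 ?addr0 // => i.
rewrite -val_eqE /= inordK ?ltnS ?leq_addr // => im.
have [lt|] := ltnP m i; first by rewrite nth_default ?mul0r //; exact: leq_trans lt.
by move=> le; rewrite [g`_ _]nth_default ?mulr0 //; apply: leq_trans sg _; lia.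
Qed.

Lemma topdD m x y f g : topd m x f -> topd m y g -> topd m (x + y) (f + g).
Proof.
move=> [sf <-] [sg <-]; split; last by rewrite coefD.
by apply: leq_trans (size_polyD _ _) _; rewrite geq_max sf.
Qed.

Lemma topdN m x f : topd m x f -> topd m (- x) (- f).
Proof. by move=> [sf <-]; split; rewrite ?size_polyN ?coefN. Qed.

(** In a form of degree m, the coefficient of y^s has degree at most m - s.  A
    negative degree means zero: forms of degree 1 have no coefficient in y^2. *)
Definition wtop (m s : nat) (x : K) f :=
  (f = 0 /\ x = 0) \/ ((s <= m)%N /\ topd (m - s) x f).

Lemma wtop_eq m s m' s' x x' f :
  wtop m s x f -> (m + s' = m' + s)%N -> x = x' -> wtop m' s' x' f.
Proof.
move=> h e <-; case: h => [h|[le h]]; [by left|right].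
by split; [lia | have <- : (m - s = m' - s')%N by lia].
Qed.

Lemma wtopM m s m' s' x y f g :
  wtop m s x f -> wtop m' s' y g -> wtop (m + m') (s + s') (x * y) (f * g).
Proof.
case=> [[-> ->] _|[le h]]; first by left; rewrite !mul0r.
case=> [[-> ->]|[le' h']]; first by left; rewrite !mulr0.
right; split; first by lia.
have -> : (m + m' - (s + s') = m - s + (m' - s'))%N by lia.
exact: topdM.
Qed.

Lemma topd0 m : topd m 0 0.
Proof. by split; rewrite ?size_poly0 ?coef0. Qed.

Lemma wtopD m s x y f g : wtop m s x f -> wtop m s y g -> wtop m s (x + y) (f + g).
Proof.
case=> [[-> ->]|[le h]]; first by rewrite !add0r.
case=> [[-> ->]|[_ h']]; first by rewrite !addr0; right.
by right; split=> //; apply: topdD.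
Qed.

Lemma wtopN m s x f : wtop m s x f -> wtop m s (- x) (- f).
Proof.
case=> [[-> ->]|[le h]]; first by left; rewrite !oppr0.
by right; split=> //; apply: topdN.
Qed.

Lemma wtop_size m s x f : wtop m s x f -> (size f + s <= m.+1)%N \/ f = 0.
Proof. by case=> [[-> _]|[le [h _]]]; [right | left; lia]. Qed.

Lemma wtopD' m s m1 s1 m2 s2 x y f g :
  wtop m1 s1 x f -> wtop m2 s2 y g -> (m + s1 = m1 + s)%N -> (m + s2 = m2 + s)%N ->
  wtop m s (x + y) (f + g).
Proof.
move=> h1 h2 e1 e2; apply: wtopD.
- by apply: (wtop_eq h1 _ erefl); lia.
- by apply: (wtop_eq h2 _ erefl); lia.
Qed.

Variables (p q r c0 c1 c2 : {poly K}) (p' q' r' c0' c1' c2' : K) (l : nat).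
Hypotheses (wp : wtop 1 0 p' p) (wq : wtop 2 0 q' q) (wr : wtop 3 0 r' r).
Hypotheses (w0 : wtop l 0 c0' c0) (w1 : wtop l 1 c1' c1) (w2 : wtop l 2 c2' c2).

Let wm1 : wtop l.+1 1 (c0' - q' * c2') (c0 - q * c2).
Proof. apply: wtopD'; [exact: w0 | apply: wtopN; apply: wtopM; [exact: wq|exact: w2] | lia | lia]. Qed.
Let wm2 : wtop l 1 (c1' - p' * c2') (c1 - p * c2).
Proof. apply: wtopD'; [exact: w1 | apply: wtopN; apply: wtopM; [exact: wp|exact: w2] | lia | lia]. Qed.
Let wm3 : wtop l.+2 1 (- r' * c2' - q' * (c1' - p' * c2')) (- r * c2 - q * (c1 - p * c2)).
Proof.
apply: wtopD'; [apply: wtopM; [apply: wtopN; exact: wr|exact: w2] |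
 apply: wtopN; apply: wtopM; [exact: wq|exact: wm2] | lia | lia].
Qed.
Let wm4 : wtop l.+2 2 (c0' - q' * c2' - p' * (c1' - p' * c2')) (c0 - q * c2 - p * (c1 - p * c2)).
Proof.
apply: wtopD'; [exact: wm1 | apply: wtopN; apply: wtopM; [exact: wp|exact: wm2] | lia | lia].
Qed.

Lemma wtop_adj0 : wtop (2 * l) 0 (adj0 p' q' r' c0' c1' c2') (adj0 p q r c0 c1 c2).
Proof.
rewrite adj0.unlock; apply: wtopD'; [apply: wtopM; [exact: wm1|exact: wm4] |
 apply: wtopN; apply: wtopM; [exact: wm2|exact: wm3] | lia | lia].
Qed.
Lemma wtop_adj1 : wtop (2 * l) 1 (adj1 p' q' r' c0' c1' c2') (adj1 p q r c0 c1 c2).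
Proof.
rewrite adj1.unlock; apply: wtopD'; [apply: wtopM; [exact: w2|exact: wm3] |
 apply: wtopN; apply: wtopM; [exact: w1|exact: wm4] | lia | lia].
Qed.
Lemma wtop_adj2 : wtop (2 * l) 2 (adj2 p' q' r' c0' c1' c2') (adj2 p q r c0 c1 c2).
Proof.
rewrite adj2.unlock; apply: wtopD'; [apply: wtopM; [exact: w1|exact: wm2] |
 apply: wtopN; apply: wtopM; [exact: w2|exact: wm1] | lia | lia].
Qed.
(** Bezout's bound for a cubic and a curve of degree l.  The top coefficient is
    the norm on the line at infinity of the chart. *)
Lemma wtop_nrm : wtop (3 * l) 0 (nrm p' q' r' c0' c1' c2') (nrm p q r c0 c1 c2).
Proof.
rewrite nrm.unlock; apply: (@wtopD' _ _ (3 * l) 0 (3 * l).+2 2); first last.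
- by lia.
- by lia.
- apply: wtopN; apply: (wtop_eq (wtopM (wtopM wr wm2) wtop_adj2)) => //; lia.
- apply: (@wtopD' _ _ (3 * l) 0 (3 * l) 0); first last.
  + by lia.
  + by lia.
  + apply: wtopN; apply: (wtop_eq (wtopM (wtopM wr w2) wtop_adj1)) => //; lia.
  + apply: (wtop_eq (wtopM w0 wtop_adj0)) => //; lia.
Qed.

Variables (b0 b1 b2 : {poly K}) (b0' b1' b2' : K) (m : nat).
Hypotheses (v0 : wtop m 0 b0' b0) (v1 : wtop m 1 b1' b1) (v2 : wtop m 2 b2' b2).

Let ws3 : wtop (m + l) 3 (c1' * b2' + c2' * b1') (c1 * b2 + c2 * b1).
Proof.
apply: wtopD'; [apply: wtopM; [exact: w1|exact: v2] |
  apply: wtopM; [exact: w2|exact: v1] | lia | lia].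
Qed.
Let ws4 : wtop (m + l) 4 (c2' * b2') (c2 * b2).
Proof. by rewrite [(m + l)%N]addnC; apply: (wtopM w2 v2). Qed.

Lemma wtop_mulq0 : exists x, wtop (m + l) 0 x (mulq0 p q r c0 c1 c2 b0 b1 b2).
Proof.
eexists; rewrite /mulq0; apply: (@wtopD' _ _ (m + l) 0 (m + l).+4 4); first last.
- by lia.
- by lia.
- apply: (wtop_eq (wtopM (wtopM wp wr) ws4)) => //; lia.
- apply: (@wtopD' _ _ (m + l) 0 (m + l).+3 3); first last.
  + by lia.
  + by lia.
  + apply: wtopN; apply: (wtop_eq (wtopM wr ws3)) => //; lia.
  + apply: (wtop_eq (wtopM w0 v0)) => //; lia.
Qed.

Lemma wtop_mulq1 : exists x, wtop (m + l) 1 x (mulq1 p q r c0 c1 c2 b0 b1 b2).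
Proof.
eexists; rewrite /mulq1; apply: (@wtopD' _ _ (m + l) 1 (m + l).+3 4); first last.
- by lia.
- by lia.
- have h : wtop 3 0 (p' * q' - r') (p * q - r).
    by apply: wtopD'; [apply: wtopM; [exact: wp|exact: wq]|apply: wtopN; exact: wr|lia|lia].
  apply: (wtop_eq (wtopM h ws4)) => //; lia.
- apply: (@wtopD' _ _ (m + l) 1 (m + l).+2 3); first last.
  + by lia.
  + by lia.
  + apply: wtopN; apply: (wtop_eq (wtopM wq ws3)) => //; lia.
  + apply: wtopD'; [apply: wtopM; [exact: w0|exact: v1] |
      apply: wtopM; [exact: w1|exact: v0] | lia | lia].
Qed.

Lemma wtop_mulq2 : exists x, wtop (m + l) 2 x (mulq2 p q r c0 c1 c2 b0 b1 b2).
Proof.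
eexists; rewrite /mulq2; apply: (@wtopD' _ _ (m + l) 2 (m + l).+2 4); first last.
- by lia.
- by lia.
- have h : wtop 2 0 (p' ^+ 2 - q') (p ^+ 2 - q).
    by apply: wtopD'; [apply: wtopM; exact: wp|apply: wtopN; exact: wq|lia|lia].
  apply: (wtop_eq (wtopM h ws4)) => //; lia.
- apply: (@wtopD' _ _ (m + l) 2 (m + l).+1 3); first last.
  + by lia.
  + by lia.
  + apply: wtopN; apply: (wtop_eq (wtopM wp ws3)) => //; lia.
  + apply: (@wtopD' _ _ (m + l) 2 (m + l) 2); first last.
    * by lia.
    * by lia.
    * apply: (wtop_eq (wtopM w2 v0)) => //; lia.
    * apply: wtopD'; [apply: wtopM; [exact: w0|exact: v2] |
      apply: wtopM; [exact: w1|exact: v1] | lia | lia].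
Qed.
End Tops.

(** * Local intersection in a chart *)

Section LocalConditions.
Variable K : fieldType.

Definition common t y (F C : {poly {poly K}}) := (ev t y F == 0) && (ev t y C == 0).

(** The ideal generated by F and C in the local ring at (t, y); the element e
    clears denominators. *)
Definition inI (F C : {poly {poly K}}) t y (g : {poly {poly K}}) : Prop :=
  exists e a b, ev t y e != 0 /\ e * g = a * F + b * C.

End LocalConditions.

Section Core.
Variable K : closedFieldType.
Variables (p q r c0 c1 c2 : {poly K}).
Local Notation F := (cub p q r).
Local Notation C := (quad c0 c1 c2).
Local Notation d0 := (adj0 p q r c0 c1 c2).
Local Notation d1 := (adj1 p q r c0 c1 c2).
Local Notation d2 := (adj2 p q r c0 c1 c2).
Local Notation D := (quad d0 d1 d2).
Local Notation N := (nrm p q r c0 c1 c2).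

Definition adj_vanishes t := [&& d0.[t] == 0, d1.[t] == 0 & d2.[t] == 0].

Lemma adjE : exists h, C * D = N%:P + F * h.
Proof. by eexists; apply: quad_adj. Qed.

Lemma fibDE t : fib t D = quad (adj0 p.[t] q.[t] r.[t] c0.[t] c1.[t] c2.[t])
   (adj1 p.[t] q.[t] r.[t] c0.[t] c1.[t] c2.[t]) (adj2 p.[t] q.[t] r.[t] c0.[t] c1.[t] c2.[t]).
Proof. by rewrite fib_quad horner_adj0 horner_adj1 horner_adj2. Qed.

Lemma adj_vanishesE t : adj_vanishes t = (fib t D == 0).
Proof.
apply/and3P/eqP=> [[/eqP e0 /eqP e1 /eqP e2]|]; rewrite fib_quad.
  by rewrite e0 e1 e2 quadC polyC0.
by case/quad_eq0=> -> -> ->.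
Qed.

Lemma common_nrm t y : common t y F C -> N.[t] = 0.
Proof.
case/andP=> /eqP rF /eqP rC; have [h e] := adjE.
by have := congr1 (ev t y) e; rewrite !evE rF rC !mul0r addr0.
Qed.

Lemma nrm_common t : N.[t] = 0 -> exists y, common t y F C.
Proof.
rewrite horner_nrm => /exists_common_root [y h]; exists y.
by rewrite /common -!root_fib fib_cub fib_quad.
Qed.

(** A Bezout identity on the fibre, lifted to an identity up to t - t0. *)
Lemma fib_bezout t y : ~~ adj_vanishes t -> common t y F C ->
  exists u v h, u * F + v * C = 'X - y%:P%:P + ('X - t%:P)%:P * h.
Proof.
move=> D0 cy; have := common_nrm cy; rewrite horner_nrm => n0.
case/andP: cy; rewrite -!root_fib fib_cub fib_quad => rF rC.
have D0' : quad (adj0 p.[t] q.[t] r.[t] c0.[t] c1.[t] c2.[t])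
   (adj1 p.[t] q.[t] r.[t] c0.[t] c1.[t] c2.[t]) (adj2 p.[t] q.[t] r.[t] c0.[t] c1.[t] c2.[t]) != 0.
  by move: D0; rewrite adj_vanishesE fibDE.
have [u [v uv]] := bezout_fibre n0 D0' rF rC.
set u' := map_poly polyC u; set v' := map_poly polyC v.
have [h eh] : exists h, u' * F + v' * C - ('X - y%:P%:P) = ('X - t%:P)%:P * h.
  apply: fib_eq0; rewrite !fibE !fib_lift fib_cub fib_quad -uv hornerC.
  by rewrite subrr.
by exists u', v', h; rewrite -eh [RHS]addrC subrK.
Qed.

Lemma common_uniq t y y' : ~~ adj_vanishes t ->
  common t y F C -> common t y' F C -> y' = y.
Proof.
move=> D0 cy /andP[/eqP rF /eqP rC].
have [u [v [h]]] := fib_bezout D0 cy => /(congr1 (ev t y')).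
rewrite !evE rF rC !hornerE subrr ?(mulr0, mul0r, addr0, add0r).
by move/esym/eqP; rewrite subr_eq0 => /eqP.
Qed.

(** Dividing C D = N by t - t0 shows that N / (t - t0) is again in the ideal of F
    and C, so it vanishes where they meet over t0: the norm has a double zero. *)
Lemma adj_vanishes_factor t : adj_vanishes t ->
  exists e0 e1 e2 n1 h, [/\ D = ('X - t%:P)%:P * quad e0 e1 e2,
    N = ('X - t%:P) * n1, C * quad e0 e1 e2 = n1%:P + F * h &
    forall y, common t y F C -> n1.[t] = 0].
Proof.
case/and3P; rewrite -!rootE -!dvdp_XsubCl => /dvdpP[e0 h0] /dvdpP[e1 h1] /dvdpP[e2 h2].
set tau := 'X - t%:P in h0 h1 h2 *.
have eD : D = tau%:P * quad e0 e1 e2.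
  by rewrite h0 h1 h2 ![_ * tau]mulrC quadZ.
have [h eh] := adjE.
have eM := quadM p q r c0 c1 c2 e0 e1 e2.
set m0 := mulq0 _ _ _ _ _ _ _ _ _ in eM; set m1 := mulq1 _ _ _ _ _ _ _ _ _ in eM.
set m2 := mulq2 _ _ _ _ _ _ _ _ _ in eM; set h' := (X in F * X) in eM.
have : quad (tau * m0 - N) (tau * m1) (tau * m2) = F * (h - tau%:P * h').
  have -> : quad (tau * m0 - N) (tau * m1) (tau * m2) = tau%:P * quad m0 m1 m2 - N%:P.
    by rewrite -quadZ -quadC -quadB !subr0.
  have -> : N%:P = C * D - F * h by rewrite eh addrK.
  by rewrite eD [quad _ _ _ * (_ * _)]mulrCA eM; ring.
move/quad_cub0 => [z0 z1 z2].
have tau0 : tau != 0 by rewrite polyXsubC_eq0.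
have m10 : m1 = 0 by apply/eqP; move/eqP: z1; rewrite mulf_eq0 (negPf tau0).
have m20 : m2 = 0 by apply/eqP; move/eqP: z2; rewrite mulf_eq0 (negPf tau0).
have eCn : C * quad e0 e1 e2 = m0%:P + F * h'.
  by rewrite eM m10 m20 quadC.
exists e0, e1, e2, m0, h'; split=> //.
  by apply/eqP; rewrite eq_sym -subr_eq0 z0.
move=> y /andP[/eqP rF /eqP rC].
by have := congr1 (ev t y) eCn; rewrite !evE rF rC !mul0r addr0.
Qed.

Lemma inI_add t y g g' : inI F C t y g -> inI F C t y g' -> inI F C t y (g + g').
Proof.
move=> [e [a [b [e0 h]]]] [e' [a' [b' [e0' h']]]].
exists (e * e'), (e' * a + e * a'), (e' * b + e * b'); split.
  by rewrite evM mulf_neq0.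
have -> : e * e' * (g + g') = e' * (e * g) + e * (e' * g') by ring.
by rewrite h h'; ring.
Qed.

Lemma inI_mul t y g g' : inI F C t y g -> inI F C t y (g' * g).
Proof.
move=> [e [a [b [e0 h]]]]; exists e, (g' * a), (g' * b); split=> //.
by rewrite mulrCA h; ring.
Qed.

Lemma inI_unit t y g g' : ev t y g' != 0 -> inI F C t y (g' * g) -> inI F C t y g.
Proof.
move=> g0 [e [a [b [e0 h]]]]; exists (e * g'), a, b; split; last by rewrite -mulrA.
by rewrite evM mulf_neq0.
Qed.

Lemma inI_gen t y g a b : g = a * F + b * C -> inI F C t y g.
Proof.
move=> h; exists 1, a, b; split; last by rewrite mul1r.
by rewrite ev1 oner_neq0.
Qed.

(** The norm is in the ideal generated by F and C. *)
Lemma inI_nrm t y k n1 : N = ('X - t%:P) ^+ k * n1 -> n1.[t] != 0 ->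
  inI F C t y (('X - t%:P) ^+ k)%:P.
Proof.
move=> eN n0; apply: (@inI_unit _ _ _ n1%:P); first by rewrite evC.
have [h eh] := adjE; apply: (@inI_gen _ _ _ (- h) D).
by rewrite -polyCM mulrC -eN [D * C]mulrC eh; ring.
Qed.

(** A transversal intersection. *)
Definition mult_one t y := inI F C t y ('X - t%:P)%:P /\ inI F C t y ('X - y%:P%:P).

(** A simple tangency, with local parameter the first coordinate. *)
Definition mult_two t y :=
  [/\ inI F C t y (('X - t%:P) ^+ 2)%:P,
      exists h, inI F C t y ('X - y%:P%:P + ('X - t%:P)%:P * h)
    & ~ inI F C t y ('X - t%:P)%:P].

(** t - t0 is in the ideal by the order of the norm, and then y - y0 is by the
    Bezout identity of the fibre. *)
Lemma simple_zero t y n1 : N = ('X - t%:P) * n1 -> n1.[t] != 0 ->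
  common t y F C -> ~~ adj_vanishes t /\ mult_one t y.
Proof.
move=> eN n0 cy.
have nv : ~~ adj_vanishes t.
  apply: contra n0 => /adj_vanishes_factor [e0 [e1 [e2 [n2 [h [_ eN2 _ /(_ _ cy) z]]]]]].
  have tau0 : 'X - t%:P != 0 by rewrite polyXsubC_eq0.
  by move: eN2; rewrite eN => /(mulfI tau0) ->; rewrite z.
split=> //; have it : inI F C t y ('X - t%:P)%:P.
  by have := @inI_nrm t y 1 n1; rewrite expr1; apply.
split=> //; have [u [v [h e]]] := fib_bezout nv cy.
have -> : 'X - y%:P%:P = ('X - y%:P%:P + ('X - t%:P)%:P * h) + (- h) * ('X - t%:P)%:P by ring.
by apply: inI_add; [apply: inI_gen (esym e)|apply: inI_mul].
Qed.

(** If t - t0 were in the local ideal, D would vanish at the common root as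
    well as at the two other points of the fibre. *)
Lemma double_zero t y n1 : N = ('X - t%:P) ^+ 2 * n1 -> n1.[t] != 0 ->
  common t y F C -> (fib t F)^`().[y] != 0 -> ~~ adj_vanishes t -> mult_two t y.
Proof.
move=> eN n0 cy sm nv; split.
- exact: (inI_nrm (k := 2) _ eN).
- have [u [v [h e]]] := fib_bezout nv cy.
  by exists h; apply: inI_gen (esym e).
move=> [e [a [b [e0 eI]]]]; set tau := 'X - t%:P in eN eI.
have tau0 : tau != 0 by rewrite polyXsubC_eq0.
have [h eh] := adjE.
have [H eH] : exists H, e * D - b * tau%:P * n1%:P = F * H.
  apply: (@cub_cancel _ _ _ _ tau _ (a * D + b * h)) => //.
  have -> : tau%:P * (e * D - b * tau%:P * n1%:P) = (e * tau%:P) * D - b * (tau ^+ 2 * n1)%:P.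
    by rewrite !polyCM; ring.
  rewrite eI -eN; have -> : N%:P = C * D - F * h by rewrite eh addrK.
  by ring.
case/andP: (cy) => /eqP rF /eqP rC.
have Dy : ev t y D = 0.
  have := congr1 (ev t y) eH; rewrite !evE rF /tau !hornerE subrr.
  rewrite ?(mulr0, mul0r, subr0).
  by move/eqP; rewrite mulf_eq0 (negPf e0) => /eqP.
have [u [v [h' euv]]] := fib_bezout nv cy.
have dF : fib t F %| ('X - y%:P) * fib t D.
  have -> : ('X - y%:P) * fib t D = fib t (u * F * D + v * (C * D)).
    have -> : u * F * D + v * (C * D) = (u * F + v * C) * D by ring.
    by rewrite euv !fibE !hornerE subrr ?(polyC0, mul0r, addr0).
  rewrite eh !fibE eN /tau !hornerE subrr ?mul0r.
  rewrite expr0n mul0r polyC0 add0r; apply: dvdp_add; last by rewrite dvdp_mull ?dvdp_mulr.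
  by rewrite dvdp_mulr ?dvdp_mull.
have dFy : 'X - y%:P %| fib t F by rewrite dvdp_XsubCl root_fib rF.
case/dvdpP: dFy => F1 eF1.
have F1y : ~~ root F1 y.
  move: sm; rewrite eF1 derivM derivXsubC mulr1 !hornerE subrr mulr0 add0r.
  by rewrite rootE.
have dF1 : F1 %| fib t D.
  move: dF; rewrite eF1 [F1 * _]mulrC dvdp_mul2l ?polyXsubC_eq0 //.
have : fib t F %| fib t D.
  rewrite eF1 Gauss_dvdp ?dF1 ?dvdp_XsubCl /= ?root_fib ?Dy //.
  by rewrite coprimep_XsubC.
rewrite fibDE fib_cub => /dvd_quad; rewrite -fibDE => /eqP.
by rewrite -adj_vanishesE (negPf nv).
Qed.

End Core.

(** * The residual point *)

Lemma deriv_double (R : comNzRingType) (g : {poly R}) a :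
  ((('X - a%:P) ^+ 2 * g)^`()).[a] = 0.
Proof.
rewrite expr2 !derivM !derivXsubC !(hornerM, hornerD, hornerN).
by rewrite !(hornerX, hornerC) subrr !(mul0r, addr0, mulr0).
Qed.

Section Residual.
Variable K : closedFieldType.
Variables (p q r c0 c1 c2 : {poly K}) (l : nat) (pts : seq (K * K)) (nu tQ : K).
Local Notation F := (cub p q r).
Local Notation C := (quad c0 c1 c2).
Local Notation d0 := (adj0 p q r c0 c1 c2).
Local Notation d1 := (adj1 p q r c0 c1 c2).
Local Notation d2 := (adj2 p q r c0 c1 c2).
Local Notation D := (quad d0 d1 d2).
Local Notation N := (nrm p q r c0 c1 c2).
Local Notation vanishes := (adj_vanishes p q r c0 c1 c2).

Let Pi := \prod_(P <- pts) ('X - P.1%:P).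
Let cofac P := \prod_(R <- rem P pts) ('X - R.1%:P).

Hypothesis nu0 : nu != 0.
Hypothesis eN : N = nu%:P * Pi * ('X - tQ%:P).
Hypothesis upts : uniq [seq P.1 | P <- pts].
Hypothesis cpts : forall P, P \in pts -> common P.1 P.2 F C.
Hypothesis spts : forall P, P \in pts -> (fib P.1 F)^`().[P.2] != 0.

Lemma Pi_root t : Pi.[t] != 0 = (t \notin [seq P.1 | P <- pts]).
Proof.
rewrite horner_prod prodf_seq_neq0 -has_pred1 has_map -all_predC; apply: eq_all => P /=.
by rewrite !hornerE subr_eq0 eq_sym.
Qed.

Lemma PiE P : P \in pts -> Pi = ('X - P.1%:P) * cofac P.
Proof. by move=> h; rewrite /Pi (perm_big _ (perm_to_rem h)) big_cons. Qed.

Lemma cofac_neq0 P : P \in pts -> (cofac P).[P.1] != 0.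
Proof.
move=> h; have := upts; rewrite (perm_uniq (perm_map _ (perm_to_rem h))) /=.
case/andP=> n _; rewrite horner_prod prodf_seq_neq0.
rewrite -has_pred1 has_map -all_predC in n.
apply/allP => R /(allP n) /=.
by rewrite !hornerE subr_eq0 eq_sym.
Qed.

Lemma tau_neq0 t : 'X - t%:P != 0 :> {poly K}.
Proof. by rewrite polyXsubC_eq0. Qed.

(** The norm is a cubic form in the coefficients of C. *)
Lemma vanish_C0 t : fib t C = 0 -> exists n3, N = ('X - t%:P) ^+ 3 * n3.
Proof.
rewrite fib_quad => /quad_eq0 [/eqP h0 /eqP h1 /eqP h2].
move: h0 h1 h2; rewrite -!rootE -!dvdp_XsubCl => /dvdpP[e0 ->] /dvdpP[e1 ->] /dvdpP[e2 ->].
exists (nrm p q r e0 e1 e2).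
by rewrite nrm.unlock adj0.unlock adj1.unlock adj2.unlock; ring.
Qed.

(** The t-coordinates of the prescribed points being distinct, a zero of the norm
    is double only when tQ is one of them. *)
Lemma nrm_order t : N.[t] = 0 ->
  [\/ [/\ t \notin [seq P.1 | P <- pts], t = tQ &
          exists2 n1, N = ('X - t%:P) * n1 & n1.[t] != 0],
      exists P, [/\ P \in pts, P.1 = t, t != tQ &
          exists2 n1, N = ('X - t%:P) * n1 & n1.[t] != 0] |
      exists P, [/\ P \in pts, P.1 = t, t = tQ &
          exists2 n1, N = ('X - t%:P) ^+ 2 * n1 & n1.[t] != 0]].
Proof.
move=> N0; have [/mapP[P Pp tP]|tn] := boolP (t \in [seq P.1 | P <- pts]); last first.
  have tt : t = tQ.
    move/eqP: N0; rewrite eN !hornerE !mulf_eq0 (negPf nu0) /=.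
    by rewrite (negPf (_ : Pi.[t] != 0)) ?Pi_root //= subr_eq0 => /eqP.
  apply: Or31; split=> //; exists (nu%:P * Pi); first by rewrite eN tt; ring.
  by rewrite !hornerE mulf_neq0 // Pi_root.
have [tt|tt] := eqVneq t tQ; [apply: Or33|apply: Or32]; exists P; split=> //.
  exists (nu%:P * cofac P); last by rewrite !hornerE tP mulf_neq0 // cofac_neq0.
  by rewrite eN (PiE Pp) -tP -tt; ring.
exists (nu%:P * cofac P * ('X - tQ%:P)).
  by rewrite eN (PiE Pp) -tP; ring.
by rewrite !hornerE !mulf_neq0 ?subr_eq0 // tP cofac_neq0.
Qed.

(** On the fibre y - y0 is in the ideal of F and C, while C D = 0 modulo F as the
    norm vanishes at t. *)
Lemma adj_fib t y : ~~ vanishes t -> common t y F C ->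
  exists G, ('X - y%:P) * fib t D = fib t F * G.
Proof.
move=> nv cy; have [u [v [h e]]] := fib_bezout nv cy.
have [h' eh'] := adjE p q r c0 c1 c2.
have N0 := common_nrm cy.
exists (fib t (u * D + v * h')).
have : fib t ((u * F + v * C) * D) = fib t (u * F * D + v * (C * D)) by congr fib; ring.
rewrite e eh' !fibE N0 !hornerE subrr => e'.
transitivity (fib t u * fib t F * fib t D + fib t v * (fib t F * fib t h')); last by ring.
by move: e'; rewrite ?(polyC0, mul0r, add0r, addr0) => -> /=; ring.
Qed.

(** D can vanish on a fibre only above a double zero of the norm. *)
Lemma vanish_in_pts t y : vanishes t -> common t y F C ->
  exists P, [/\ P \in pts, P.1 = t, t = tQ &
          exists2 n1, N = ('X - t%:P) ^+ 2 * n1 & n1.[t] != 0].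
Proof.
move=> v cy; have [e0 [e1 [e2 [n2 [h [_ eN2 _ /(_ _ cy) z]]]]]] := adj_vanishes_factor v.
have n0 : forall n1, N = ('X - t%:P) * n1 -> n1.[t] != 0 -> False.
  move=> n1; rewrite eN2 => /(mulfI (tau_neq0 t)) <-; by rewrite z eqxx.
case: (nrm_order (common_nrm cy)) => [[_ _ [n1 h1 h2]]|[P [_ _ _ [n1 h1 h2]]]|//].
- by case: (n0 n1).
- by case: (n0 n1).
Qed.

(** A fibre along which D vanishes: C restricts to the product of two factors
    of F, one of which belongs to a prescribed point. *)
Lemma vanish_fibre t P : vanishes t -> P \in pts -> P.1 = t -> t = tQ ->
  let y' := - (c1.[t] / c2.[t]) - P.2 in
  let e := c1.[t] / c2.[t] - p.[t] in
  [/\ c2.[t] != 0, fib t C = c2.[t]%:P * (('X - P.2%:P) * ('X - y'%:P)),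
   fib t F = ('X - e%:P) * (('X - P.2%:P) * ('X - y'%:P)), P.2 != y' & P.2 != e].
Proof.
move=> v Pp Pt ttQ y' e.
have cP := cpts Pp; rewrite Pt in cP.
have [P' [_ _ _ [n1 eN2 n10]]] := vanish_in_pts v cP.
have C0 : fib t C != 0.
  apply/eqP => /vanish_C0 [n3].
  rewrite eN2 [_ ^+ 3]exprSr -mulrA => /(mulfI (expf_neq0 2 (tau_neq0 t))) e1.
  by move: n10; rewrite e1 !hornerE subrr mul0r eqxx.
case/and3P: v => /eqP; rewrite horner_adj0 => h0 /eqP; rewrite horner_adj1 => h1 /eqP.
rewrite horner_adj2 => h2; rewrite fib_quad in C0.
have [c20 eF] := adj_eq0_factor h0 h1 h2 C0.
have [/eqP cF /eqP cC] := andP cP.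
have eC : quad c0.[t] c1.[t] c2.[t] = c2.[t]%:P * (('X - P.2%:P) * ('X - y'%:P)).
  move: cC; rewrite ev_fib fib_quad quad.unlock !hornerE /= => cC.
  have -> : c0.[t] = - c1.[t] * P.2 - c2.[t] * P.2 ^+ 2.
    by rewrite -[LHS]subr0 -cC; ring.
  have -> : y' = - (c1.[t] / c2.[t]) - P.2 by [].
  have {1 2}-> : c1.[t] = c2.[t] * (c1.[t] / c2.[t]) by rewrite mulrC divfK.
  by rewrite !(polyCD, polyCM, polyCN, polyCB) ?polyC_exp; ring.
have eF' : fib t F = ('X - e%:P) * (('X - P.2%:P) * ('X - y'%:P)).
  rewrite fib_cub eF eC -mul_polyC; congr (_ * _).
  by rewrite mulrA -polyCM mulVf // mul1r.
have sP := spts Pp; rewrite Pt eF' in sP.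
split=> //; first by rewrite fib_quad.
- apply: contraNneq sP => ey; rewrite -[y'](_ : P.2 = y') //.
  have -> : ('X - e%:P) * (('X - P.2%:P) * ('X - P.2%:P)) = ('X - P.2%:P) ^+ 2 * ('X - e%:P) by ring.
  by rewrite deriv_double.
- apply: contraNneq sP => ee; rewrite -[e](_ : P.2 = e) //.
  have -> : ('X - P.2%:P) * (('X - P.2%:P) * ('X - y'%:P)) = ('X - P.2%:P) ^+ 2 * ('X - y'%:P) by ring.
  by rewrite deriv_double.
Qed.

Section Unique.
Variables (p' q' r' c0' c1' c2' b0' b1' b2' : K) (b0 b1 b2 : {poly K}).
Hypotheses (wp : wtop 1 0 p' p) (wq : wtop 2 0 q' q) (wr : wtop 3 0 r' r).
Hypotheses (w0 : wtop l 0 c0' c0) (w1 : wtop l 1 c1' c1) (w2 : wtop l 2 c2' c2).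
Hypotheses (v0 : wtop l 0 b0' b0) (v1 : wtop l 1 b1' b1) (v2 : wtop l 2 b2' b2).
Hypothesis szpts : (size pts).+1 = (3 * l)%N.
Local Notation B := (quad b0 b1 b2).
Hypothesis bpts : forall P, P \in pts -> ev P.1 P.2 B = 0.

Let e0 := mulq0 p q r b0 b1 b2 d0 d1 d2.
Let e1 := mulq1 p q r b0 b1 b2 d0 d1 d2.
Let e2 := mulq2 p q r b0 b1 b2 d0 d1 d2.

Lemma Pi_dvd g : (forall P, P \in pts -> g.[P.1] = 0) -> Pi %| g.
Proof.
move=> h; have -> : Pi = \prod_(z <- [seq P.1 | P <- pts]) ('X - z%:P) by rewrite big_map.
apply: uniq_roots_dvdp; last by rewrite uniq_rootsE.
by apply/allP => _ /mapP[P Pp ->]; rewrite rootE h.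
Qed.

Lemma size_Pi : size Pi = (3 * l)%N.
Proof. by rewrite size_prod_XsubC szpts. Qed.

Lemma monic_Pi : Pi \is monic.
Proof. exact: monic_prod_XsubC. Qed.

(** If D does not vanish on the fibre it is, up to multiples of F, divisible by
    F / (y - y_P), and B is divisible by y - y_P. *)
Lemma BD_fibre P : P \in pts -> [/\ e0.[P.1] = 0, e1.[P.1] = 0 & e2.[P.1] = 0].
Proof.
move=> Pp; set t := P.1.
have eM := quadM p q r b0 b1 b2 d0 d1 d2; rewrite -/e0 -/e1 -/e2 in eM.
set h := (X in F * X) in eM.
suff [G eG] : exists G, fib t B * fib t D = fib t F * G.
  have : quad e0.[t] e1.[t] e2.[t] = cub p.[t] q.[t] r.[t] * (G - fib t h).
    by rewrite -fib_quad -fib_cub mulrBr -eG -fibM eM fibD fibM addrK.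
  by case/quad_cub0.
have [v|nv] := boolP (vanishes t).
  by move: v; rewrite adj_vanishesE => /eqP ->; exists 0; rewrite !mulr0.
have [G eG] := adj_fib nv (cpts Pp).
have /dvdpP[s eB] : 'X - P.2%:P %| fib t B by rewrite dvdp_XsubCl root_fib bpts.
by exists (s * G); rewrite eB -mulrA eG mulrCA.
Qed.

(** Once the product of the t - t_i is divided out, the degree bounds leave the
    equation of a line. *)
Lemma BD_factor : exists (L0 L1 : {poly K}) (h : {poly {poly K}}), [/\ (size L0 <= 2)%N, (size L1 <= 1)%N &
  B * D = Pi%:P * quad L0 L1 0 + F * h].
Proof.
have D0 := wtop_adj0 wp wq wr w0 w1 w2; have D1 := wtop_adj1 wp wq wr w0 w1 w2.
have D2 := wtop_adj2 r r' wp wq w0 w1 w2.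
have [x0 t0] := wtop_mulq0 q wp wr v0 v1 v2 D0 D1 D2.
have [x1 t1] := wtop_mulq1 wp wq wr v0 v1 v2 D0 D1 D2.
have [x2 t2] := wtop_mulq2 r wp wq v0 v1 v2 D0 D1 D2.
rewrite -/e0 -/e1 -/e2 in t0 t1 t2.
have sP (g : {poly K}) : Pi * g != 0 -> size (g * Pi)%R = (size g + 3 * l).-1.
  rewrite mulf_eq0 negb_or => /andP[P0 g0].
  by rewrite size_mul // size_Pi.
have sz (g : {poly K}) m : (size (g * Pi)%R + m <= (3 * l).+1)%N \/ g * Pi = 0 -> (size g + m <= 2)%N \/ g = 0.
  case=> [|/eqP]; last by rewrite mulf_eq0 (negPf (monic_neq0 monic_Pi)) orbF => /eqP ->; right.
  have [->|g0] := eqVneq g 0; first by right.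
  rewrite sP ?mulf_neq0 ?(monic_neq0 monic_Pi) // => h; left.
  by move: g0; rewrite -size_poly_gt0; lia.
have /dvdpP[L0 E0] : Pi %| e0 by apply: Pi_dvd => P /BD_fibre[].
have /dvdpP[L1 E1] : Pi %| e1 by apply: Pi_dvd => P /BD_fibre[].
have /dvdpP[L2 E2] : Pi %| e2 by apply: Pi_dvd => P /BD_fibre[].
have e3 : (2 * l + l = 3 * l)%N by lia.
rewrite e3 in t0 t1 t2.
have := wtop_size t0; rewrite E0 => /sz s0.
have := wtop_size t1; rewrite E1 => /sz s1.
have := wtop_size t2; rewrite E2 => /sz s2.
have L20 : L2 = 0.
  by case: s2 => // s2; apply/eqP; rewrite -size_poly_leq0 -(leq_add2r 2).
have eM := quadM p q r b0 b1 b2 d0 d1 d2; rewrite -/e0 -/e1 -/e2 in eM.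
exists L0, L1; eexists; split.
- by case: s0 => [|->]; rewrite ?addn0 ?size_poly0.
- by case: s1 => [|->]; rewrite ?addn1 ?size_poly0.
rewrite eM E0 E1 E2 L20 mul0r; congr (_ + _).
by rewrite -quadZ mulr0 ![Pi * _]mulrC.
Qed.

(** If B vanishes at the prescribed points then B D = Pi L modulo F, with L the
    equation of a line.  Multiplying by C gives nu (t - tQ) B = C L modulo F.
    On the fibre over tQ this makes (y - yQ) L divisible by F, of larger degree,
    or, if D vanishes there, gives L two distinct zeros; in both cases L
    vanishes on the fibre, so L is a constant times t - tQ. *)
Lemma unique_up_to_scalar : exists lam : K,
  [/\ b0 = lam%:P * c0, b1 = lam%:P * c1 & b2 = lam%:P * c2].
Proof.
have [L0 [L1 [h [s0 s1 eBD]]]] := BD_factor.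
set L := quad L0 L1 0 in eBD.
have Pi0 := monic_neq0 monic_Pi.
have [h' eCD] := adjE p q r c0 c1 c2.
have [H eH] : exists H, C * L - (nu%:P * ('X - tQ%:P))%:P * B = F * H.
  apply: (@cub_cancel _ _ _ _ Pi _ (B * h' - C * h)) => //.
  have -> : Pi%:P * (C * L - (nu%:P * ('X - tQ%:P))%:P * B) =
            C * (Pi%:P * L) - B * (nu%:P * Pi * ('X - tQ%:P))%:P.
    by rewrite !polyCM; ring.
  rewrite -eN (_ : N%:P = C * D - F * h'); last by rewrite eCD addrK.
  rewrite (_ : Pi%:P * L = B * D - F * h); last by rewrite eBD addrK.
  by ring.
have CL0 : fib tQ C * fib tQ L = fib tQ F * fib tQ H.
  have := congr1 (fib tQ) eH; rewrite !fibE !hornerE subrr mulr0 /=.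
  by rewrite polyC0 mul0r oppr0 addr0.
have [l0 l1] : L0.[tQ] = 0 /\ L1.[tQ] = 0.
  have NQ : N.[tQ] = 0 by rewrite eN !hornerE subrr mulr0.
  have [y cy] := nrm_common NQ.
  have [v|nv] := boolP (vanishes tQ); last first.
    have [u [v [h'' e]]] := fib_bezout nv cy.
    have : quad (- y * L0.[tQ]) (L0.[tQ] - y * L1.[tQ]) (L1.[tQ]) =
           cub p.[tQ] q.[tQ] r.[tQ] * (fib tQ (u * L + v * H)).
      have -> : quad (- y * L0.[tQ]) (L0.[tQ] - y * L1.[tQ]) (L1.[tQ]) =
                ('X - y%:P) * fib tQ L.
        by rewrite /L fib_quad quad.unlock hornerC polyC0 !(polyCM, polyCB, polyCN); ring.
      have : fib tQ ((u * F + v * C) * L) = fib tQ u * fib tQ F * fib tQ L + fib tQ v * (fib tQ C * fib tQ L).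
        by rewrite -!fibM -fibD; congr fib; ring.
      rewrite e CL0 -fib_cub !fibE !hornerE subrr /= => e'.
      transitivity (fib tQ u * fib tQ F * fib tQ L + fib tQ v * (fib tQ F * fib tQ H)); last by ring.
      by rewrite mulrA -e' ?(polyC0, mul0r, addr0).
    case/quad_cub0 => _ z1 z2; split=> //; apply/eqP.
    by rewrite -z1 z2 mulr0 subr0.
  have [P [Pp Pt _ _]] := vanish_in_pts v cy.
  have [c20 eC eF Py Pe] := vanish_fibre v Pp Pt erefl.
  set y' := - (c1.[tQ] / c2.[tQ]) - P.2 in eC eF Py.
  set e := c1.[tQ] / c2.[tQ] - p.[tQ] in eF Pe.
  have Le : (fib tQ L).[e] = 0.
    have C0 : fib tQ C != 0.
      by rewrite eC !mulf_neq0 ?polyC_eq0 ?polyXsubC_eq0.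
    have -> : fib tQ L = ('X - e%:P) * ((c2.[tQ])^-1 *: fib tQ H).
      apply: (mulfI C0); rewrite CL0 eC eF -[_^-1 *: _]mul_polyC.
      have -> : forall a b g i j k : {poly K}, a * (b * g) * (i * (j * k)) =
        (a * j) * (i * (b * g)) * k by move=> *; ring.
      by rewrite -polyCM mulfV // mul1r.
    by rewrite hornerM hornerXsubC subrr mul0r.
  have LP : (fib tQ L).[P.2] = 0.
    have [E0 [E1 [E2 [n1 [h1 [eD _ eCE _]]]]]] := adj_vanishes_factor v.
    have ePi : Pi = ('X - tQ%:P) * cofac P by rewrite (PiE Pp) Pt.
    have [G eG] : exists G, B * quad E0 E1 E2 - (cofac P)%:P * L = F * G.
      apply: (@cub_cancel _ _ _ _ ('X - tQ%:P) _ h); first exact: tau_neq0.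
      rewrite mulrBr mulrCA -eD eBD ePi polyCM; ring.
    have := congr1 (ev tQ P.2) eG; rewrite !evE -ev_fib.
    have := cpts Pp; rewrite Pt => /andP[/eqP -> _].
    have := bpts Pp; rewrite Pt => ->; rewrite !mul0r sub0r => /eqP.
    rewrite oppr_eq0 mulf_eq0; have := cofac_neq0 Pp; rewrite Pt => /negPf -> /=.
    by move/eqP.
  move: Le LP; rewrite /L fib_quad hornerC quad.unlock !hornerE /= => Le LP.
  have l1 : L1.[tQ] = 0.
    apply/eqP; have : L1.[tQ] * (P.2 - e) = 0.
      by rewrite mulrBr; apply/eqP; rewrite subr_eq0; apply/eqP; apply: (addrI L0.[tQ]); rewrite Le LP.
    by move/eqP; rewrite mulf_eq0 subr_eq0 (negPf Pe) orbF.
  by split=> //; move: Le; rewrite l1 !(mul0r, addr0).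
have L10 : L1 = 0.
  by move: l1; rewrite (size1_polyC s1) hornerC => ->; rewrite polyC0.
have /dvdpP[g eg] : 'X - tQ%:P %| L0 by rewrite dvdp_XsubCl rootE l0.
have sg : (size g <= 1)%N.
  have [->|g0] := eqVneq g 0; first by rewrite size_poly0.
  by move: s0; rewrite eg size_mul ?polyXsubC_eq0 // size_XsubC addn2 /= ltnS.
rewrite (size1_polyC sg) in eg; set ga := g`_0 in eg.
have [G eG] : exists G, quad (ga%:P * c0 - nu%:P * b0) (ga%:P * c1 - nu%:P * b1)
     (ga%:P * c2 - nu%:P * b2) = F * G.
  apply: (@cub_cancel _ _ _ _ ('X - tQ%:P) _ H); first exact: tau_neq0.
  rewrite -eH /L eg L10 quadC quadB !quadZ !polyCM; ring.
case/quad_cub0: eG => z0 z1 z2.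
have fin a b : ga%:P * a - nu%:P * b = 0 -> b = (ga / nu)%:P * a.
  move/eqP; rewrite subr_eq0 => /eqP e; rewrite mulrC polyCM mulrA [a * _]mulrC e.
  by rewrite mulrAC -polyCM mulfV // mul1r.
by exists (ga / nu); split; apply: fin.
Qed.

End Unique.

(** Where D does not vanish on the fibre over tQ, it is a multiple of
    F / (y - yQ), which determines yQ.  If it vanishes, then tQ is the
    coordinate of a prescribed point P, and C has a second zero on that fibre.
    The multiplicities follow from the order of the norm. *)
Lemma residual_point : exists yQ, [/\ common tQ yQ F C,
  (d2.[tQ] != 0 /\ yQ = d1.[tQ] / d2.[tQ] - p.[tQ]) \/
  (exists P, [/\ P \in pts, P.1 = tQ & yQ = - (c1.[tQ] / c2.[tQ]) - P.2]) &
  forall t y, common t y F C ->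
    (count_mem (t, y) (rcons pts (tQ, yQ)) = 1 /\ mult_one p q r c0 c1 c2 t y) \/
    (count_mem (t, y) (rcons pts (tQ, yQ)) = 2 /\ mult_two p q r c0 c1 c2 t y)].
Proof.
have up : uniq pts by apply: map_uniq upts.
have NQ : N.[tQ] = 0 by rewrite eN !hornerE subrr mulr0.
have inj P R : P \in pts -> R \in pts -> P.1 = R.1 -> P = R.
  move=> Pp Rp e; rewrite -[P](nth_index P Pp) -[R](nth_index P Rp); congr nth.
  apply/eqP; rewrite -(nth_uniq tQ _ _ upts) ?size_map ?index_mem //.
  by rewrite !(nth_map P) ?index_mem // !nth_index // e.
have cnt yQ t y : count_mem (t, y) (rcons pts (tQ, yQ)) =
    (((t, y) \in pts) + ((t, y) == (tQ, yQ)))%N.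
  by rewrite -cats1 count_cat count_uniq_mem //= addn0 eq_sym.
(* on a fibre where D does not vanish there is only one common point *)
have gen yQ : common tQ yQ F C -> forall t y, ~~ vanishes t -> common t y F C ->
    (count_mem (t, y) (rcons pts (tQ, yQ)) = 1 /\ mult_one p q r c0 c1 c2 t y) \/
    (count_mem (t, y) (rcons pts (tQ, yQ)) = 2 /\ mult_two p q r c0 c1 c2 t y).
  move=> cQ t y nv cy; rewrite cnt.
  case: (nrm_order (common_nrm cy)) => [[tn tt [n1 h1 h2]]|[P [Pp Pt tt [n1 h1 h2]]]|
     [P [Pp Pt tt [n1 h1 h2]]]].
  - have ey : yQ = y by apply: (common_uniq nv cy); rewrite tt.
    left; split; last by have [] := simple_zero h1 h2 cy.
    rewrite tt ey eqxx; suff /negPf -> : (tQ, y) \notin pts by [].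
    by apply: contra tn => h; rewrite tt; apply: (map_f fst h).
  - have ey : P.2 = y by apply: (common_uniq nv cy); rewrite -Pt; apply: cpts.
    left; split; last by have [] := simple_zero h1 h2 cy.
    by rewrite xpair_eqE (negPf tt) -Pt -ey -surjective_pairing Pp.
  - have ey : P.2 = y by apply: (common_uniq nv cy); rewrite -Pt; apply: cpts.
    have eQ : yQ = y by apply: (common_uniq nv cy); rewrite tt.
    right; split.
      have -> : (t, y) \in pts by rewrite -Pt -ey -surjective_pairing.
      by rewrite eQ tt eqxx.
    apply: double_zero h1 h2 cy _ nv.
    by have := spts Pp; rewrite Pt ey.
have [y cy] := nrm_common NQ.
have [v|nv] := boolP (vanishes tQ); last first.
  exists y; split=> //; last first.
    move=> t y' c'; apply: gen => //.
    apply/negP => v; have [P [_ _ tt _]] := vanish_in_pts v c'.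
    by move: nv; rewrite -tt v.
  left; have [G eG] := adj_fib nv cy.
  have eq : quad (- y * d0.[tQ] - r.[tQ] * d2.[tQ]) (d0.[tQ] - y * d1.[tQ] - q.[tQ] * d2.[tQ])
       (d1.[tQ] - y * d2.[tQ] - p.[tQ] * d2.[tQ]) = cub p.[tQ] q.[tQ] r.[tQ] * (G - (d2.[tQ])%:P).
    rewrite mulrBr -fib_cub -eG fib_quad fib_cub quad.unlock cub.unlock.
    by rewrite !(polyCM, polyCB, polyCN); ring.
  case/quad_cub0: eq => z0 z1 z2.
  have d20 : d2.[tQ] != 0.
    apply: contraNneq nv => z; rewrite z !mulr0 !subr0 in z0 z1 z2.
    by rewrite z2 mulr0 subr0 in z1; rewrite /adj_vanishes z z1 z2 eqxx.
  split=> //; apply: (mulIf d20); rewrite mulrBl divfK //.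
  by apply/eqP; rewrite eq_sym subr_eq addrC -subr_eq0 opprD addrA -subr_eq0 subr0; apply/eqP; rewrite -z2; ring.
have [P [Pp Pt _ [n2 eN2 n20]]] := vanish_in_pts v cy.
have [c20 eC eF Py Pe] := vanish_fibre v Pp Pt erefl.
set y' := - (c1.[tQ] / c2.[tQ]) - P.2 in eC eF Py.
  set e := c1.[tQ] / c2.[tQ] - p.[tQ] in eF Pe.
have cy' : common tQ y' F C.
  by rewrite /common !ev_fib eC eF !hornerM !hornerXsubC subrr !mulr0 eqxx.
exists y'; split=> //; first by right; exists P.
move=> t z cz; have [vt|nvt] := boolP (vanishes t); last exact: gen.
have tt : t = tQ by have [? []] := vanish_in_pts vt cz.
subst t; left.
have [E0 [E1 [E2 [n1 [h1 [eD eN1 eCE _]]]]]] := adj_vanishes_factor v.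
have en : n1 = ('X - tQ%:P) * n2.
  by apply: (mulfI (tau_neq0 tQ)); rewrite -eN1 eN2 expr2 mulrA.
have zI : z = P.2 \/ z = y'.
  case/andP: cz => _; rewrite ev_fib eC !hornerE /= !mulf_eq0 (negPf c20) /=.
  by rewrite !subr_eq0 => /orP[/eqP|/eqP]; [left|right].
have It : inI F C tQ z ('X - tQ%:P)%:P.
  apply: (@inI_unit _ _ _ _ _ _ _ _ _ _ n2%:P); first by rewrite evC.
  rewrite -polyCM mulrC -en; apply: (@inI_gen _ _ _ _ _ _ _ _ _ _ (- h1) (quad E0 E1 E2)).
  by rewrite [_ * C]mulrC eCE; ring.
have [H eH] : exists H, C - map_poly polyC (fib tQ C) = ('X - tQ%:P)%:P * H.
  by apply: fib_eq0; rewrite fibD fibN fib_lift subrr.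
have lift : map_poly polyC (fib tQ C) = (c2.[tQ])%:P%:P * ('X - P.2%:P%:P) * ('X - y'%:P%:P).
  by rewrite eC !rmorphM !rmorphB /= !map_polyC map_polyX mulrA.
have IC : inI F C tQ z (map_poly polyC (fib tQ C)).
  have -> : map_poly polyC (fib tQ C) = C + (- H) * ('X - tQ%:P)%:P.
    by rewrite mulNr mulrC -eH opprB addrC subrK.
  apply: inI_add; last exact: inI_mul.
  by apply: (@inI_gen _ _ _ _ _ _ _ _ _ _ 0 1); rewrite mul0r add0r mul1r.
split.
  rewrite cnt xpair_eqE eqxx /=.
  case: zI => ->.
    by rewrite (negPf Py) -Pt -surjective_pairing Pp.
  rewrite eqxx; suff -> : (tQ, y') \in pts = false by [].
  apply/negP => Qp; have := inj _ _ Pp Qp Pt => eP.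
  by move: Py; rewrite eP eqxx.
split=> //; rewrite lift in IC; case: zI => zE.
- apply: (@inI_unit _ _ _ _ _ _ _ _ _ _ ((c2.[tQ])%:P%:P * ('X - y'%:P%:P))).
    by rewrite !evE !hornerE mulf_neq0 // subr_eq0 zE.
  by move: IC; rewrite mulrAC -zE.
- apply: (@inI_unit _ _ _ _ _ _ _ _ _ _ ((c2.[tQ])%:P%:P * ('X - P.2%:P%:P))).
    by rewrite !evE !hornerE mulf_neq0 // subr_eq0 zE eq_sym.
  by move: IC; rewrite -zE.
Qed.

End Residual.

(** * Charts of the projective plane *)

Section MmapMorph.
Variables (R S : comNzRingType) (n : nat).
Variables (f : {rmorphism R -> S}).
Implicit Types (h : 'I_n -> S) (p : {mpoly R[n]}).

Lemma mmap_morph (T : comNzRingType) (g : {rmorphism S -> T}) h p :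
  g (mmap f h p) = mmap (g \o f) (fun i => g (h i)) p.
Proof.
rewrite /mmap rmorph_sum; apply: eq_bigr => m _; rewrite rmorphM /=; congr (_ * _).
by rewrite /mmap1 rmorph_prod; apply: eq_bigr => i _; rewrite rmorphXn.
Qed.

Lemma mmap_eqh h h' p : h =1 h' -> mmap f h p = mmap f h' p.
Proof. by move=> e; rewrite /mmap; apply: eq_bigr => m _; rewrite (mmap1_eq _ e). Qed.

Lemma mmap_homog d lam h p : p \is d.-homog ->
  mmap f (fun i => lam * h i) p = lam ^+ d * mmap f h p.
Proof.
move=> /dhomogP hp; rewrite /mmap big_distrr /= big_seq [RHS]big_seq.
apply: eq_bigr => m /hp <-; rewrite mulrCA; congr (_ * _).
rewrite /mmap1 -[X in lam ^+ X]/(mdeg m) mdegE -GRing.prodrXr /=.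
by rewrite -big_split /=; apply: eq_bigr => i _; rewrite exprMn.
Qed.
End MmapMorph.

Lemma mmap_id (R : comNzRingType) n (p : {mpoly R[n]}) :
  mmap (@mpolyC n R) (fun i => 'X_i) p = p.
Proof.
rewrite [RHS]mpolyE /mmap; apply: eq_bigr => m _.
by rewrite mmap1_id mul_mpolyC.
Qed.

Definition coord (S : nmodType) (x y z : S) (i : 'I_3) : S := [:: x; y; z]`_i.

Section Chart.
Variable K : fieldType.
Variable b : K.
Local Notation mp := {mpoly K[3]}.
Local Notation bp := {poly {poly K}}.
Local Notation FF := {fraction mp}.

(** The affine chart x - b z = 1 of the plane, with coordinates t = z and y. *)
Definition chart_coord : 'I_3 -> bp := coord (1 + b *: 'X)%:P 'X ('X%:P).
Definition dehom : mp -> bp := mmap (polyC \o polyC) chart_coord.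
HB.instance Definition _ := GRing.RMorphism.copy dehom (mmap (polyC \o polyC) chart_coord).

Definition line_at : mp := 'X_0 - b *: 'X_2%:R.
Definition Tc : FF := ('X_2%:R)%:F / line_at%:F.
Definition Yc : FF := ('X_1)%:F / line_at%:F.

Definition cstF : K -> FF := @FracField.tofrac mp \o @mpolyC 3 K.
HB.instance Definition _ := GRing.RMorphism.copy cstF (@FracField.tofrac mp \o @mpolyC 3 K).
(** psi1 and psi substitute the rational functions t = z / (x1 - b z) and
    y = x2 / (x1 - b z) of the plane. *)
Definition psi1 : {poly K} -> FF := horner_morph (fun x => mulrC Tc (cstF x)).
HB.instance Definition _ := GRing.RMorphism.copy psi1 (horner_morph (fun x => mulrC Tc (cstF x))).
Definition psi : bp -> FF := horner_morph (fun x => mulrC Yc (psi1 x)).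
HB.instance Definition _ := GRing.RMorphism.copy psi (horner_morph (fun x => mulrC Yc (psi1 x))).

Lemma psiC g : psi g%:P = psi1 g. Proof. exact: horner_morphC. Qed.
Lemma psiX : psi 'X = Yc. Proof. exact: horner_morphX. Qed.
Lemma psi1C c : psi1 c%:P = cstF c. Proof. exact: horner_morphC. Qed.
Lemma psi1X : psi1 'X = Tc. Proof. exact: horner_morphX. Qed.

Lemma psi1D g h : psi1 (g + h) = psi1 g + psi1 h. Proof. exact: rmorphD. Qed.
Lemma psi1M g h : psi1 (g * h) = psi1 g * psi1 h. Proof. exact: rmorphM. Qed.
Lemma psi1_1 : psi1 1 = 1. Proof. exact: rmorph1. Qed.
Lemma psiD g h : psi (g + h) = psi g + psi h. Proof. exact: rmorphD. Qed.
Lemma psiN g : psi (- g) = - psi g. Proof. exact: rmorphN. Qed.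
Lemma psiM g h : psi (g * h) = psi g * psi h. Proof. exact: rmorphM. Qed.
Lemma line_at_homog : line_at \is 1.-homog.
Proof. by apply: rpredB; rewrite ?rpredZ // dhomogX /= mdeg1. Qed.

Lemma line_at_neq0 : line_at != 0.
Proof.
apply/eqP => /(congr1 (fun G => G.@[coord 1 0 0])).
rewrite mevalB mevalZ !mevalXU meval0 /coord /= mulr0 subr0 => /eqP.
by rewrite oner_eq0.
Qed.

Lemma dehomX i : dehom 'X_i = chart_coord i.
Proof. by rewrite /dehom mmapX mmap1U. Qed.

Lemma dehomC c : dehom c%:MP = c%:P%:P.
Proof. by rewrite /dehom mmapC. Qed.

Lemma dehom_line : dehom line_at = 1.
Proof.
rewrite /line_at rmorphB /= -mul_mpolyC rmorphM /= dehomC !dehomX /chart_coord /coord /=.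
by rewrite -polyCM -polyCB mul_polyC addrK.
Qed.

(** The equation in the chart is obtained by dividing the coordinates by the
    linear form that is 1 there. *)
Lemma psi_dehom d G : G \is d.-homog -> G%:F = line_at%:F ^+ d * psi (dehom G).
Proof.
move=> hG; have l0 : line_at%:F != 0 by rewrite tofrac_eq0 line_at_neq0.
have -> : psi (dehom G) = mmap (psi \o (polyC \o polyC)) (fun i => psi (chart_coord i)) G.
  exact: (mmap_morph (polyC \o polyC) psi chart_coord G).
rewrite -mmap_homog //.
have -> : G%:F = mmap (@FracField.tofrac mp \o @mpolyC 3 K) (fun i => ('X_i)%:F) G.
  rewrite -[X in X%:F]mmap_id.
  exact: (mmap_morph (@mpolyC 3 K) (@FracField.tofrac mp) _ G).
have ec : forall c : K, (@FracField.tofrac mp \o @mpolyC 3 K) c = (psi \o (polyC \o polyC)) c.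
  by move=> c /=; rewrite psiC psi1C.
rewrite /mmap; apply: eq_bigr => m _; rewrite ec; congr (_ * _).
apply: mmap1_eq => i; rewrite mulrC; apply/(canRL (divfK l0)).
rewrite /chart_coord /coord.
case: i => [[|[|[|//]]] hi] /=.
- rewrite psiC psi1D psi1_1 -mul_polyC psi1M psi1C psi1X /Tc mulrA.
  rewrite -[1](divff l0) -mulrDl; congr (_ / _).
  rewrite /line_at -mul_mpolyC tofracB tofracM /cstF /= subrK.
  by congr (_%:F); congr 'X_ _; apply: val_inj.
- by rewrite psiX /Yc; congr (_%:F / _); congr 'X_ _; apply: val_inj.
- by rewrite psiC psi1X /Tc; congr (_%:F / _); congr 'X_ _; apply: val_inj.
Qed.
End Chart.

(** * The local ring at a point of a chart *)

Section LocalRing.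
Variable K : fieldType.
Local Notation mp := {mpoly K[3]}.
Local Notation FF := {fraction mp}.
Variables (b : K) (P : 'rV[K]_3) (t0 y0 lam : K).
Hypothesis lam0 : lam != 0.
Hypothesis eP : forall i, P 0 i = lam * coord (1 + b * t0) y0 t0 i.
Local Notation T := (Tc b).
Local Notation Y := (Yc b).
Local Notation line := (line_at b).

Definition value_at (w : FF) (c : K) : Prop :=
  exists n a d, [/\ a \is n.-homog, d \is n.-homog, evalp d P != 0, w = a%:F / d%:F
    & evalp a P = c * evalp d P].

Lemma evalpD G H : evalp (G + H) P = evalp G P + evalp H P. Proof. exact: mevalD. Qed.
Lemma evalpN G : evalp (- G) P = - evalp G P. Proof. exact: mevalN. Qed.
Lemma evalpM G H : evalp (G * H) P = evalp G P * evalp H P. Proof. exact: mevalM. Qed.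
Lemma evalpC c : evalp c%:MP P = c. Proof. exact: mevalC. Qed.
Lemma evalpX i : evalp 'X_i P = P 0 i. Proof. exact: mevalXU. Qed.
Lemma evalp0 : evalp 0 P = 0. Proof. exact: meval0. Qed.
Lemma evalp1 : evalp 1 P = 1. Proof. exact: meval1. Qed.
Lemma evalpXn G n : evalp (G ^+ n) P = evalp G P ^+ n.
Proof. by elim: n => [|n IH]; rewrite ?expr0 ?evalp1 // !exprS evalpM IH. Qed.

Lemma evalp_neq0 G : evalp G P != 0 -> G != 0.
Proof. by apply: contraNneq => ->; rewrite evalp0. Qed.

Lemma frac_neq0 G : evalp G P != 0 -> G%:F != 0 :> FF.
Proof. by move/evalp_neq0; rewrite tofrac_eq0. Qed.

Lemma line_val : evalp line P = lam.
Proof.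
rewrite /line_at evalpD evalpN -mul_mpolyC evalpM evalpC !evalpX !eP /coord /=.
by ring.
Qed.

Lemma local_val w : local_ring P w -> exists c, value_at w c.
Proof.
move=> [n [a [d [ha hd d0 ->]]]]; exists (evalp a P / evalp d P), n, a, d.
by split=> //; rewrite divfK.
Qed.

Lemma val_local w c : value_at w c -> local_ring P w.
Proof. by move=> [n [a [d [ha hd d0 -> _]]]]; exists n, a, d. Qed.

Lemma valD w w' c c' : value_at w c -> value_at w' c' -> value_at (w + w') (c + c').
Proof.
move=> [n [a [d [ha hd d0 -> ea]]]] [n' [a' [d' [ha' hd' d0' -> ea']]]].
exists (n + n')%N, (a * d' + a' * d), (d * d'); split.
- by apply: dhomogD; [apply: dhomogM | rewrite mulrC; apply: dhomogM].
- exact: dhomogM.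
- by rewrite evalpM mulf_neq0.
- by rewrite tofracD !tofracM addf_div // frac_neq0.
- rewrite evalpD !evalpM ea ea'; ring.
Qed.

Lemma valM w w' c c' : value_at w c -> value_at w' c' -> value_at (w * w') (c * c').
Proof.
move=> [n [a [d [ha hd d0 -> ea]]]] [n' [a' [d' [ha' hd' d0' -> ea']]]].
exists (n + n')%N, (a * a'), (d * d'); split; try exact: dhomogM.
- by rewrite evalpM mulf_neq0.
- by rewrite !tofracM mulf_div.
- rewrite !evalpM ea ea'; ring.
Qed.

Lemma valV w c : value_at w c -> c != 0 -> value_at w^-1 c^-1.
Proof.
move=> [n [a [d [ha hd d0 -> ea]]]] c0; exists n, d, a; split=> //.
- by rewrite ea mulf_neq0.
- by rewrite invf_div.
- by rewrite ea mulKf.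
Qed.

Lemma val_cst c : value_at (cstF c) c.
Proof.
exists 0%N, c%:MP, 1; split; rewrite ?dhomog1 ?evalp1 ?oner_neq0 ?evalpC ?mulr1 //.
- by rewrite -[c%:MP]mulr1 mul_mpolyC rpredZ ?dhomog1.
- by rewrite tofrac1 divr1.
Qed.

Lemma val_T : value_at T t0.
Proof.
exists 1%N, 'X_2%:R, line; split; rewrite ?line_at_homog ?line_val //.
- by rewrite dhomogX /= mdeg1.
- by rewrite evalpX eP /coord /= mulrC.
Qed.

Lemma val_Y : value_at Y y0.
Proof.
exists 1%N, 'X_1, line; split; rewrite ?line_at_homog ?line_val //.
- by rewrite dhomogX /= mdeg1.
- by rewrite evalpX eP /coord /= mulrC.
Qed.

Lemma val_psi1 g : value_at (psi1 b g) g.[t0].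
Proof.
elim/poly_ind: g => [|g c IH].
  by rewrite -polyC0 psi1C hornerC; apply: val_cst.
rewrite psi1D psi1M psi1X psi1C hornerMXaddC; apply: valD (val_cst c).
exact: valM val_T.
Qed.

Lemma val_psi g : value_at (psi b g) (ev t0 y0 g).
Proof.
elim/poly_ind: g => [|g c IH].
  by rewrite -polyC0 psiC evC; apply: val_psi1.
rewrite psiD psiM psiX psiC !evE; apply: valD (val_psi1 c).
exact: valM val_Y.
Qed.

Lemma val_line_inv d (G : mp) : G \is d.-homog -> evalp G P = lam ^+ d * ev t0 y0 (dehom b G).
Proof.
move=> hG; rewrite /evalp /meval.
have -> : mmap idfun (fun i => P 0 i) G = mmap idfun (fun i => lam * coord (1 + b * t0) y0 t0 i) G.
  by apply: (@mmap_eqh _ _ _ idfun).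
rewrite (@mmap_homog _ _ _ idfun d) //; congr (_ * _).
rewrite ev_fib -[(fib _ _).[_]]/(horner_eval y0 (fib t0 (dehom b G))).
have -> : dehom b G = mmap (polyC \o polyC) (chart_coord b) G by [].
have := mmap_morph (polyC \o polyC) (horner_eval y0 \o fib t0) (chart_coord b) G.
rewrite /= => ->; rewrite /mmap; apply: eq_bigr => m _ /=.
rewrite fibC hornerC /horner_eval hornerC; congr (_ * _); apply: mmap1_eq => i.
rewrite /chart_coord /coord; case: i => [[|[|[|//]]] hi] /=.
- by rewrite fibC !hornerE.
- by rewrite fibX hornerX.
- by rewrite fibC !hornerE.
Qed.

Lemma ev0_decomp (G : {poly {poly K}}) : ev t0 y0 G = 0 ->
  exists U V, G = ('X - t0%:P)%:P * U + ('X - y0%:P%:P) * V.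
Proof.
move=> e; have r1 : root (G - (G.[y0%:P])%:P) y0%:P by rewrite /root !hornerE subrr.
have /factor_theorem[V eV] := r1.
have r2 : root G.[y0%:P] t0.
  rewrite /root; apply/eqP; rewrite -[RHS]e.
  have -> : G = V * ('X - y0%:P%:P) + (G.[y0%:P])%:P by rewrite -eV subrK.
  by rewrite !evE !hornerE subrr ?(mulr0, add0r).
have /factor_theorem[U eU] := r2.
exists U%:P, V; rewrite -[LHS](subrK (G.[y0%:P])%:P) eV eU polyCM; ring.
Qed.

Lemma psi_unit d (D : mp) : D \is d.-homog -> evalp D P != 0 -> ev t0 y0 (dehom b D) != 0.
Proof. by move=> hD; apply: contraNneq => e; rewrite (val_line_inv hD) e mulr0. Qed.

(** The maximal ideal of the local ring at P is generated by T - t0 and Y - y0. *)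
Lemma local_decomp w c : value_at w c ->
  exists u v, [/\ local_ring P u, local_ring P v &
    w = cstF c + (T - cstF t0) * u + (Y - cstF y0) * v].
Proof.
move=> [n [a [d [ha hd d0 -> ea]]]].
have u0 := psi_unit hd d0.
have l0 : line%:F != 0 :> FF by rewrite tofrac_eq0 line_at_neq0.
have ld0 : psi b (dehom b d) != 0.
  have := frac_neq0 d0; rewrite (psi_dehom b hd).
  by rewrite mulf_eq0 negb_or => /andP[].
have e0 : ev t0 y0 (dehom b a - c%:P%:P * dehom b d) = 0.
  apply: (mulfI (expf_neq0 n lam0)); rewrite mulr0 !evE hornerC.
  by rewrite mulrBr mulrCA -!val_line_inv // ea subrr.
have [U [V eUV]] := ev0_decomp e0.
have vi := valV (val_psi (dehom b d)) u0.
exists (psi b U / psi b (dehom b d)), (psi b V / psi b (dehom b d)); split.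
- exact: val_local (valM (val_psi U) vi).
- exact: val_local (valM (val_psi V) vi).
have cancel (x y z : FF) : x != 0 -> (x * y) / (x * z) = y / z.
  by move=> x0; rewrite -mulf_div divff // mul1r.
rewrite (psi_dehom b ha) (psi_dehom b hd) (cancel _ _ _ (expf_neq0 n l0)).
have -> : dehom b a = c%:P%:P * dehom b d + (('X - t0%:P)%:P * U + ('X - y0%:P%:P) * V).
  by rewrite -eUV addrC subrK.
rewrite !(psiD, psiM, psiN, psiC, psiX) !psi1D -!polyCN !psi1C psi1X.
have -> : cstF (- t0) = - cstF t0 by exact: rmorphN.
rewrite !mulrDl -!mulrA mulfV // mulr1 addrA; congr (_ + _ + _); ring.
Qed.
End LocalRing.

(** * Intersection multiplicities *)

Lemma div_eqM (L : fieldType) (x y z w : L) :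
  y != 0 -> w != 0 -> x / y = z / w -> x * w = z * y.
Proof. by move=> y0 w0 /eqP; rewrite eqr_div // => /eqP. Qed.

Lemma lin_div (L : fieldType) (x y z : L) : y != 0 -> x - z * y = (x / y - z) * y.
Proof. by move=> y0; rewrite mulrBl divfK. Qed.

Lemma sub_lead (V : zmodType) (x y z : V) : x + y + z - x = y + z.
Proof. by rewrite addrC -addrA addKr. Qed.

Section Multiplicity.
Variable K : fieldType.
Local Notation mp := {mpoly K[3]}.
Local Notation FF := {fraction mp}.

Lemma frac_eqM (a d a' d' : mp) : d%:F != 0 :> FF -> d'%:F != 0 :> FF ->
  a%:F / d%:F = a'%:F / d'%:F -> a * d' = a' * d.
Proof.
move=> d0 d0' e; have h := div_eqM d0 d0' e.
apply/eqP; rewrite -tofrac_eq; apply/eqP.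
exact: etrans (tofracM a d') (etrans h (esym (tofracM a' d))).
Qed.

Section Zero.
Variables (F C : mp) (P : 'rV[K]_3) (m l : nat).
Hypotheses (hF : F \is m.-homog) (hC : C \is l.-homog).

(** If one of the curves misses P, the local ideal contains a unit. *)
Lemma mult_zero : evalp F P != 0 \/ evalp C P != 0 -> intersection_mult F C P 0.
Proof.
move=> h.
have [k [G [A [B [hG G0 eG]]]]] : exists k G A B, [/\ G \is k.-homog, evalp G P != 0 & G = A * F + B * C].
  case: h => h; first by exists m, F, 1, 0; split=> //; rewrite mul1r mul0r addr0.
  by exists l, C, 0, 1; split=> //; rewrite mul1r mul0r add0r.
exists (fun _ => 0); split; first by case.
move=> z [n [a [d [ha hd d0 ->]]]].
exists [ffun=> 0]; split; last by move=> c _; apply/ffunP; case.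
rewrite big_ord0 subr0; exists (k + n)%N, (G * a), (G * d), (a * A), (a * B); split.
- exact: dhomogM.
- exact: dhomogM.
- by rewrite evalpM mulf_neq0.
- by rewrite eG; ring.
- have Gf : G%:F != 0 :> FF by exact: frac_neq0 G0.
  by rewrite !tofracM -mulf_div divff // mul1r.
Qed.
End Zero.

Variables (b : K) (P : 'rV[K]_3) (t0 y0 lam : K).
Hypothesis lam0 : lam != 0.
Hypothesis eP : forall i, P 0 i = lam * coord (1 + b * t0) y0 t0 i.
Local Notation T := (Tc b).
Local Notation Y := (Yc b).
Local Notation line := (line_at b).
Variables (F C : mp) (m l : nat).
Hypotheses (hF : F \is m.-homog) (hC : C \is l.-homog).
Hypotheses (F0 : evalp F P = 0) (C0 : evalp C P = 0).
Local Notation I := (local_ideal F C P).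
Local Notation O := (local_ring P).

Lemma lideal_add z w : I z -> I w -> I (z + w).
Proof.
move=> [n [a [d [A [B [ha hd d0 ea ->]]]]]] [n' [a' [d' [A' [B' [ha' hd' d0' ea' ->]]]]]].
exists (n + n')%N, (a * d' + a' * d), (d * d'), (A * d' + A' * d), (B * d' + B' * d); split.
- by apply: dhomogD; [apply: dhomogM | rewrite mulrC; apply: dhomogM].
- exact: dhomogM.
- by rewrite evalpM mulf_neq0.
- rewrite ea ea'; ring.
- by rewrite tofracD !tofracM addf_div // (@frac_neq0 _ P).
Qed.

Lemma lideal_mul z w : O w -> I z -> I (w * z).
Proof.
move=> [n' [a' [d' [ha' hd' d0' ->]]]] [n [a [d [A [B [ha hd d0 ea ->]]]]]].
exists (n' + n)%N, (a' * a), (d' * d), (a' * A), (a' * B); split.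
- exact: dhomogM.
- exact: dhomogM.
- by rewrite evalpM mulf_neq0.
- rewrite ea; ring.
- by rewrite !tofracM mulf_div.
Qed.

Lemma lideal_val z c : I z -> value_at P z c -> c = 0.
Proof.
move=> [n [a [d [A [B [ha hd d0 ea ->]]]]]] [n' [a' [d' [ha' hd' d0' e ea']]]].
have d1 : d%:F != 0 :> FF by exact: (@frac_neq0 _ P).
have d1' : d'%:F != 0 :> FF by exact: (@frac_neq0 _ P).
have := congr1 (fun G => evalp G P) (frac_eqM d1 d1' e).
rewrite /= !evalpM ea' ea evalpD !evalpM F0 C0 !mulr0 addr0 mul0r => /esym/eqP.
by rewrite !mulf_eq0 (negPf d0) (negPf d0') !orbF => /eqP.
Qed.

Lemma psi_local g : O (psi b g).
Proof. exact: val_local (val_psi lam0 eP g). Qed.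

Lemma O_cst c : O (cstF c).
Proof. exact: val_local (val_cst P c). Qed.

Lemma gen_ideal d G A B : G \is d.-homog -> G = A * F + B * C -> I (psi b (dehom b G)).
Proof.
move=> hG eG; exists d, G, (line ^+ d), A, B; split=> //.
- by rewrite -[X in X.-homog]mul1n; apply: dhomogMn; apply: line_at_homog.
- by rewrite evalpXn expf_neq0 // (line_val eP).
- have l0 : line%:F ^+ d != 0 :> FF by rewrite expf_neq0 // tofrac_eq0 line_at_neq0.
  by rewrite (psi_dehom b hG) tofracXn mulrAC divff // mul1r.
Qed.

Lemma idealF : I (psi b (dehom b F)).
Proof. by apply: (gen_ideal hF (A := 1) (B := 0)); rewrite mul1r mul0r addr0. Qed.
Lemma idealC : I (psi b (dehom b C)).
Proof. by apply: (gen_ideal hC (A := 0) (B := 1)); rewrite mul1r mul0r add0r. Qed.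

(** The ideal computed in the chart is sent to the local ideal of the plane. *)
Lemma inI_local g : inI (dehom b F) (dehom b C) t0 y0 g -> I (psi b g).
Proof.
move=> [e [A [B [e0 eg]]]].
have Ve := val_psi lam0 eP e.
have pe0 : psi b e != 0.
  case: Ve => [n [a [d [_ _ d0 -> ea]]]].
  rewrite mulf_neq0 ?invr_eq0 ?(@frac_neq0 _ P) //.
  by rewrite ea mulf_neq0.
have -> : psi b g = (psi b e)^-1 * psi b (e * g).
  by rewrite psiM mulKf.
apply: lideal_mul; first exact: val_local (valV Ve e0).
rewrite eg psiD !psiM; apply: lideal_add; apply: lideal_mul; try exact: psi_local.
- exact: idealF.
- exact: idealC.
Qed.

(** The converse for t - t0, the element that tells a tangency from a
    transversal intersection. *)
Lemma local_inI : I (T - cstF t0) -> inI (dehom b F) (dehom b C) t0 y0 ('X - t0%:P)%:P.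
Proof.
move=> [n [a [d [A [B [ha hd d0 ea e]]]]]].
exists (dehom b d), (dehom b A), (dehom b B).
split; first exact: (psi_unit eP hd d0).
have l0 : line%:F != 0 :> FF by rewrite tofrac_eq0 line_at_neq0.
have d1 : d%:F != 0 :> FF by exact: (@frac_neq0 _ P).
have e1 : ('X_2%:R - t0%:MP * line) * d = a * line.
  apply/eqP; rewrite -tofrac_eq !tofracM tofracB tofracM.
  have -> : a%:F = (T - cstF t0) * d%:F by rewrite e divfK.
  have -> : ('X_2%:R)%:F - (t0%:MP)%:F * line%:F = (T - cstF t0) * line%:F.
    exact: (lin_div _ _ l0).
  by rewrite mulrAC.
have dd G H : dehom b (G * H) = dehom b G * dehom b H by exact: rmorphM.
have da G H : dehom b (G + H) = dehom b G + dehom b H by exact: rmorphD.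
have dn G : dehom b (- G) = - dehom b G by exact: rmorphN.
have := congr1 (dehom b) e1; rewrite !dd dehom_line mulr1 da dn dd dehom_line mulr1.
rewrite dehomC dehomX /chart_coord /coord /= ea da !dd => <-.
by rewrite polyCB mulrC.
Qed.

Lemma cstFE c : cstF c = (c%:MP)%:F :> FF. Proof. by []. Qed.

Lemma psi_lin_t : psi b ('X - t0%:P)%:P = T - cstF t0.
Proof. by rewrite psiC psi1D psi1X -polyCN psi1C; congr (_ + _); exact: rmorphN. Qed.
Lemma psi_lin_y : psi b ('X - y0%:P%:P) = Y - cstF y0.
Proof. by rewrite psiD psiX psiN psiC psi1C. Qed.

(** The local ideal is the maximal ideal, and the quotient is K. *)
Lemma mult_one_local :
  inI (dehom b F) (dehom b C) t0 y0 ('X - t0%:P)%:P ->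
  inI (dehom b F) (dehom b C) t0 y0 ('X - y0%:P%:P) ->
  intersection_mult F C P 1.
Proof.
move=> /inI_local; rewrite psi_lin_t => It /inI_local; rewrite psi_lin_y => Iy.
exists (fun _ => 1); split.
  by move=> _; apply: val_local; have := val_cst P 1; rewrite /cstF /= mpolyC1 tofrac1; apply.
move=> z /local_val [c vz]; exists [ffun=> c]; split.
  rewrite big_ord1 ffunE mulr1 -cstFE.
  have [u [v [Ou Ov ->]]] := local_decomp lam0 eP vz.
  rewrite sub_lead.
  by apply: lideal_add; rewrite mulrC; apply: lideal_mul.
move=> c' ; rewrite big_ord1 mulr1 -cstFE => Iz.
apply/ffunP => i; rewrite ffunE [i]ord1.
have vd : value_at P (z - cstF (c' ord0)) (c - c' ord0).
  by apply: valD => //; have := val_cst P (- c' ord0); rewrite (rmorphN (@cstF K)).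
by have /eqP := lideal_val Iz vd; rewrite subr_eq0 => /eqP.
Qed.

(** The quotient has the basis 1, t - t0. *)
Lemma mult_two_local h :
  inI (dehom b F) (dehom b C) t0 y0 (('X - t0%:P) ^+ 2)%:P ->
  inI (dehom b F) (dehom b C) t0 y0 ('X - y0%:P%:P + ('X - t0%:P)%:P * h) ->
  ~ inI (dehom b F) (dehom b C) t0 y0 ('X - t0%:P)%:P ->
  intersection_mult F C P 2.
Proof.
move=> /inI_local; rewrite expr2 polyCM psiM psi_lin_t => It2.
move=> /inI_local; rewrite psiD psiM psi_lin_t psi_lin_y => Iy nI.
set th := T - cstF t0 in It2 Iy.
have Oth : O th by rewrite /th -psi_lin_t; apply: psi_local.
have vth : value_at P th 0.
  by have := val_psi lam0 eP (('X - t0%:P)%:P); rewrite psi_lin_t evC !hornerE subrr.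
have addO w w' : O w -> O w' -> O (w + w').
  by move=> /local_val[c h1] /local_val[c' h2]; apply: val_local (valD h1 h2).
have mulO w w' : O w -> O w' -> O (w * w').
  by move=> /local_val[c h1] /local_val[c' h2]; apply: val_local (valM h1 h2).
have oppO w : O w -> O (- w).
  move=> hw; rewrite -mulN1r; apply: mulO => //.
  by have := O_cst (- 1); rewrite rmorphN /= rmorph1.
have Oh := psi_local h.
(* every multiple of the parameter is a constant multiple of it modulo I *)
have red w c : value_at P w c -> I (th * w - cstF c * th).
  move=> vw; have [u [v [Ou Ov ->]]] := local_decomp lam0 eP vw.
  have -> : th * (cstF c + (T - cstF t0) * u + (Y - cstF y0) * v) - cstF c * th =
     (u - psi b h * v) * (th * th) + (th * v) * (Y - cstF y0 + th * psi b h).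
    by rewrite -/th; ring.
  apply: lideal_add; apply: lideal_mul => //; last exact: mulO.
  by apply: addO => //; apply: oppO; apply: mulO.
exists (fun i => if i == ord0 then 1 else th); split.
  move=> i; case: ifP => // _.
  by apply: val_local; have := val_cst P 1; rewrite /cstF /= mpolyC1 tofrac1; apply.
have sumE (c : {ffun 'I_2 -> K}) : \sum_i ((c i)%:MP)%:F * (if i == ord0 then 1 else th) =
   cstF (c ord0) + cstF (c (lift ord0 ord0)) * th.
  by rewrite big_ord_recl big_ord1 /= mulr1.
move=> z /local_val [c vz].
have [u [v [Ou Ov ez]]] := local_decomp lam0 eP vz.
have [c1 v1] : exists c1, value_at P (u - psi b h * v) c1.
  by apply: local_val; apply: addO => //; apply: oppO; apply: mulO.
exists [ffun i : 'I_2 => if i == ord0 then c else c1]; split.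
  rewrite sumE !ffunE /= ez.
  have -> : cstF c + (T - cstF t0) * u + (Y - cstF y0) * v - (cstF c + cstF c1 * th) =
     (th * (u - psi b h * v) - cstF c1 * th) + v * (Y - cstF y0 + th * psi b h).
    by rewrite -/th; ring.
  by apply: lideal_add; [apply: red | apply: lideal_mul].
move=> c'; rewrite sumE => Iz.
have e0 : c' ord0 = c.
  have vd : value_at P (z - (cstF (c' ord0) + cstF (c' (lift ord0 ord0)) * th)) (c + - (c' ord0 + c' (lift ord0 ord0) * 0)).
    apply: valD => //.
    have -> : - (cstF (c' ord0) + cstF (c' (lift ord0 ord0)) * th) = cstF (-1) * (cstF (c' ord0) + cstF (c' (lift ord0 ord0)) * th).
      by rewrite (rmorphN (@cstF K)) rmorph1 mulN1r.
    rewrite -[- (c' ord0 + _)]mulN1r; apply: valM; first exact: val_cst.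
    apply: valD; first exact: val_cst.
    by apply: valM => //; exact: val_cst.
  by have /eqP := lideal_val Iz vd; rewrite mulr0 addr0 subr_eq0 => /eqP.
have e1 : c' (lift ord0 ord0) = c1.
  apply/eqP; rewrite eq_sym -subr_eq0; apply/eqP.
  have [//|/eqP n0] := eqVneq (c1 - c' (lift ord0 ord0)) 0.
  case: nI; apply: local_inI; rewrite -/th.
  set k := c1 - _ in n0.
  have Ik : I (cstF k * th).
    have -> : cstF k * th = (z - (cstF (c' ord0) + cstF (c' (lift ord0 ord0)) * th))
       + (cstF (-1)) * ((th * (u - psi b h * v) - cstF c1 * th) + v * (Y - cstF y0 + th * psi b h)).
      rewrite ez e0 /k (rmorphN (@cstF K)) rmorph1 (rmorphB (@cstF K)) -/th; ring.
    apply: lideal_add => //; apply: lideal_mul; first exact: O_cst.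
    by apply: lideal_add; [apply: red | apply: lideal_mul].
  have -> : th = cstF k^-1 * (cstF k * th).
    by rewrite mulrA -(rmorphM (@cstF K)) mulVf ?rmorph1 ?mul1r //; apply/eqP.
  by apply: lideal_mul => //; exact: O_cst.
apply/ffunP => i; rewrite ffunE; case: eqP => [->//|].
case: i => [[|[|//]]] hi ne; first by case: ne; apply: val_inj.
by rewrite -e1; congr (c' _); apply: val_inj.
Qed.

End Multiplicity.

(** * The degree of the field generated by phi_x and phi_y y *)

Lemma homog_scale (L : fieldType) (g x z : L) i m : z != 0 -> (i <= m)%N ->
  g * x ^+ i * z ^+ (m - i) = z ^+ m * (g * (x ^+ i / z ^+ i)).
Proof.
move=> z0 im; rewrite -[in RHS](subnK im) exprD.
by field; rewrite expf_neq0.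
Qed.

Section HomogIndep.
Variables (k : fieldType) (N D : {poly k}).
Hypotheses (cND : coprimep N D) (sDN : (size D < size N)%N) (D0 : D != 0).

(** Only the top coefficient is unrestricted: D divides it, and moving the
    quotient to the next coefficient makes the degree of that one too large. *)
Lemma homog_top m (g : nat -> {poly k}) :
  (forall i, (i < m)%N -> (size (g i) < size N)%N) ->
  \sum_(i < m.+1) g i * N ^+ i * D ^+ (m - i) = 0 -> g m = 0.
Proof.
elim: m g => [|m IH] g sg; first by rewrite big_ord1 !expr0 !mulr1.
rewrite big_ord_recr /= subnn expr0 mulr1.
have -> : \sum_(i < m.+1) g i * N ^+ i * D ^+ (m.+1 - i) =
          D * \sum_(i < m.+1) g i * N ^+ i * D ^+ (m - i).
  rewrite big_distrr /=; apply: eq_bigr => i _.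
  by rewrite (subSn (ltnSE (ltn_ord _))) exprS; ring.
move=> e.
have dg : D %| g m.+1.
  rewrite -(@Gauss_dvdpl _ _ (N ^+ m.+1)); last first.
    by rewrite coprimep_sym coprimep_expl.
  have -> : g m.+1 * N ^+ m.+1 = - (D * \sum_(i < m.+1) g i * N ^+ i * D ^+ (m - i)).
    by apply/eqP; rewrite -addr_eq0 addrC e.
  by rewrite dvdpNr dvdp_mulr.
case/dvdpP: dg => h eh.
pose g' i := if i == m then g m + h * N else g i.
have e' : g' m = 0.
  apply: IH => [i im|]; first by rewrite /g' ltn_eqF // sg // ltnS ltnW.
  apply: (mulfI D0); rewrite mulr0 -[RHS]e eh !big_ord_recr /= subnn expr0 /g' eqxx.
  have -> : \sum_(i < m) (if val i == m then g m + h * N else g i) * N ^+ i * D ^+ (m - i)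
          = \sum_(i < m) g i * N ^+ i * D ^+ (m - i).
    by apply: eq_bigr => i _; rewrite (ltn_eqF (ltn_ord i)).
  by rewrite [N ^+ m.+1]exprS; ring.
have h0 : h = 0.
  apply/eqP; apply: contraTT (sg m (ltnSn m)) => hn0; rewrite -leqNgt.
  have -> : g m = - (h * N).
    by apply/eqP; rewrite -addr_eq0; move/eqP: e'; rewrite /g' eqxx.
  rewrite size_polyN size_mul // -?size_poly_gt0 ?(leq_ltn_trans _ sDN) //.
  by move: hn0; rewrite -size_poly_gt0; case: (size h) => // s _; rewrite addSn /= leq_addl.
by rewrite eh h0 mul0r.
Qed.

Lemma homog_indep m (g : nat -> {poly k}) :
  (forall i, (i <= m)%N -> (size (g i) < size N)%N) ->
  \sum_(i < m.+1) g i * N ^+ i * D ^+ (m - i) = 0 -> forall i, (i <= m)%N -> g i = 0.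
Proof.
elim: m g => [|m IH] g sg e i.
  rewrite leqn0 => /eqP ->; apply: (@homog_top 0) => //.
have gm : g m.+1 = 0 by apply: homog_top e => j jm; apply: sg; apply: ltnW.
rewrite leq_eqVlt => /orP[/eqP -> //|]; apply: IH.
  by move=> j jm; apply: sg; apply: leqW.
move: e; rewrite big_ord_recr /= gm !mul0r addr0.
have -> : \sum_(i < m.+1) g i * N ^+ i * D ^+ (m.+1 - i) =
          D * \sum_(i < m.+1) g i * N ^+ i * D ^+ (m - i).
  rewrite big_distrr /=; apply: eq_bigr => j _.
  by rewrite (subSn (ltnSE (ltn_ord _))) exprS; ring.
by move/eqP; rewrite mulf_eq0 (negPf D0) => /eqP.
Qed.
End HomogIndep.

Section Pullback.
Variables (k L : fieldType) (c : {rmorphism ratfun k -> L}) (y : L).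
Variables (w fx fy : ratfun k) (f2 : {poly k}).
Hypothesis (y2 : y ^+ 2 = c w).
Hypothesis (ygen : forall z, exists f g, z = c f + c g * y).
Hypothesis (yfree : forall f g, c f + c g * y = 0 -> f = 0 /\ g = 0).
Hypothesis (sf2 : size f2 = 4).

Definition pev (a : {poly k}) : ratfun k := horner_morph (fun x => mulrC fx (ratC x)) a.
HB.instance Definition _ := GRing.RMorphism.copy pev (horner_morph (fun x => mulrC fx (ratC x))).

Hypothesis (efy : fy ^+ 2 * w = pev f2).
Hypothesis (sfx : (size (fden fx) < size (fnum fx))%N).
Local Notation N := (fnum fx).
Local Notation D := (fden fx).
Let n := (size N).-1.
Let sN : size N = n.+1. Proof. by rewrite /n prednK // (leq_ltn_trans _ sfx). Qed.
Let Y := c fy * y.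
Let X := c ratX.

(** With y^2 = w, this is the pull-back field of the function field of E2. *)
Definition PF : L -> Prop :=
  subfield_gen (fun z => (exists a : k, z = c (ratC a)) \/ z = c fx \/ z = Y).

Lemma pevD a b : pev (a + b) = pev a + pev b. Proof. exact: rmorphD. Qed.
Lemma pevB a b : pev (a - b) = pev a - pev b. Proof. exact: rmorphB. Qed.
Lemma pevM a b : pev (a * b) = pev a * pev b. Proof. exact: rmorphM. Qed.
Lemma pevC a : pev a%:P = ratC a. Proof. exact: horner_morphC. Qed.
Lemma pevX : pev 'X = fx. Proof. exact: horner_morphX. Qed.
Lemma pevE a : pev a = \sum_(i < size a) ratC a`_i * fx ^+ i.
Proof.
rewrite /pev /horner_morph horner_coef size_map_poly.
by apply: eq_bigr => i _; rewrite coef_map.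
Qed.

Lemma D_neq0 : D%:F != 0 :> ratfun k. Proof. by rewrite tofrac_eq0 fden_neq0. Qed.

(** After clearing denominators, a relation becomes a form in N and D whose
    coefficients are polynomials in x of degree less than n. *)
Lemma pev_indep (a : 'I_n -> {poly k}) :
  \sum_j pev (a j) * ratX ^+ j = 0 -> forall j, a j = 0.
Proof.
move=> e; pose m := \max_j size (a j).
pose g i := \sum_(j < n) (a j)`_i *: 'X^j : {poly k}.
have sg i : (size (g i) < size N)%N.
  rewrite sN ltnS; apply: leq_trans (size_sum _ _ _) _; apply/bigmax_leqP => j _.
  by apply: leq_trans (size_scale_leq _ _) _; rewrite size_polyXn.
have eg : \sum_(i < m.+1) g i * N ^+ i * D ^+ (m - i) = 0.
  apply/eqP; rewrite -tofrac_eq0; apply/eqP.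
  have D0 := D_neq0.
  transitivity (D%:F ^+ m * \sum_(i < m.+1) (g i)%:F * fx ^+ i).
    rewrite rmorph_sum big_distrr; apply: eq_bigr => i _ /=.
    rewrite tofracM tofracXn (tofracM (g i)) tofracXn.
    have -> : fx ^+ i = N%:F ^+ i / D%:F ^+ i by rewrite {1}(fnum_fdenE fx) expr_div_n.
    have im : (i <= m)%N by rewrite -ltnS.
    exact: homog_scale.
  apply/eqP; rewrite mulf_eq0 expf_eq0 (negPf D0) andbF /=; apply/eqP.
  rewrite -[RHS]e.
  transitivity (\sum_(i < m.+1) \sum_(j < n) (ratC (a j)`_i * fx ^+ i) * ratX ^+ j).
    apply: eq_bigr => i _; rewrite /g rmorph_sum /= big_distrl; apply: eq_bigr => j _ /=.
    by rewrite -mul_polyC tofracM tofracXn /ratC /ratX; ring.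
  rewrite exchange_big; apply: eq_bigr => j _ /=; rewrite -big_distrl /=; congr (_ * _).
  rewrite pevE; have sm : (size (a j) <= m.+1)%N.
    by apply: leqW; apply: (leq_bigmax j).
  rewrite (big_ord_widen _ (fun i => ratC (a j)`_i * fx ^+ i) sm) [RHS]big_mkcond.
  apply: eq_bigr => i _; case: ltnP => // h; rewrite nth_default //.
  by rewrite (rmorph0 (@ratC k)) mul0r.
move=> j; apply/polyP => i; rewrite coef0.
have [im|im] := leqP i m; last first.
  rewrite nth_default //; apply: leq_trans (ltnW im).
  exact: (leq_bigmax j).
have := homog_indep (coprimep_fnum_fden fx) sfx (fden_neq0 fx) (fun i _ => sg i) eg im.
move/(congr1 (fun p : {poly k} => p`_j)); rewrite /g coef_sum coef0 (bigD1 j) //=.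
rewrite coefZ coefXn eqxx mulr1 big1 ?addr0 // => l lj.
by rewrite coefZ coefXn -val_eqE eq_sym in lj *; rewrite (negPf lj) mulr0.
Qed.

Lemma n_gt0 : (0 < n)%N.
Proof.
rewrite -ltnS -sN; apply: leq_trans sfx; rewrite ltnS size_poly_gt0; exact: fden_neq0.
Qed.

Lemma pev_inj a : pev a = 0 -> a = 0.
Proof.
move=> e; have := @pev_indep (fun j => if val j == 0%N then a else 0).
move=> /(_ _ (Ordinal n_gt0)); apply.
rewrite (bigD1 (Ordinal n_gt0)) //= e mul0r add0r big1 // => j.
rewrite -val_eqE /= => /negPf ->; by rewrite -polyC0 pevC (rmorph0 (@ratC k)) mul0r.
Qed.

Definition PFform z := exists a b e : {poly k},
  e != 0 /\ c (pev e) * z = c (pev a) + c (pev b) * Y.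

Lemma c_inj f : c f = 0 -> f = 0.
Proof. by move/eqP; rewrite fmorph_eq0 => /eqP. Qed.

Lemma Y2 : Y ^+ 2 = c (pev f2).
Proof. by rewrite /Y exprMn y2 -rmorphXn -rmorphM efy. Qed.

Lemma pev_neq0 a : a != 0 -> c (pev a) != 0.
Proof. by apply: contraNneq => /c_inj /pev_inj ->. Qed.

Lemma cpM a b : c (pev (a * b)) = c (pev a) * c (pev b).
Proof. by rewrite pevM rmorphM. Qed.
Lemma cpD a b : c (pev (a + b)) = c (pev a) + c (pev b).
Proof. by rewrite pevD rmorphD. Qed.
Lemma cpN a : c (pev (- a)) = - c (pev a).
Proof. by rewrite -sub0r pevB -polyC0 pevC (rmorph0 (@ratC k)) sub0r rmorphN. Qed.
Lemma cp1 : c (pev 1) = 1. Proof. by rewrite !rmorph1. Qed.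
Lemma cp0 : c (pev 0) = 0. Proof. by rewrite -polyC0 pevC (rmorph0 (@ratC k)) rmorph0. Qed.

(** The degree of f2 is odd. *)
Lemma norm_neq0 (a b : {poly k}) : a ^+ 2 - b ^+ 2 * f2 = 0 -> a = 0 /\ b = 0.
Proof.
move=> /eqP; rewrite subr_eq0 => /eqP e.
have f20 : f2 != 0 by rewrite -size_poly_eq0 sf2.
have [b0|b0] := eqVneq b 0.
  by split=> //; move/eqP: e; rewrite b0 expr0n mul0r expf_eq0 => /eqP.
have a0 : a != 0.
  by apply: contraNneq b0 => a0; move/eqP: e; rewrite a0 expr0n eq_sym mulf_eq0 (negPf f20) orbF expf_eq0.
have := congr1 (fun p : {poly k} => size p) e.
rewrite /= [in RHS]size_mul ?expf_neq0 // sf2 !expr2 !size_mul //.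
move: a0 b0; rewrite -!size_poly_gt0.
case: (size a) => // s _; case: (size b) => // s' _.
by rewrite !addSn !addnS /= => -[] /(congr1 odd); rewrite /= !oddD !addbb.
Qed.

(** Since Y^2 is a polynomial in fx, the field generated by fx and Y consists of
    the quotients (a + b Y) / e. *)
Lemma PF_form z : PF z -> PFform z.
Proof.
elim=> {z} [z h| | z z' _ [a [b [e [e0 h]]]] _ [a' [b' [e' [e0' h']]]] |
    z z' _ [a [b [e [e0 h]]]] _ [a' [b' [e' [e0' h']]]] | z _ [a [b [e [e0 h]]]]].
- case: h => [[a ->]|[->|->]].
  + by exists a%:P, 0, 1; rewrite oner_neq0 cp1 mul1r pevC cp0 mul0r addr0.
  + by exists 'X, 0, 1; rewrite oner_neq0 cp1 mul1r pevX cp0 mul0r addr0.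
  + by exists 0, 1, 1; rewrite oner_neq0 cp1 !mul1r cp0 add0r.
- by exists 1, 0, 1; rewrite oner_neq0 cp1 mul1r cp0 mul0r addr0.
- exists (e' * a - e * a'), (e' * b - e * b'), (e * e'); split; first by rewrite mulf_neq0.
  have -> : c (pev (e * e')) * (z - z') = c (pev e') * (c (pev e) * z) - c (pev e) * (c (pev e') * z').
    by rewrite cpM; ring.
  by rewrite h h' !(cpD, cpN, cpM); ring.
- exists (a * a' + b * b' * f2), (a * b' + a' * b), (e * e'); split; first by rewrite mulf_neq0.
  have -> : c (pev (e * e')) * (z * z') = (c (pev e) * z) * (c (pev e') * z').
    by rewrite cpM; ring.
  by rewrite h h' !(cpD, cpM) -Y2; ring.
- have [->|z0] := eqVneq z 0.
    by exists 0, 0, 1; rewrite oner_neq0 invr0 mulr0 cp0 mul0r addr0.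
  have nn0 : a ^+ 2 - b ^+ 2 * f2 != 0.
    apply/eqP => /norm_neq0 [za zb].
    have := pev_neq0 e0; move/eqP: h; rewrite za zb cp0 mul0r addr0 mulf_eq0 (negPf z0) orbF.
    by move=> ->.
  exists (e * a), (- (e * b)), (a ^+ 2 - b ^+ 2 * f2); split=> //.
  apply: (mulIf z0); rewrite mulfVK //.
  have -> : c (pev (a ^+ 2 - b ^+ 2 * f2)) = (c (pev a) + c (pev b) * Y) * (c (pev a) - c (pev b) * Y).
    by rewrite !(expr2, cpD, cpN, cpM) -Y2; ring.
  by rewrite -h !(cpN, cpM); ring.
Qed.

Lemma PF0 : PF 0. Proof. rewrite -(subrr 1); apply: sg_sub; exact: sg_one. Qed.
Lemma PFN z : PF z -> PF (- z). Proof. by move=> h; rewrite -sub0r; apply: sg_sub => //; exact: PF0. Qed.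
Lemma PFD z z' : PF z -> PF z' -> PF (z + z').
Proof. by move=> h h'; rewrite -[z']opprK; apply: sg_sub => //; exact: PFN. Qed.
Lemma PFC a : PF (c (ratC a)). Proof. by apply: sg_gen; left; exists a. Qed.
Lemma PFx : PF (c fx). Proof. by apply: sg_gen; right; left. Qed.
Lemma PFY : PF Y. Proof. by apply: sg_gen; right; right. Qed.
Lemma PF_sum (I : finType) (f : I -> L) : (forall i, PF (f i)) -> PF (\sum_i f i).
Proof. by move=> h; elim/big_ind: _ => //; [exact: PF0|exact: PFD]. Qed.

Lemma fy_neq0 : fy != 0.
Proof.
apply/eqP => z; have := efy; rewrite z expr0n mul0r => /esym/pev_inj f0.
by move: sf2; rewrite f0 size_poly0.
Qed.

(** The parts without and with y give two relations over k(fx). *)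
Lemma PF_indep (z : 'I_n -> L) : (forall j, PF (z j)) ->
  \sum_j z j * X ^+ j = 0 -> forall j, z j = 0.
Proof.
move=> hz ez.
have /fin_all_exists [a /fin_all_exists [b /fin_all_exists [e h]]] := fun j => PF_form (hz j).
pose ee := \prod_j e j.
have ee0 : ee != 0 by apply/prodf_neq0 => j _; case: (h j).
pose co j := \prod_(i | i != j) e i.
have eco j : ee = co j * e j by rewrite /ee (bigD1 j) //= mulrC.
have zj j : c (pev ee) * z j = c (pev (co j * a j)) + c (pev (co j * b j)) * Y.
  by rewrite (eco j) cpM -mulrA (h j).2 !cpM; ring.
have eq0 : c (\sum_j pev (co j * a j) * ratX ^+ j) + c (fy * \sum_j pev (co j * b j) * ratX ^+ j) * y = 0.
  rewrite -[RHS](mulr0 (c (pev ee))) -ez [in RHS]big_distrr /=.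
  rewrite (rmorphM c) !(rmorph_sum c) /= mulrAC -/Y big_distrr -big_split /=.
  apply: eq_bigr => j _; rewrite mulrA zj !(rmorphM c) (rmorphXn c) -/X; ring.
have [/pev_indep ea eb] := yfree eq0.
have {}eb : \sum_j pev (co j * b j) * ratX ^+ j = 0.
  by move/eqP: eb; rewrite mulf_eq0 (negPf fy_neq0) => /eqP.
move/pev_indep in eb.
move=> j; have := zj j; rewrite ea eb cp0 mul0r addr0 => /eqP.
by rewrite mulf_eq0 (negPf (pev_neq0 ee0)) => /eqP.
Qed.

Definition span z := exists v : 'I_n -> L, (forall j, PF (v j)) /\ z = \sum_j v j * X ^+ j.

Lemma spanD z z' : span z -> span z' -> span (z + z').
Proof.
move=> [v [hv ->]] [v' [hv' ->]]; exists (fun j => v j + v' j); split.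
  by move=> j; apply: PFD; [exact: hv | exact: hv'].
by rewrite -big_split /=; apply: eq_bigr => j _; rewrite mulrDl.
Qed.
Lemma spanZ a z : PF a -> span z -> span (a * z).
Proof.
move=> ha [v [hv ->]]; exists (fun j => a * v j); split.
  by move=> j; apply: sg_mul; [exact: ha | exact: hv].
by rewrite big_distrr; apply: eq_bigr => j _ /=; rewrite mulrA.
Qed.
Lemma span0 : span 0.
Proof. by exists (fun _ => 0); split; [move=> _; exact: PF0|rewrite big1 // => j _; rewrite mul0r]. Qed.
Lemma span_sum m (f : 'I_m -> L) : (forall i, span (f i)) -> span (\sum_i f i).
Proof. by move=> h; elim/big_ind: _ => //; [exact: span0|exact: spanD]. Qed.

Lemma cX_poly (g : {poly k}) : c g%:F = \sum_(i < size g) c (ratC g`_i) * X ^+ i.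
Proof.
rewrite -{1}[g]coefK poly_def !rmorph_sum; apply: eq_bigr => i _ /=.
by rewrite -mul_polyC tofracM tofracXn rmorphM rmorphXn.
Qed.

Lemma span_Xsmall j : (j < n)%N -> span (X ^+ j).
Proof.
move=> jn; exists (fun i => if i == Ordinal jn then 1 else 0); split.
  by move=> i; case: ifP => _; [exact: sg_one|exact: PF0].
rewrite (bigD1 (Ordinal jn)) //= eqxx mul1r big1 ?addr0 // => i /negPf ->.
by rewrite mul0r.
Qed.

(** x is a root of N(T) - fx D(T), whose leading coefficient is constant. *)
Lemma span_Xn : span (X ^+ n).
Proof.
have lN : N`_n != 0.
  by have := lead_coef_eq0 N; rewrite /lead_coef sN /= => ->; rewrite -size_poly_eq0 sN.
have e : c N%:F = c fx * c D%:F.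
  have fxD : fx * D%:F = N%:F by rewrite {1}(fnum_fdenE fx) divfK // D_neq0.
  by rewrite -(rmorphM c) fxD.
rewrite !cX_poly sN big_ord_recr /= in e.
have -> : X ^+ n = c (ratC (N`_n)^-1) *
   (c fx * (\sum_(i < size D) c (ratC D`_i) * X ^+ i) + \sum_(i < n) c (ratC (- N`_i)) * X ^+ i).
  have -> : \sum_(i < n) c (ratC (- N`_i)) * X ^+ i = - \sum_(i < n) c (ratC (N`_i)) * X ^+ i.
    by rewrite -sumrN; apply: eq_bigr => i _; rewrite !rmorphN mulNr.
  have addK' (a b' : L) : a + b' - a = b' by rewrite addrC addKr.
  have nK : c (ratC (N`_n)^-1) * c (ratC N`_n) = 1.
    by rewrite -(rmorphM c) -(rmorphM (@ratC k)) mulVf // (rmorph1 (@ratC k)) rmorph1.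
  by rewrite -e addK' mulrA nK mul1r.
apply: spanZ; first exact: PFC.
apply: spanD; last by apply: span_sum => i; apply: spanZ (PFC _) (span_Xsmall _).
apply: spanZ PFx _; apply: span_sum => i; apply: spanZ (PFC _) (span_Xsmall _).
by have := leq_trans (ltn_ord i) (ltnSE (leq_trans sfx (eq_leq sN))).
Qed.

Lemma span_X m : span (X ^+ m).
Proof.
elim: m => [|m [v [hv e]]]; first by rewrite expr0; exact: (span_Xsmall n_gt0).
rewrite exprS e big_distrr /=; apply: span_sum => j.
have -> : X * (v j * X ^+ j) = v j * X ^+ j.+1 by rewrite exprS; ring.
apply: spanZ => //; have := ltn_ord j; rewrite leq_eqVlt => /orP[/eqP ->|/span_Xsmall //].
exact: span_Xn.
Qed.

Lemma span_poly (g : {poly k}) : span (c g%:F).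
Proof. by rewrite cX_poly; apply: span_sum => i; apply: spanZ (PFC _) (span_X _). Qed.

Lemma span_denom z : exists2 q : {poly k}, q != 0 & span (c q%:F * z).
Proof.
have [f [g ->]] := ygen z.
have -> : c g * y = c (g / fy) * Y.
  by rewrite /Y mulrA -(rmorphM c) divfK // fy_neq0.
set g' := g / fy.
have d0 (h : ratfun k) : (fden h)%:F != 0 :> ratfun k by rewrite tofrac_eq0 fden_neq0.
have dE (h : ratfun k) : (fden h)%:F * h = (fnum h)%:F.
  by rewrite [X in _ * X = _](fnum_fdenE h) mulrC divfK ?d0.
exists (fden f * fden g'); first by rewrite mulf_neq0 ?fden_neq0.
have -> : c (fden f * fden g')%:F * (c f + c g' * Y) =
  c ((fden g' * fnum f)%:F) + Y * c ((fden f * fnum g')%:F).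
  by rewrite !(tofracM _ (fnum _)) -!dE !rmorphM /=; ring.
apply: spanD; first exact: span_poly.
exact: spanZ PFY (span_poly _).
Qed.

(** The powers 1, x, ..., x^(n-1) are independent over the pull-back field, and
    they span, since any element has a multiple by a nonzero polynomial q in x
    in their span and a basis b may be replaced by q b.  The two
    transition matrices between the bases are then inverse to each other. *)
Lemma pullback_degree d : has_degree_over PF d -> d = n.
Proof.
move=> [b hb].
have /fin_all_exists2 [q0 q0n hq0] := fun i => span_denom (b i).
pose q := \prod_i q0 i.
have qn0 : q != 0 by apply/prodf_neq0 => i _.
have hq i : span (c q%:F * b i).
  have -> : c q%:F * b i = c (\prod_(l | l != i) q0 l)%:F * (c (q0 i)%:F * b i).
    by rewrite /q (bigD1 i) //= tofracM (rmorphM c); ring.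
  have [v [hv ->]] := hq0 i.
  rewrite big_distrr; apply: span_sum => j /=.
  rewrite mulrCA; apply: spanZ => //.
  have -> : X ^+ j = c ('X^j)%:F by rewrite tofracXn (rmorphXn c).
  rewrite -(rmorphM c) -tofracM; exact: span_poly.
have cq0 : c q%:F != 0 by rewrite fmorph_eq0 tofrac_eq0.
have /fin_all_exists [A hA] := hq.
have hB j : exists v : {ffun 'I_d -> L}, (forall i, PF (v i)) /\ X ^+ j = \sum_i v i * (c q%:F * b i).
  have [v [[hv ev] _]] := hb (X ^+ j / c q%:F).
  exists v; split=> //.
  have -> : \sum_i v i * (c q%:F * b i) = c q%:F * \sum_i v i * b i.
    by rewrite big_distrr; apply: eq_bigr => i _ /=; ring.
  by rewrite -ev mulrC divfK.
have /fin_all_exists [B hB'] := fun j : 'I_n => hB j.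
pose MA := \matrix_(i, j) A i j; pose MB := \matrix_(j, i) B j i.
have AB : MA *m MB = 1%:M.
  apply/matrixP => i l; rewrite !mxE.
  have [v [_ uv]] := hb (b i).
  have e1 : v = [ffun l => \sum_j A i j * B j l].
    apply: uv; split; first by move=> l'; rewrite ffunE; apply: PF_sum => j; apply: sg_mul; [exact: (hA i).1|exact: (hB' j).1].
    apply: (mulfI cq0); rewrite (hA i).2.
    transitivity (\sum_j A i j * \sum_l B j l * (c q%:F * b l)).
      by apply: eq_bigr => j _; rewrite -(hB' j).2.
    rewrite big_distrr /=.
    under eq_bigr do rewrite big_distrr /=.
    rewrite exchange_big; apply: eq_bigr => l' _ /=; rewrite ffunE big_distrl big_distrr /=.
    by apply: eq_bigr => j _; ring.
  have e2 : v = [ffun l => (i == l)%:R].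
    apply: uv; split; first by move=> l'; rewrite ffunE; case: (i == l'); [exact: sg_one|exact: PF0].
    rewrite (bigD1 i) //= ffunE eqxx mul1r big1 ?addr0 // => l' h.
    by rewrite ffunE eq_sym (negPf h) mul0r.
  have := congr1 (fun f : {ffun 'I_d -> L} => f l) (etrans (esym e1) e2); rewrite !ffunE => <-.
  by apply: eq_bigr => j _; rewrite !mxE.
have BA : MB *m MA = 1%:M.
  apply/matrixP => j l; rewrite !mxE.
  have := @PF_indep (fun l => \sum_i B j i * A i l - (j == l)%:R).
  move=> /(_ _ _ l) H; apply/eqP; rewrite -subr_eq0.
  have -> : \sum_i MB j i * MA i l = \sum_i B j i * A i l.
    by apply: eq_bigr => i _; rewrite !mxE.
  apply/eqP; apply: H => [l'|].
    apply: sg_sub; first by apply: PF_sum => i; apply: sg_mul; [exact: (hB' j).1|exact: (hA i).1].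
    by case: (j == l'); [exact: sg_one|exact: PF0].
  under eq_bigr do rewrite mulrBl.
  rewrite sumrB; apply/eqP; rewrite subr_eq0; apply/eqP.
  transitivity (X ^+ j); last first.
    rewrite (bigD1 j) //= eqxx mul1r big1 ?addr0 // => l' h.
    by rewrite eq_sym (negPf h) mul0r.
  rewrite (hB' j).2.
  under eq_bigr do rewrite big_distrl /=.
  rewrite exchange_big; apply: eq_bigr => i _ /=; rewrite (hA i).2 big_distrr /=.
  by apply: eq_bigr => l' _; ring.
by apply/eqP; rewrite eqn_leq (mulmx1_min AB) (mulmx1_min BA).
Qed.
End Pullback.

(** * The function field of an elliptic curve *)

Section FunctionFieldOfE.
Variables (k : fieldType) (E : ellcurve k).
Local Notation h := (ff_poly E).
Local Notation L := (funfield E).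

Definition cubic_poly : {poly k} := ec_cubic E polyC 'X 1.

Lemma cubic_polyE : cubic_poly = 'X^3 + (ec_a2 E)%:P * 'X^2 + (ec_a4 E)%:P * 'X + (ec_a6 E)%:P.
Proof. by rewrite /cubic_poly /ec_cubic !expr1n !mulr1. Qed.

Lemma cubic_ratE : ec_cubic E (@ratC k) ratX 1 = cubic_poly%:F.
Proof.
by rewrite /cubic_poly /ec_cubic /ratC /ratX !(tofracD, tofracM, tofracXn, tofrac1).
Qed.

Lemma mk_h : mk_monic h = h.
Proof. by rewrite mk_monicE //; exact: ff_poly_irr. Qed.

Lemma size_h : size h = 3.
Proof.
rewrite /ff_poly size_polyDl size_polyXn // size_polyN.
exact: leq_ltn_trans (size_polyC_leq1 _) _.
Qed.

Definition toL (p : {poly ratfun k}) : L := in_qpoly h p.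
Lemma toLD p q : toL (p + q) = toL p + toL q. Proof. exact: in_qpolyD. Qed.
Lemma toLM p q : toL (p * q) = toL p * toL q. Proof. exact: in_qpolyM. Qed.
Lemma toL1 : toL 1 = 1. Proof. exact: in_qpoly1. Qed.
Lemma toLZ a p : toL (a *: p) = (a *: (in_qpoly h p : {poly %/ h with ff_poly_irr E}) : {poly %/ h with ff_poly_irr E}).
Proof. exact: in_qpolyZ. Qed.

Lemma ffC_toL f : ffC E f = toL f%:P.
Proof.
rewrite /ffC -[f%:P]mulr1 mul_polyC toLZ; congr (_ *: _).
exact/esym/toL1.
Qed.

Lemma ffC_is_additive : zmod_morphism (@ffC k E).
Proof. by move=> f g; rewrite /ffC scalerBl. Qed.
Lemma ffC_is_multiplicative : monoid_morphism (@ffC k E).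
Proof.
split=> [|f g]; first by rewrite ffC_toL toL1.
by rewrite !ffC_toL polyCM toLM.
Qed.
HB.instance Definition _ := GRing.isZmodMorphism.Build _ _ (@ffC k E) ffC_is_additive.
HB.instance Definition _ := GRing.isMonoidMorphism.Build _ _ (@ffC k E) ffC_is_multiplicative.

Lemma monic_h : h \is monic.
Proof. by have [_] := ff_poly_irr E. Qed.

Lemma toL_h : toL h = 0.
Proof. by apply: val_inj; rewrite /= mk_h Pdiv.RingMonic.rmodpp ?monic_h. Qed.

Lemma toL_small (p : {poly ratfun k}) : (size p < 3)%N -> toL p = 0 -> p = 0.
Proof.
move=> sp /(congr1 val) /=; rewrite mk_h Pdiv.Ring.rmodp_small ?size_h //.
Qed.

Lemma ffy2 : ffy E ^+ 2 = ffC E (cubic_poly)%:F.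
Proof.
rewrite -cubic_ratE ffC_toL expr2 -[ffy E]/(toL 'X) -toLM -expr2.
have -> : 'X^2 = (ec_cubic E (@ratC k) ratX 1)%:P + h by rewrite /ff_poly addrC subrK.
by rewrite toLD toL_h addr0.
Qed.

Lemma ff_gen (z : L) : exists f g, z = ffC E f + ffC E g * ffy E.
Proof.
pose p : {poly ratfun k} := val z.
have sm : size (mk_monic h) = 3 by rewrite mk_h size_h.
have sp : (size p < 3)%N := leq_trans (size_mk_monic z) (eq_leq sm).
have ep : p = (p`_0)%:P + (p`_1)%:P * 'X.
  apply/polyP => -[|[|i]]; rewrite coefD coefC coefCM coefX /= ?mulr0 ?mulr1 ?addr0 ?add0r //.
  by rewrite nth_default // (leq_trans (ltnSE sp)).
exists p`_0, p`_1; rewrite !ffC_toL -[ffy E]/(toL 'X) -toLM -toLD -ep.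
by apply: val_inj; exact: (esym (in_qpoly_small (size_mk_monic z))).
Qed.

Lemma ff_free f g : ffC E f + ffC E g * ffy E = 0 -> f = 0 /\ g = 0.
Proof.
rewrite !ffC_toL -[ffy E]/(toL 'X) -toLM -toLD => /toL_small e.
have : f%:P + g%:P * 'X = 0.
  apply: e; apply: leq_ltn_trans (size_polyD _ _) _; rewrite gtn_max.
  rewrite (leq_ltn_trans (size_polyC_leq1 _)) //=.
  by apply: leq_ltn_trans (size_polyMleq _ _) _; rewrite size_polyX addn2 /= ltnS ltnS size_polyC_leq1.
move=> e'; have co i : (f%:P + g%:P * 'X)`_i = 0 by rewrite e' coef0.
by have := co 0%N; have := co 1%N; rewrite !coefD !coefC !coefCM !coefX mulr0 mulr1 addr0 add0r.
Qed.
End FunctionFieldOfE.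

(** * The polynomial equation of an isogeny *)

Section RmorphHomcub.
Variables (R S : comNzRingType) (f : {rmorphism R -> S}).

Lemma rmorph_lhs b nn d c1 c2 c3 :
  f (b ^+ 2 * (nn ^+ 3 + c1 * (nn ^+ 2 * d) + c2 * (nn * d ^+ 2) + c3 * d ^+ 3)) =
  f b ^+ 2 * (f nn ^+ 3 + f c1 * (f nn ^+ 2 * f d) + f c2 * (f nn * f d ^+ 2) + f c3 * f d ^+ 3).
Proof. by rewrite !(rmorphXn, rmorphM, rmorphD). Qed.

Lemma rmorph_rhs a g d : f (a ^+ 2 * g * d ^+ 3) = f a ^+ 2 * f g * f d ^+ 3.
Proof. by rewrite !(rmorphXn, rmorphM). Qed.
End RmorphHomcub.

Section Isog.
Variables (k : fieldType) (E1 E2 : ellcurve k) (fx fy : ratfun k).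
Hypothesis iso : is_isogeny E1 E2 fx fy.
Local Notation N := (fnum fx).
Local Notation D := (fden fx).
Local Notation A := (fnum fy).
Local Notation B := (fden fy).
Local Notation f1 := (cubic_poly E1).
Local Notation f2 := (cubic_poly E2).
Local Notation n := (size N).-1.

Lemma size_cubic_poly (E : ellcurve k) : size (cubic_poly E) = 4.
Proof.
rewrite cubic_polyE.
have h : (size (Poly [:: ec_a6 E; ec_a4 E; ec_a2 E]) < size ('X^3 : {poly k}))%N.
  by rewrite size_polyXn ltnS size_Poly.
have -> : 'X^3 + (ec_a2 E)%:P * 'X^2 + (ec_a4 E)%:P * 'X + (ec_a6 E)%:P =
  'X^3 + Poly [:: ec_a6 E; ec_a4 E; ec_a2 E].
  by rewrite /= !cons_poly_def; ring.
by rewrite size_polyDl // size_polyXn.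
Qed.

Lemma pevXn i : pev fx 'X^i = fx ^+ i.
Proof. exact: (etrans (rmorphXn (pev fx) i 'X) (congr1 (fun z => z ^+ i) (pevX fx))). Qed.

Lemma pev_cubic : pev fx f2 =
  fx ^+ 3 + ratC (ec_a2 E2) * fx ^+ 2 + ratC (ec_a4 E2) * fx + ratC (ec_a6 E2).
Proof.
rewrite cubic_polyE !pevD (pevM fx (ec_a2 E2)%:P) (pevM fx (ec_a4 E2)%:P).
by rewrite !pevXn !pevC pevX.
Qed.

(** Both sides of the equation of E2, pulled back to k(E1), are in k(x1). *)
Lemma isog_eq : fy ^+ 2 * f1%:F = pev fx f2.
Proof.
have [e _] := iso.
have -> : pev fx f2 = fx ^+ 3 + ratC (ec_a2 E2) * fx ^+ 2 + ratC (ec_a4 E2) * fx + ratC (ec_a6 E2).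
  exact: pev_cubic.
have e1 : ffC E1 (fy ^+ 2 * f1%:F) = pull_y E1 fy ^+ 2.
  by rewrite /pull_y exprMn ffy2 (rmorphM (@ffC k E1)) (rmorphXn (@ffC k E1)).
set v := (X in _ = X).
have e2 : ffC E1 v = pull_y E1 fy ^+ 2.
  rewrite e /ec_cubic /pull_x !expr1n !mulr1 /v.
  rewrite !(rmorphD (@ffC k E1)) (rmorphM (@ffC k E1) (ratC (ec_a2 E2))).
  by rewrite (rmorphM (@ffC k E1) (ratC (ec_a4 E2))) !(rmorphXn (@ffC k E1)).
apply: (fmorph_inj (@ffC k E1)); exact: etrans e1 (esym e2).
Qed.

Lemma isog_degree d : isogeny_degree E1 fx fy d -> d = n.
Proof.
move=> hd; have [_ s] := iso.
apply: (@pullback_degree k (funfield E1) (@ffC k E1) (ffy E1) (f1%:F) fx fy f2) => //.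
- exact: ffy2.
- exact: ff_gen.
- exact: ff_free.
- exact: size_cubic_poly.
- exact: isog_eq.
Qed.

Lemma sfx : (size D < size N)%N. Proof. by have [] := iso. Qed.

(** The cubic of E2, homogenized, at (N : D). *)
Definition homcub : {poly k} :=
  N ^+ 3 + (ec_a2 E2)%:P * (N ^+ 2 * D) + (ec_a4 E2)%:P * (N * D ^+ 2) + (ec_a6 E2)%:P * D ^+ 3.

Lemma frac_clear (L : fieldType) (a b nn d c1 c2 c3 f : L) : b != 0 -> d != 0 ->
  (a / b) ^+ 2 * f = (nn / d) ^+ 3 + c1 * (nn / d) ^+ 2 + c2 * (nn / d) + c3 ->
  b ^+ 2 * (nn ^+ 3 + c1 * (nn ^+ 2 * d) + c2 * (nn * d ^+ 2) + c3 * d ^+ 3) = a ^+ 2 * f * d ^+ 3.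
Proof.
move=> b0 d0 e.
have -> : a ^+ 2 * f * d ^+ 3 = ((a / b) ^+ 2 * f) * (b ^+ 2 * d ^+ 3) by field.
by rewrite e; field.
Qed.

Lemma isog_poly_eq : B ^+ 2 * homcub = A ^+ 2 * f1 * D ^+ 3.
Proof.
have b0 : B%:F != 0 :> ratfun k by rewrite tofrac_eq0 fden_neq0.
have d0 : D%:F != 0 :> ratfun k by rewrite tofrac_eq0 fden_neq0.
have e := isog_eq.
have eN := fnum_fdenE fx; have eA := fnum_fdenE fy.
have e2 : pev fx f2 = fx ^+ 3 + ratC (ec_a2 E2) * fx ^+ 2 + ratC (ec_a4 E2) * fx + ratC (ec_a6 E2).
  exact: pev_cubic.
have e3 : (A%:F / B%:F) ^+ 2 * f1%:F = (N%:F / D%:F) ^+ 3 +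
  ratC (ec_a2 E2) * (N%:F / D%:F) ^+ 2 + ratC (ec_a4 E2) * (N%:F / D%:F) + ratC (ec_a6 E2).
  by rewrite -eA -eN -e2.
have := frac_clear b0 d0 e3 => e4.
apply/eqP; rewrite -tofrac_eq; apply/eqP.
by rewrite /homcub rmorph_lhs rmorph_rhs.
Qed.

Lemma size_homcub : size homcub = (3 * n).+1.
Proof.
have sDN := sfx; have N0 : (0 < size N)%N by exact: leq_ltn_trans sDN.
have sN : size N = n.+1 by rewrite prednK.
have sD : (size D <= n)%N by move: sDN; rewrite sN.
have sN3 : size (N ^+ 3) = (3 * n).+1.
  have := size_exp N 3; rewrite mulnC => <-; rewrite prednK // size_poly_gt0.
  by rewrite expf_neq0 // -size_poly_gt0.
have sC (c : k) (p : {poly k}) : (size p <= 3 * n)%N -> (size (c%:P * p)%R <= 3 * n)%N.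
  by move=> h; rewrite mul_polyC; apply: leq_trans (size_scale_leq _ _) h.
have sM (p q : {poly k}) a b : (size p <= a.+1)%N -> (size q <= b.+1)%N ->
    (size (p * q)%R <= (a + b).+1)%N.
  move=> sp sq; apply: leq_trans (size_polyMleq p q) _.
  by move: sp sq; move: (size p) (size q) => x y; lia.
have n0 : (0 < n)%N by rewrite (leq_trans _ sD) // size_poly_gt0 fden_neq0.
have eD : (size D <= n.-1.+1)%N by rewrite prednK.
have eN : (size N <= n.+1)%N by rewrite sN.
have D2 := sM _ _ _ _ eD eD; have N2 := sM _ _ _ _ eN eN.
rewrite /homcub -!addrA size_polyDl sN3 // ltnS.
apply: leq_trans (size_polyD _ _) _; rewrite geq_max sC.
  apply: leq_trans (size_polyD _ _) _; rewrite geq_max !sC //.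
  - by apply: leq_trans (sM _ _ _ _ eD D2) _; lia.
  - by apply: leq_trans (sM _ _ _ _ eN D2) _; lia.
by apply: leq_trans (sM _ _ _ _ N2 eD) _; lia.
Qed.

Lemma coprime_homcub_D : coprimep homcub D.
Proof.
have -> : homcub = ((ec_a2 E2)%:P * N ^+ 2 + (ec_a4 E2)%:P * (N * D) + (ec_a6 E2)%:P * D ^+ 2) * D + N ^+ 3.
  by rewrite /homcub; ring.
rewrite coprimep_sym /coprimep (eqp_size (gcdp_addl_mul _ _ _)) -/(coprimep _ _).
by rewrite coprimep_sym coprimep_expl ?coprimep_fnum_fden.
Qed.

(** In B^2 homcub = A^2 f1 D^3, A is prime to B and homcub is prime to D. *)
Lemma isog_factor : exists g e : {poly k},
  [/\ homcub = A ^+ 2 * g, B ^+ 2 = D ^+ 3 * e & e * g = f1].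
Proof.
have cAB := coprimep_fnum_fden fy.
have /dvdpP[g eg] : A ^+ 2 %| homcub.
  rewrite -(@Gauss_dvdpr _ _ (B ^+ 2)); last by rewrite coprimep_expl // coprimep_expr.
  by rewrite isog_poly_eq -mulrA dvdp_mulr.
have B0 := fden_neq0 fy; have D0 := fden_neq0 fx.
have f10 : f1 != 0 by rewrite -size_poly_eq0 size_cubic_poly.
have A0 : A != 0.
  apply/eqP => A0; have := isog_poly_eq; rewrite A0 expr0n !mul0r => /eqP.
  rewrite mulf_eq0 expf_eq0 (negPf B0) /= => /eqP M0.
  by have := size_homcub; rewrite M0 size_poly0.
have eBg : B ^+ 2 * g = f1 * D ^+ 3.
  apply: (mulfI (expf_neq0 2 A0)); rewrite [RHS]mulrA -isog_poly_eq eg; ring.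
have cDg : coprimep (D ^+ 3) g.
  rewrite coprimep_expl //.
  apply: coprimep_dvdl (_ : coprimep D homcub); first by rewrite eg dvdp_mulr.
  by rewrite coprimep_sym coprime_homcub_D.
have /dvdpP[e eB] : D ^+ 3 %| B ^+ 2.
  by rewrite -(@Gauss_dvdpl _ _ g) // eBg dvdp_mull.
exists g, e; split; [by rewrite eg mulrC|by rewrite eB mulrC|].
apply: (mulfI (expf_neq0 3 D0)); rewrite [RHS]mulrC -eBg eB; ring.
Qed.
End Isog.

(** A factor of A^2 g prime to its cofactor and to g is a constant times a square. *)
Lemma odd_size_square_factor (K : closedFieldType) (P R A g : {poly K}) :
  P != 0 -> A != 0 -> g != 0 -> P * R = A ^+ 2 * g -> coprimep P R -> coprimep P g ->
  odd (size P).
Proof.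
elim: {A}(size A) {-2}A (leqnn (size A)) P => [|m IH] A sA P P0 A0 g0 e cPR cPg.
  by move: sA; rewrite leqn0 size_poly_eq0 (negPf A0).
have [/eqP -> //|sP] := boolP (size P == 1).
have [x rx] : exists x, root P x by apply/closed_rootP.
have nR : ~~ root R x.
  by apply: contraL cPR => rR; apply/negP => /coprimep_root /(_ rx); rewrite (rootP rR) eqxx.
have ng : ~~ root g x.
  by apply: contraL cPg => rR; apply/negP => /coprimep_root /(_ rx); rewrite (rootP rR) eqxx.
have rA : root A x.
  have : root (P * R) x by rewrite rootM rx.
  by rewrite e rootM (negPf ng) orbF rootE hornerM mulf_eq0 orbb.
have [A' eA] := factor_theorem _ _ rA.
have t0 : 'X - x%:P != 0 by rewrite polyXsubC_eq0.
have /dvdpP[P' eP] : ('X - x%:P) ^+ 2 %| P.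
  rewrite -(@Gauss_dvdpl _ _ R); last by rewrite coprimep_expl // coprimep_sym coprimep_XsubC.
  by rewrite e eA; apply/dvdpP; exists (A' ^+ 2 * g); ring.
have P'0 : P' != 0 by apply: contraNneq P0 => z; rewrite eP z mul0r.
have A'0 : A' != 0 by apply: contraNneq A0 => z; rewrite eA z mul0r.
have e' : P' * R = A' ^+ 2 * g.
  apply: (mulfI (expf_neq0 2 t0)); rewrite mulrA [_ * P']mulrC -eP e eA; ring.
have sP' : size P = (size P').+2.
  by rewrite eP size_mul ?expf_neq0 // size_exp_XsubC addn3.
rewrite sP' /= negbK; apply: (IH A' _ P') => //.
- by move: sA; rewrite eA size_mul // size_XsubC addn2 /= ltnS.
- by apply: coprimep_dvdr cPR; rewrite eP dvdp_mulr.
- by apply: coprimep_dvdr cPg; rewrite eP dvdp_mulr.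
Qed.

(** * The degree of phi_y *)

Section Separable.
Variables (k : fieldType) (E : ellcurve k) (K : fieldType) (m : {rmorphism k -> K}).

Definition cubK : {poly K} := map_poly m (cubic_poly E).

Lemma cubKE : cubK = 'X^3 + (m (ec_a2 E))%:P * 'X^2 + (m (ec_a4 E))%:P * 'X + (m (ec_a6 E))%:P.
Proof.
rewrite /cubK cubic_polyE !rmorphD (rmorphM _ (ec_a2 E)%:P) (rmorphM _ (ec_a4 E)%:P) /=.
by rewrite !map_polyC !map_polyXn map_polyX.
Qed.

Lemma horner_cubK x : cubK.[x] = ec_cubic E m x 1.
Proof. by rewrite cubKE /ec_cubic !hornerE /=; ring. Qed.

Lemma cubK_deriv x : cubK^`().[x] = 3%:R * x ^+ 2 + 2%:R * m (ec_a2 E) * x + m (ec_a4 E).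
Proof.
rewrite cubKE !derivD !mul_polyC !derivZ !derivXn derivX derivC.
by rewrite !hornerE /=; ring.
Qed.

Lemma size_cubK : size cubK = 4.
Proof. by rewrite size_map_poly size_cubic_poly. Qed.

Lemma ec_disc : w_disc (ec_a2 E) (ec_a4 E) (ec_a6 E) != 0.
Proof. by case: E. Qed.

Lemma cubK_separable x : cubK.[x] = 0 -> cubK^`().[x] != 0.
Proof.
move=> r; apply/eqP; rewrite cubK_deriv => r'.
have /eqP[] : m (w_disc (ec_a2 E) (ec_a4 E) (ec_a6 E)) != 0 by rewrite fmorph_eq0 ec_disc.
move: r r'; rewrite cubKE !hornerE /= => r r'.
have -> : m (w_disc (ec_a2 E) (ec_a4 E) (ec_a6 E)) = w_disc (m (ec_a2 E)) (m (ec_a4 E)) (m (ec_a6 E)).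
  rewrite /w_disc /w_b2 /w_b4 /w_b6 /w_b8.
  by rewrite !(rmorphXn, rmorphD, rmorphN, rmorphM, rmorph_nat) /=; ring.
move: (m (ec_a2 E)) (m (ec_a4 E)) (m (ec_a6 E)) r r' => a2 a4 a6 r r'.
have e4 : a4 = - (3%:R * x ^+ 2 + 2%:R * a2 * x) by rewrite -[LHS]subr0 -r'; ring.
have e6 : a6 = - (x ^+ 3 + a2 * x ^+ 2 + a4 * x) by rewrite -[LHS]subr0 -r; ring.
rewrite /w_disc /w_b2 /w_b4 /w_b6 /w_b8 e6 e4; ring.
Qed.
End Separable.

Section Simple.
Variable K : closedFieldType.

Lemma uniq_simple_roots (f : {poly K}) c rs : c != 0 -> f = c *: \prod_(x <- rs) ('X - x%:P) ->
  (forall x, f.[x] = 0 -> f^`().[x] != 0) -> uniq rs.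
Proof.
move=> c0 ef sf; rewrite -separable_prod_XsubC.
have -> : separable_poly (\prod_(x <- rs) ('X - x%:P)) = separable_poly f.
  by apply: eqp_separable; rewrite ef eqp_sym eqp_scale.
rewrite separable_poly.unlock /coprimep; apply/negPn/negP => /closed_rootP [x].
rewrite root_gcd => /andP[/rootP r1 /rootP r2].
by move: (sf x r1); rewrite r2 eqxx.
Qed.

Lemma split_simple (f : {poly K}) : f \is monic ->
  (forall x, f.[x] = 0 -> f^`().[x] != 0) ->
  exists rs, uniq rs /\ f = \prod_(x <- rs) ('X - x%:P).
Proof.
move=> mf sf; have [rs ers] := closed_field_poly_normal f.
rewrite (monicP mf) scale1r in ers; exists rs; split=> //.
by apply: (@uniq_simple_roots f 1); rewrite ?oner_neq0 ?scale1r.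
Qed.
End Simple.

Section Degrees.
Variables (k : fieldType) (E1 E2 : ellcurve k) (fx fy : ratfun k).
Hypothesis iso : is_isogeny E1 E2 fx fy.
Variables (K : closedFieldType) (m : {rmorphism k -> K}).
Local Notation N := (fnum fx).
Local Notation D := (fden fx).
Local Notation A := (fnum fy).
Local Notation B := (fden fy).
Local Notation n := (size N).-1.
Local Notation f1 := (cubic_poly E1).
Local Notation f2 := (cubic_poly E2).
Local Notation mp := (map_poly m).

Lemma monic_cubK (E : ellcurve k) : cubK E m \is monic.
Proof.
rewrite monicE /lead_coef size_cubK cubKE !coefD !coefCM !coefC !coefXn !coefX /=.
by rewrite !mulr0 !addr0.
Qed.

Lemma homcub_split rs : cubK E2 m = \prod_(b <- rs) ('X - b%:P) -> size rs = 3 ->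
  mp (homcub E2 fx) = \prod_(b <- rs) (mp N - b *: mp D).
Proof.
case: rs => [|b1 [|b2 [|b3 [|//]]]] //; rewrite !big_cons !big_nil !mulr1 => e _.
have c i : (cubK E2 m)`_i = (('X - b1%:P) * (('X - b2%:P) * ('X - b3%:P)))`_i by rewrite e.
have ex : ('X - b1%:P) * (('X - b2%:P) * ('X - b3%:P)) =
  'X^3 + (- (b1 + b2 + b3))%:P * 'X^2 + (b1 * b2 + b1 * b3 + b2 * b3)%:P * 'X + (- (b1 * b2 * b3))%:P.
  by rewrite !(polyCD, polyCN, polyCM); ring.
rewrite ex cubKE in c.
have coefs a b d : ('X^3 + a%:P * 'X^2 + b%:P * 'X + d%:P : {poly K})`_0 = d /\
  ('X^3 + a%:P * 'X^2 + b%:P * 'X + d%:P : {poly K})`_1 = b /\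
  ('X^3 + a%:P * 'X^2 + b%:P * 'X + d%:P : {poly K})`_2 = a.
  by rewrite !coefD !coefCM !coefC !coefXn !coefX /= !(mulr0, mulr1, add0r, addr0).
have e6 : m (ec_a6 E2) = - (b1 * b2 * b3).
  by have := c 0%N; rewrite (coefs _ _ _).1 (coefs _ _ _).1.
have e4 : m (ec_a4 E2) = b1 * b2 + b1 * b3 + b2 * b3.
  by have := c 1%N; rewrite (coefs _ _ _).2.1 (coefs _ _ _).2.1.
have e2 : m (ec_a2 E2) = - (b1 + b2 + b3).
  by have := c 2%N; rewrite (coefs _ _ _).2.2 (coefs _ _ _).2.2.
rewrite /homcub !rmorphD !(rmorphM _ _%:P) /= !(rmorphM _ _ (_ ^+ _)) !(rmorphM _ (_ ^+ _)) !rmorphXn /= !map_polyC /= e2 e4 e6.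
by rewrite -!mul_polyC !(polyCD, polyCN, polyCM); ring.
Qed.

Lemma size_N : size N = n.+1.
Proof. by rewrite prednK // (leq_ltn_trans _ (sfx iso)). Qed.

Lemma size_lin b : size (mp N - b *: mp D) = n.+1.
Proof.
rewrite -size_N size_polyDl ?size_map_poly // size_polyN.
apply: leq_ltn_trans (size_scale_leq _ _) _; rewrite size_map_poly; exact: sfx iso.
Qed.

Lemma coprime_lin b b' : b != b' -> coprimep (mp N - b *: mp D) (mp N - b' *: mp D).
Proof.
move=> bb; have cND : coprimep (mp N) (mp D) by rewrite coprimep_map coprimep_fnum_fden.
have d0 : b - b' != 0 by rewrite subr_eq0.
have cD : coprimep (mp N - b *: mp D) (mp D).
  have -> : mp N - b *: mp D = (- b%:P) * mp D + mp N by rewrite -mul_polyC; ring.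
  rewrite coprimep_sym /coprimep (eqp_size (gcdp_addl_mul _ _ _)) -/(coprimep _ _).
  by rewrite coprimep_sym.
have -> : mp N - b' *: mp D = 1 * (mp N - b *: mp D) + (b - b') *: mp D.
  by rewrite scalerBl mul1r; ring.
rewrite /coprimep (eqp_size (gcdp_addl_mul _ _ _)) -/(coprimep _ _).
by rewrite coprimepZr.
Qed.

(** Over K, homcub is a product of three coprime factors of odd degree n, one for
    each zero of the cubic of E2; none of them being a square up to a constant,
    each has a zero in common with g. *)
Lemma cofactor_odd g : ~~ odd (size N) -> homcub E2 fx = A ^+ 2 * g -> (3 < size g)%N.
Proof.
move=> on eg.
have [rs [urs ers]] := split_simple (monic_cubK E2) (@cubK_separable _ E2 _ m).
have srs : size rs = 3 by have := size_cubK E2 m; rewrite ers size_prod_XsubC => -[].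
have es := homcub_split ers srs.
have M0 : homcub E2 fx != 0.
  by rewrite -size_poly_eq0 (size_homcub iso).
have A0 : A != 0 by apply: contraNneq M0 => z; rewrite eg z expr0n mul0r.
have g0 : g != 0 by apply: contraNneq M0 => z; rewrite eg z mulr0.
have e : \prod_(b <- rs) (mp N - b *: mp D) = mp A ^+ 2 * mp g.
  by rewrite -es eg rmorphM rmorphXn.
pose P b := mp N - b *: mp D.
have rt b : b \in rs -> exists a, root (P b) a && root (mp g) a.
  move=> br; have P0 : P b != 0 by rewrite -size_poly_eq0 size_lin.
  have : ~~ coprimep (P b) (mp g).
    apply: contra on => c.
    rewrite -(_ : size (P b) = size N); last by rewrite size_lin -size_N.
    apply: (@odd_size_square_factor _ _ (\prod_(b' <- rem b rs) P b') (mp A) (mp g)) => //.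
    - by rewrite map_poly_eq0.
    - by rewrite map_poly_eq0.
    - by rewrite -e (perm_big _ (perm_to_rem br)) big_cons.
    - rewrite big_seq; elim/big_ind: _ => [|x y cx cy|b'].
      + exact: coprimep1.
      + by rewrite coprimepMr cx.
      + rewrite (mem_rem_uniq _ urs) inE => /andP[bb _].
        by apply: coprime_lin; rewrite eq_sym.
  rewrite /coprimep => /closed_rootP [a]; rewrite root_gcd => h; by exists a.
have [s [us ss]] : exists s : seq K, [/\ uniq s, size s = 3 & all (root (mp g)) s].
  case: rs srs urs rt {ers es e} => [|b1 [|b2 [|b3 [|//]]]] // _ /= /and3P[n1 n2 _] rt.
  rewrite !inE in n1 n2.
  have [|a1 /andP[r1 g1]] := rt b1; first by rewrite !inE eqxx.
  have [|a2 /andP[r2 g2]] := rt b2; first by rewrite !inE eqxx orbT.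
  have [|a3 /andP[r3 g3]] := rt b3; first by rewrite !inE eqxx !orbT.
  move: n1; rewrite negb_or => /andP[n12 n13].
  have dis b b' a a' : b != b' -> root (P b) a -> root (P b') a' -> a != a'.
    move=> bb ra; apply: contraTneq => <-.
    by apply/negP => ra'; have := coprimep_root (coprime_lin bb) ra; rewrite (rootP ra') eqxx.
  exists [:: a1; a2; a3]; split; rewrite //= ?g1 ?g2 ?g3 // !inE negb_or.
  by rewrite (dis _ _ _ _ n12 r1 r2) (dis _ _ _ _ n13 r1 r3) (dis _ _ _ _ n2 r2 r3).
move=> gs; have := max_poly_roots _ gs us.
by rewrite map_poly_eq0 g0 ss size_map_poly => /(_ isT).
Qed.

(** Write homcub = A^2 g and e g = f1 with f1 the cubic of E1.  When n is odd,
    cofactor_odd gives deg g = 3.  When n is even, deg g is even, and it is not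
    0: otherwise e would be f1 up to a constant in B^2 = D^3 e, and the zeros of
    f1, being simple, would be zeros of D, so all of E1[2] would be in the
    kernel. *)
Lemma isog_sizes :
  [/\ (size B <= size A)%N, A != 0,
      ~~ odd (size N) -> (2 * (size A).-1 = 3 * n - 3)%N &
      odd (size N) -> ~ two_torsion_in_kernel E1 fx m -> (2 * (size A).-1 = 3 * n - 2)%N].
Proof.
have [g [e [eM eB eg]]] := isog_factor iso.
have sM := size_homcub iso.
have f10 : f1 != 0 by rewrite -size_poly_eq0 size_cubic_poly.
have e0 : e != 0 by apply: contraNneq f10 => z; rewrite -eg z mul0r.
have g0 : g != 0 by apply: contraNneq f10 => z; rewrite -eg z mulr0.
have M0 : homcub E2 fx != 0 by rewrite -size_poly_eq0 sM.
have A0 : A != 0 by apply: contraNneq M0 => z; rewrite eM z expr0n mul0r.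
have B0 := fden_neq0 fy; have D0 := fden_neq0 fx.
have sg : (size e + size g = 5)%N.
  have := size_cubic_poly E1; rewrite -eg size_mul //.
  by move: e0 g0; rewrite -!size_poly_gt0; move: (size e) (size g) => x y; lia.
have sA : ((size A).-1 * 2 + size g = (3 * n).+1)%N.
  rewrite -sM eM size_mul ?expf_neq0 // -(size_exp A 2).
  by rewrite -[in RHS](prednK (_ : 0 < size (A ^+ 2))%N) ?size_poly_gt0 ?expf_neq0.
have sB : ((size B).-1 * 2 + 1 = (size D).-1 * 3 + size e)%N.
  rewrite -(size_exp B 2) -(size_exp D 3) eB size_mul ?expf_neq0 //.
  have : (0 < size (D ^+ 3))%N by rewrite size_poly_gt0 expf_neq0.
  by move: e0; rewrite -size_poly_gt0; move: (size (D ^+ 3)) (size e) => x y; lia.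
have sDN := sfx iso.
have gB : (0 < size B)%N by rewrite size_poly_gt0.
have gA : (0 < size A)%N by rewrite size_poly_gt0.
have gD : (0 < size D)%N by rewrite size_poly_gt0.
have gg : (0 < size g)%N by rewrite size_poly_gt0.
have ge : (0 < size e)%N by rewrite size_poly_gt0.
split=> //.
- by move: sg sA sB sDN gB gA gD gg ge; move: (size g) (size e) (size A) (size B) (size D) (size N) => *; lia.
- move=> on; have g3 := cofactor_odd on eM.
  move: sg sA ge g3; move: (size g) (size e) (size A) => *; lia.
move=> on nt; suff : size e != 4.
  have := odd_double_half (size N); rewrite on.
  move: sg sA ge gg gA sDN; move: (size g) (size e) (size A) (size N) (half (size N)) (size D) => *; lia.
apply/negP => s4; apply: nt => x rx.
have sg1 : size g = 1 by move: sg; rewrite (eqP s4) => -[].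
have [c c0 ec] : exists2 c, c != 0 & g = c%:P by apply/size_poly1P/eqP.
have r1 : root (mp f1) x by rewrite rootE -[map_poly m f1]/(cubK E1 m) horner_cubK rx.
have er : root (mp e) x.
  move: r1; rewrite -eg ec mulrC mul_polyC map_polyZ /= rootZ //.
  by rewrite fmorph_eq0.
have eB' : mp B ^+ 2 = mp D ^+ 3 * mp e by rewrite -rmorphXn eB rmorphM rmorphXn.
have rB : root (mp B) x.
  have : root (mp B ^+ 2) x by rewrite eB' rootM er orbT.
  by rewrite expr2 rootM orbb.
apply/negPn/negP => nD.
have t0 : 'X - x%:P != 0 by rewrite polyXsubC_eq0.
have [B' eB1] := factor_theorem _ _ rB.
have /dvdpP[q eq] : ('X - x%:P) ^+ 2 %| mp e.
  rewrite -(@Gauss_dvdpr _ _ (mp D ^+ 3)); last first.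
    by rewrite coprimep_expl // coprimep_expr // coprimep_sym coprimep_XsubC.
  by rewrite -eB' eB1; apply/dvdpP; exists (B' ^+ 2); ring.
have := @cubK_separable _ E1 _ m x (rootP r1).
rewrite /cubK -eg rmorphM /= eq -mulrA [_ * mp g]mulrC mulrA mulrC.
by rewrite deriv_double eqxx.
Qed.
End Degrees.

(** * The points above the roots of p^+ and p^- *)

Lemma fnum_frac (F : fieldType) (p q : {poly F}) : q != 0 -> coprimep p q ->
  fnum (p%:F / q%:F : ratfun F) %= p.
Proof.
move=> q0 cpq; set f : ratfun F := p%:F / q%:F.
have qF : q%:F != 0 :> ratfun F by rewrite tofrac_eq0.
have dF : (fden f)%:F != 0 :> ratfun F by rewrite tofrac_eq0 fden_neq0.
have e : p * fden f = fnum f * q.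
  have /eqP := fnum_fdenE f; rewrite {1}/f eqr_div // => /eqP h.
  apply/eqP; rewrite -tofrac_eq; apply/eqP.
  exact: etrans (tofracM p (fden f)) (etrans h (esym (tofracM (fnum f) q))).
rewrite /eqp; apply/andP; split.
- by rewrite -(Gauss_dvdpl _ (coprimep_fnum_fden f)) e dvdp_mulr.
- by rewrite -(Gauss_dvdpl _ cpq) -e dvdp_mulr.
Qed.

Definition iotaC (k K : fieldType) (iota : {rmorphism ratfun k -> K}) (c : k) : K := iota (ratC c).
HB.instance Definition _ (k K : fieldType) (iota : {rmorphism ratfun k -> K}) :=
  GRing.RMorphism.copy (iotaC iota) (iota \o @ratC k).

Section Transcendence.
Variables (k K : fieldType) (iota : {rmorphism ratfun k -> K}).
Local Notation m := (iotaC iota).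
Local Notation mp := (map_poly m).
Local Notation u0 := (iota ratX).

Lemma ratC_poly (h : {poly k}) : (map_poly (@ratC k) h).[ratX] = h%:F.
Proof.
elim/poly_ind: h => [|h c IH]; first by rewrite rmorph0 horner0 tofrac0.
by rewrite rmorphD rmorphM /= map_polyX map_polyC hornerMXaddC IH tofracD tofracM.
Qed.

Lemma iota_poly (h : {poly k}) : iota h%:F = (mp h).[u0].
Proof.
rewrite -ratC_poly -horner_map -map_poly_comp.
by congr (_.[_]); apply: eq_map_poly.
Qed.

Lemma transc_u (h : {poly k}) : (mp h).[u0] = 0 -> h = 0.
Proof.
rewrite -iota_poly => /eqP; rewrite fmorph_eq0 tofrac_eq0 => /eqP //.
Qed.

Definition eps (s : bool) : K := (-1) ^+ s * u0 ^+ 3.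

Lemma eps2 s : eps s ^+ 2 = u0 ^+ 6.
Proof. by rewrite /eps exprMn -!exprM mulnC exprM sqrrN expr1n expr1n mul1r. Qed.

Lemma transc_eps s (h : {poly k}) : (mp h).[eps s] = 0 -> h = 0.
Proof.
move=> e; have q0 : (((-1) ^+ s)%:P : {poly k}) != 0 by rewrite polyC_eq0 signr_eq0.
have : (mp (h \Po (((-1) ^+ s)%:P * 'X^3))).[u0] = 0.
  rewrite map_comp_poly horner_comp rmorphM /= map_polyC map_polyXn /=.
  by rewrite hornerCM hornerXn (rmorphXn m) (rmorphN m) (rmorph1 m).
move/transc_u => /eqP; rewrite comp_poly_eq0 => [/eqP //|].
by rewrite mul_polyC size_scale ?signr_eq0 // size_polyXn.
Qed.

Lemma not_algebraic_eps s : ~ algebraicOver m (eps s).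
Proof. by case=> h h0 /rootP /transc_eps h1; rewrite h1 eqxx in h0. Qed.

Lemma algebraic_horner (h : {poly k}) x : algebraicOver m x -> algebraicOver m (mp h).[x].
Proof.
move=> hx; elim/poly_ind: h => [|h c IH]; first by rewrite rmorph0 horner0; apply: algebraic0.
rewrite rmorphD rmorphM /= map_polyX map_polyC hornerMXaddC.
by apply: algebraic_add; [apply: algebraic_mul | apply: algebraic_id].
Qed.

(** A solution of A(x) = eps B(x), with A and B prime to each other, is
    transcendental over k, because eps is. *)
Lemma transc_root (A B : {poly k}) s x : coprimep A B ->
  (mp A).[x] = eps s * (mp B).[x] ->
  (mp B).[x] != 0 /\ forall h : {poly k}, (mp h).[x] = 0 -> h = 0.
Proof.
move=> cAB e; have cm : coprimep (mp A) (mp B) by rewrite coprimep_map.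
have B0 : (mp B).[x] != 0.
  apply/eqP => z; move: e; rewrite z mulr0 => /rootP rA.
  by have := coprimep_root cm rA; rewrite z eqxx.
split=> // h hx; apply/eqP; apply/negPn/negP => h0.
have alg : algebraicOver m x by exists h => //; apply/rootP.
apply: (@not_algebraic_eps s).
have -> : eps s = (mp A).[x] / (mp B).[x] by rewrite e mulfK.
by apply: algebraic_div; apply: algebraic_horner.
Qed.

Hypothesis char0 : forall n, n.+1%:R != 0 :> k.

Lemma deriv_eq0 (h : {poly k}) : h^`() = 0 -> (size h <= 1)%N.
Proof.
move=> e; rewrite leqNgt; apply/negP => s1.
have := congr1 (fun p : {poly k} => p`_(size h).-2) e; rewrite coef_deriv coef0.
have -> : ((size h).-2).+1 = (size h).-1 by case: (size h) s1 => [|[]].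
rewrite -lead_coefE -mulr_natr => /eqP; rewrite mulf_eq0 lead_coef_eq0.
have -> : (size h).-1 = ((size h).-2).+1 by case: (size h) s1 => [|[]].
by rewrite (negPf (char0 _)) orbF -size_poly_eq0 -leqn0 leqNgt (ltn_trans _ s1).
Qed.

(** A double root would be a zero of A' B - A B', which is not 0 because A is prime
    to B and not constant; but the root is transcendental. *)
Lemma simple_root (A B : {poly k}) s x : coprimep A B -> (1 < size A)%N ->
  (mp A).[x] = eps s * (mp B).[x] -> (mp A - eps s *: mp B)^`().[x] != 0.
Proof.
move=> cAB sA e; have [B0 tr] := transc_root cAB e.
apply/eqP; rewrite derivB derivZ !hornerE !deriv_map => e'.
have : (mp (A^`() * B - A * B^`())).[x] = 0.
  rewrite rmorphB !rmorphM /= !hornerE e.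
  have -> : (mp A^`()).[x] = eps s * (mp B^`()).[x] by apply/eqP; rewrite -subr_eq0 e'.
  by ring.
move/tr => /eqP; rewrite subr_eq0 => /eqP eW.
have : A %| A^`() by rewrite -(Gauss_dvdpl _ cAB) eW dvdp_mulr.
have [d0|d0] := eqVneq A^`() 0; first by have := deriv_eq0 d0; rewrite leqNgt sA.
move/(dvdp_leq d0); rewrite leqNgt lt_size_deriv //.
by rewrite -size_poly_gt0 (ltn_trans _ sA).
Qed.
End Transcendence.

(** N has larger degree than D, so 3 N^2 is the only term of top degree. *)
Lemma deriv_form_neq0 (k : fieldType) (char0 : forall n, n.+1%:R != 0 :> k) (a2 a4 : k)
  (N D : {poly k}) : (size D < size N)%N -> D != 0 ->
  3%:R%:P * N ^+ 2 + (2%:R * a2)%:P * (N * D) + a4%:P * D ^+ 2 != 0.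
Proof.
move=> sDN D0; have N0 : N != 0 by rewrite -size_poly_gt0 (leq_ltn_trans _ sDN).
have gD : (0 < size D)%N by rewrite size_poly_gt0.
apply/eqP => e.
have eN : 3%:R *: N ^+ 2 = D * - ((2%:R * a2)%:P * N + a4%:P * D).
  by rewrite -mul_polyC -[LHS]subr0 -e; ring.
have := congr1 (fun p : {poly k} => size p) eN.
rewrite /= size_scale ?char0 // expr2 size_mul // => es.
have : (size (D * - ((2%:R * a2)%:P * N + a4%:P * D))%R <= (size D + size N).-1)%N.
  apply: leq_trans (size_polyMleq _ _) _; rewrite size_polyN.
  rewrite -!subn1 leq_sub2r // leq_add2l; apply: leq_trans (size_polyD _ _) _.
  rewrite geq_max mul_polyC mul_polyC; apply/andP; split.
    exact: size_scale_leq.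
  by apply: leq_trans (size_scale_leq _ _) (ltnW sDN).
by rewrite -es; move: sDN gD; move: (size N) (size D) => a b; lia.
Qed.

Lemma form_eval (R S : comNzRingType) (f : {rmorphism R -> S}) (N D : {poly R}) c3 c2 c1 x :
  (map_poly f (c3%:P * N ^+ 2 + c2%:P * (N * D) + c1%:P * D ^+ 2)).[x] =
  f c3 * (map_poly f N).[x] ^+ 2 + f c2 * ((map_poly f N).[x] * (map_poly f D).[x])
  + f c1 * (map_poly f D).[x] ^+ 2.
Proof.
rewrite !(rmorphD (map_poly f)) (rmorphM _ c3%:P) (rmorphM _ c2%:P) (rmorphM _ c1%:P) /=.
by rewrite !map_polyC !(rmorphXn (map_poly f)) (rmorphM (map_poly f) N) /= !hornerD !hornerCM !hornerM.
Qed.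

Section PpmRoots.
Variables (k : fieldType) (E1 E2 : ellcurve k) (fx fy : ratfun k).
Variables (K : closedFieldType) (iota : {rmorphism ratfun k -> K}).
Hypothesis char0 : forall n, n.+1%:R != 0 :> k.
Hypothesis iso : is_isogeny E1 E2 fx fy.
Local Notation m := (iotaC iota).
Local Notation mp := (map_poly m).
Local Notation u0 := (iota ratX).
Local Notation N := (fnum fx).
Local Notation D := (fden fx).
Local Notation A := (fnum fy).
Local Notation B := (fden fy).
Local Notation ku := (ratfun k).
Local Notation up := (map_poly (@ratC k)).
Hypothesis sBA : (size B <= size A)%N.
Hypothesis sA : (1 < size A)%N.
Variable s : bool.

Definition epsu : ku := (-1) ^+ s * ratX ^+ 3.

Lemma iota_epsu : iota epsu = eps iota s.
Proof. by rewrite /epsu /eps rmorphM !rmorphXn rmorphN rmorph1. Qed.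

Lemma mp_up (h : {poly k}) : map_poly iota (up h) = mp h.
Proof. by rewrite -map_poly_comp; apply: eq_map_poly. Qed.

Lemma ppm_eqp : ppm fy s %= up A - epsu *: up B.
Proof.
rewrite /ppm /ratfun_map.
have B0 : up B != 0 by rewrite map_poly_eq0 fden_neq0.
have cAB : coprimep (up A) (up B) by rewrite coprimep_map coprimep_fnum_fden.
have bF : (up B)%:F != 0 :> ratfun ku by rewrite tofrac_eq0.
have -> : (up A)%:F / (up B)%:F - ratC ((-1) ^+ s * ratX ^+ 3) =
   (up A - epsu *: up B)%:F / (up B)%:F :> ratfun ku.
  by rewrite tofracB -mul_polyC (tofracM _ (up B)) mulrBl mulfK.
apply: fnum_frac => //.
have -> : up A - epsu *: up B = (- epsu%:P) * up B + up A by rewrite -mul_polyC; ring.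
by rewrite coprimep_sym /coprimep (eqp_size (gcdp_addl_mul _ _ _)) -/(coprimep _ _) coprimep_sym.
Qed.

(** If A and B have the same degree, their leading coefficients cannot cancel in
    A - eps B, as eps is not in k. *)
Lemma size_ppm : size (ppm fy s) = size A.
Proof.
rewrite (eqp_size ppm_eqp).
have [lt|ge] := ltnP (size B) (size A).
  rewrite size_polyDl ?size_map_poly // size_polyN.
  by apply: leq_ltn_trans (size_scale_leq _ _) _; rewrite size_map_poly.
have es : size B = size A by apply/eqP; rewrite eqn_leq sBA.
apply/eqP; rewrite eqn_leq; apply/andP; split.
  apply: leq_trans (size_polyD _ _) _; rewrite geq_max size_map_poly leqnn size_polyN.
  by apply: leq_trans (size_scale_leq _ _) _; rewrite size_map_poly es.
have sp : (0 < size A)%N by apply: ltnW.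
rewrite -[X in (X <= _)%N](prednK sp) ltnNge; apply/negP => /leq_sizeP /(_ _ (leqnn _)).
rewrite coefB coefZ !coef_map /= => /eqP; rewrite subr_eq0 => /eqP /(congr1 iota).
rewrite rmorphM iota_epsu -!/(m _).
set a := A`__; set b := B`__ => e.
have a0 : a != 0 by rewrite /a -lead_coefE lead_coef_eq0 -size_poly_gt0.
have b0 : b != 0.
  apply: contraNneq a0 => z; move/eqP: e; rewrite z rmorph0 mulr0.
  by rewrite fmorph_eq0.
apply: (@not_algebraic_eps _ _ iota s).
have -> : eps iota s = m (a / b) by rewrite fmorph_div /= e mulfK // fmorph_eq0.
exact: algebraic_id.
Qed.

Lemma iota_ppm : exists2 c, c != 0 & map_poly iota (ppm fy s) = c *: (mp A - eps iota s *: mp B).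
Proof.
have [c c0 ->] := eqpf_eq _ _ ppm_eqp; exists (iota c); first by rewrite fmorph_eq0.
by rewrite map_polyZ rmorphB /= map_polyZ !mp_up iota_epsu.
Qed.

Lemma ppm_rootE x : (x \in ppm_roots fy iota s) = ((mp A).[x] == eps iota s * (mp B).[x]).
Proof.
rewrite /ppm_roots; case: closed_field_poly_normal => rs /= ers.
have p0 : map_poly iota (ppm fy s) != 0 by rewrite map_poly_eq0 -size_poly_gt0 size_ppm ltnW.
have : root (map_poly iota (ppm fy s)) x = (x \in rs).
  by rewrite ers rootZ ?lead_coef_eq0 // root_prod_XsubC.
move=> <-; have [c c0 ->] := iota_ppm; rewrite rootZ // rootE !hornerE.
by rewrite subr_eq0.
Qed.

Lemma ppm_split : exists2 c, c != 0 &
  map_poly iota (ppm fy s) = c *: \prod_(x <- ppm_roots fy iota s) ('X - x%:P).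
Proof.
rewrite /ppm_roots; case: closed_field_poly_normal => rs /= ers.
have p0 : map_poly iota (ppm fy s) != 0 by rewrite map_poly_eq0 -size_poly_gt0 size_ppm ltnW.
by exists (lead_coef (map_poly iota (ppm fy s))); rewrite ?lead_coef_eq0.
Qed.

Lemma size_ppm_roots : size (ppm_roots fy iota s) = (size A).-1.
Proof.
have [c c0 e] := ppm_split; have := congr1 (fun p : {poly K} => size p) e.
by rewrite /= size_scale // size_prod_XsubC size_map_poly size_ppm => ->.
Qed.

Lemma uniq_ppm_roots : uniq (ppm_roots fy iota s).
Proof.
have [c c0 e] := ppm_split; apply: (uniq_simple_roots c0 e) => x.
have [c' c'0 ->] := iota_ppm; rewrite derivZ !hornerZ => /eqP.
rewrite mulf_eq0 (negPf c'0) /= !hornerE subr_eq0 => /eqP ex.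
rewrite mulf_neq0 //; apply: (simple_root char0 _ sA ex); exact: coprimep_fnum_fden.
Qed.

(** A vertical tangent at Q_i would give an algebraic equation for x1 over k,
    nontrivial by deriv_form_neq0. *)
Lemma ppm_root_point x : x \in ppm_roots fy iota s ->
  let y := ratfun_eval m fx x in
  [/\ (mp D).[x] != 0, (mp B).[x] != 0, forall h : {poly k}, (mp h).[x] = 0 -> h = 0,
      (cubK E2 m).[y] = u0 ^+ 6 * (cubK E1 m).[x] & (cubK E2 m)^`().[y] != 0].
Proof.
rewrite ppm_rootE => /eqP ex y.
have [B0 tr] := transc_root (coprimep_fnum_fden fy) ex.
have D0 : (mp D).[x] != 0.
  by apply: contraTneq (fden_neq0 fx) => /tr ->; rewrite eqxx.
have yD : y * (mp D).[x] = (mp N).[x] by rewrite /y /ratfun_eval divfK.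
split=> //.
- have := congr1 (fun p : {poly k} => (mp p).[x]) (isog_poly_eq iso).
  rewrite /homcub !(rmorph_lhs (mp)) !rmorph_rhs /= !map_polyC !hornerE -yD ex /= => e.
  apply: (mulfI (expf_neq0 2 B0)); apply: (mulfI (expf_neq0 3 D0)).
  apply: etrans (etrans _ e) _.
    by rewrite cubKE !hornerE /=; ring.
  by rewrite /cubK -(eps2 iota s); ring.
- apply/eqP; rewrite cubK_deriv => e.
  have : (mp (3%:R%:P * N ^+ 2 + (2%:R * ec_a2 E2)%:P * (N * D) + (ec_a4 E2)%:P * D ^+ 2)).[x] = 0.
    rewrite form_eval -yD -[RHS](mulr0 ((mp D).[x] ^+ 2)) -e rmorphM !(rmorph_nat m); ring.
  move/tr => h0; have := deriv_form_neq0 char0 (ec_a2 E2) (ec_a4 E2) (sfx iso) (fden_neq0 fx).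
  by rewrite h0 eqxx.
Qed.
End PpmRoots.

(** * The curve C_u and its tangent at O *)

Lemma ec_cubic_morph (k : fieldType) (E : ellcurve k) (R S : comNzRingType)
    (f : {rmorphism R -> S}) (m : k -> R) (m' : k -> S) x z :
  (forall c, f (m c) = m' c) -> f (ec_cubic E m x z) = ec_cubic E m' (f x) (f z).
Proof.
move=> fm; rewrite /ec_cubic !rmorphD -!fm !rmorphM /= ?rmorphXn.
by rewrite !exprS !expr0 !mulr1.
Qed.

Section EvalCu.
Variables (k : fieldType) (E1 E2 : ellcurve k) (K : closedFieldType) (iota : {rmorphism ratfun k -> K}).
Local Notation m := (iotaC iota).
Local Notation u0 := (iota ratX).
Local Notation F := (CuK E1 E2 iota).
Local Notation mpC := (fun c : k => (m c)%:MP : {mpoly K[3]}).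

Lemma CuKE : F = ec_cubic E2 mpC 'X_1 'X_2%:R - (u0 ^+ 6)%:MP * ec_cubic E1 mpC 'X_0 'X_2%:R.
Proof.
have mX i : map_mpoly iota 'X_i = 'X_i :> {mpoly K[3]} by rewrite map_mpolyX.
have mC c : map_mpoly iota c%:MP = (iota c)%:MP :> {mpoly K[3]} by exact: map_mpolyC.
rewrite /CuK /Cu.
transitivity (map_mpoly iota (ec_cubic E2 (fun c => (ratC c)%:MP) 'X_1 'X_2%:R : {mpoly (ratfun k)[3]})
  - map_mpoly iota (ratX ^+ 6)%:MP * map_mpoly iota (ec_cubic E1 (fun c => (ratC c)%:MP) 'X_0 'X_2%:R : {mpoly (ratfun k)[3]})).
  exact: etrans (rmorphB (map_mpoly iota) _ _) (congr1 _ (congr1 _ (rmorphM (map_mpoly iota) _ _))).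
rewrite mC rmorphXn.
have h (E : ellcurve k) x z : map_mpoly iota (ec_cubic E (fun c => (ratC c)%:MP) x z : {mpoly (ratfun k)[3]}) =
  ec_cubic E mpC (map_mpoly iota x) (map_mpoly iota z).
  by apply: (@ec_cubic_morph _ E _ _ (map_mpoly iota)) => c; exact: mC.
have h2 := h E2 'X_1 'X_2%:R; have h1 := h E1 'X_0 'X_2%:R; rewrite !mX in h1 h2.
exact: (f_equal2 (fun a b => a - (u0 ^+ 6)%:MP * b) h2 h1).
Qed.

Lemma ec_cubic_homog (E : ellcurve k) (x z : {mpoly K[3]}) :
  x \is 1.-homog -> z \is 1.-homog -> ec_cubic E mpC x z \is 3.-homog.
Proof.
move=> hx hz; rewrite /ec_cubic.
have h n (G : {mpoly K[3]}) : G \is 1.-homog -> G ^+ n \is n.-homog.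
  by move=> hG; rewrite -[X in X.-homog]mul1n; apply: dhomogMn.
have hc c d (G : {mpoly K[3]}) : G \is d.-homog -> (m c)%:MP * G \is d.-homog.
  by move=> hG; rewrite mul_mpolyC; apply: dhomogZ.
have hM d e (G H : {mpoly K[3]}) : G \is d.-homog -> H \is e.-homog -> G * H \is (d + e).-homog.
  exact: dhomogM.
have t1 := hM _ _ _ _ (hc (ec_a2 E) _ _ (h 2 _ hx)) hz.
have t2 := hM _ _ _ _ (hc (ec_a4 E) _ _ hx) (h 2 _ hz).
exact: dhomogD (dhomogD (dhomogD (h 3 _ hx) t1) t2) (hc _ _ _ (h 3 _ hz)).
Qed.

Lemma homogX i : ('X_i : {mpoly K[3]}) \is 1.-homog.
Proof. by rewrite dhomogX /= mdeg1. Qed.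

Lemma CuK_homog : F \is 3.-homog.
Proof.
rewrite CuKE; apply: dhomogD; first by apply: ec_cubic_homog; apply: homogX.
rewrite -mulNr -mpolyCN mul_mpolyC; apply: dhomogZ; apply: ec_cubic_homog; apply: homogX.
Qed.

Lemma evalp_CuK P : evalp F P =
  ec_cubic E2 m (P 0 1) (P 0 2%:R) - u0 ^+ 6 * ec_cubic E1 m (P 0 0) (P 0 2%:R).
Proof.
rewrite CuKE evalpD evalpN evalpM evalpC.
have h (E : ellcurve k) x z : evalp (ec_cubic E mpC x z) P = ec_cubic E m (evalp x P) (evalp z P).
  by apply: (@ec_cubic_morph _ E _ _ (meval (fun i => P 0 i))) => c; exact: mevalC.
by rewrite (h E2) (h E1) !evalpX.
Qed.

Definition dv i (P : 'rV[K]_3) (G : {mpoly K[3]}) := evalp G^`M(i) P.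
Lemma dvD i P G H : dv i P (G + H) = dv i P G + dv i P H.
Proof. by rewrite /dv mderivD evalpD. Qed.
Lemma dvN i P G : dv i P (- G) = - dv i P G.
Proof. by rewrite /dv mderivN evalpN. Qed.
Lemma dvM i P G H : dv i P (G * H) = dv i P G * evalp H P + evalp G P * dv i P H.
Proof. by rewrite /dv mderivM evalpD !evalpM. Qed.
Lemma dvC i P c : dv i P c%:MP = 0.
Proof. by rewrite /dv mderivC evalp0. Qed.
Lemma dvX i P j : dv i P 'X_j = (i == j)%:R.
Proof.
rewrite /dv mderivX mnm1E; case: eqP => [->|ne]; last first.
  by rewrite scale0r evalp0; case: eqP => // e; case: ne.
have -> : (U_(i) - U_(i))%MM = 0%MM by apply/mnmP => l; rewrite mnmBE subnn mnm0E.
by rewrite scale1r mpolyX0 evalp1 eqxx.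
Qed.

Lemma evalp_tangent (P Q : 'rV[K]_3) : evalp (tangent_line F P) Q = \sum_i dv i P F * Q 0 i.
Proof.
rewrite /tangent_line /evalp /meval.
rewrite -[LHS]/(evalp _ Q).
have : forall (I : Type) (r : seq I) (f : I -> {mpoly K[3]}), evalp (\sum_(i <- r) f i) Q = \sum_(i <- r) evalp (f i) Q.
  move=> I r f; elim: r => [|i r IH]; first by rewrite !big_nil evalp0.
  by rewrite !big_cons evalpD IH.
move=> ->; apply: eq_bigr => i _.
by rewrite -mul_mpolyC evalpM evalpC evalpX.
Qed.

Lemma dv_ec i P (E : ellcurve k) x z : evalp z P = 0 ->
  dv i P (ec_cubic E mpC x z) = 3%:R * evalp x P ^+ 2 * dv i P x + m (ec_a2 E) * evalp x P ^+ 2 * dv i P z.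
Proof.
move=> z0; rewrite /ec_cubic !exprS !expr0 !mulr1 !(dvD, dvM, dvC) !(evalpM, evalpC) z0; ring.
Qed.

(** Only the terms of degree at most one in z contribute, since z = 0 at O. *)
Lemma tangent_at_O (Q : 'rV[K]_3) : evalp (tangent_line F (OptK iota)) Q =
  3%:R * u0 ^+ 4 * Q 0 1 - 3%:R * u0 ^+ 6 * Q 0 0
  + (m (ec_a2 E2) * u0 ^+ 4 - u0 ^+ 6 * m (ec_a2 E1)) * Q 0 2%:R.
Proof.
have O0 : OptK iota 0 0 = 1 by rewrite /OptK /Opt /pt !mxE /= rmorph1.
have O1 : OptK iota 0 1 = u0 ^+ 2 by rewrite /OptK /Opt /pt !mxE /= rmorphXn.
have O2 : OptK iota 0 2%:R = 0 by rewrite /OptK /Opt /pt !mxE /= rmorph0.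
have dF i : dv i (OptK iota) F = 3%:R * u0 ^+ 4 * (i == 1)%:R + m (ec_a2 E2) * u0 ^+ 4 * (i == 2%:R)%:R
   - u0 ^+ 6 * (3%:R * (i == 0)%:R + m (ec_a2 E1) * (i == 2%:R)%:R).
  rewrite CuKE dvD dvN dvM dvC mul0r add0r evalpC !dv_ec ?evalpX ?O2 // O0 O1 !dvX -exprM !expr1n !mulr1.
  by ring.
rewrite evalp_tangent !big_ord_recl big_ord0 !dF.
have -> : lift ord0 (lift ord0 ord0) = 2%:R :> 'I_3 by apply: val_inj.
have -> : lift ord0 ord0 = 1 :> 'I_3 by apply: val_inj.
have -> : ord0 = 0 :> 'I_3 by apply: val_inj.
rewrite !eqxx /=; ring.
Qed.
End EvalCu.

Lemma same_pointP (K : fieldType) (P Q : 'rV[K]_3) : P != 0 -> same_point P Q ->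
  exists2 c, c != 0 & P = c *: Q.
Proof.
move=> P0 /andP[/sub_rVP [c e] _]; exists c => //.
by apply: contraNneq P0 => c0; rewrite e c0 scale0r.
Qed.

Lemma same_pointZ (K : fieldType) (P Q : 'rV[K]_3) c : c != 0 -> P = c *: Q -> same_point P Q.
Proof. by move=> c0 ->; rewrite /same_point; apply/eqmxP; apply: eqmx_scale. Qed.

(** * The third point on the tangent at O *)

(** Coefficients of the depressed cubic: with X = x + a2 / 3,
    x^3 + a2 x^2 + a4 x + a6 = X^3 + dep4 X + dep6. *)
Definition dep4 (L : fieldType) (a2 a4 : L) := a4 - a2 ^+ 2 / 3%:R.
Definition dep6 (L : fieldType) (a2 a4 a6 : L) := a6 - a2 * a4 / 3%:R + 2%:R * a2 ^+ 3 / 27%:R.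

Section Depressed.
Variables (k : fieldType).
Hypothesis char0 : forall n, n.+1%:R != 0 :> k.
Variable (E : ellcurve k).
Local Notation b4 := (dep4 (ec_a2 E) (ec_a4 E)).
Local Notation b6 := (dep6 (ec_a2 E) (ec_a4 E) (ec_a6 E)).

Lemma dep_neq0 : b4 = 0 -> b6 = 0 -> False.
Proof.
move=> e4 e6; have := ec_disc E; move: e4 e6.
move: (ec_a2 E) (ec_a4 E) (ec_a6 E) => a2 a4 a6; rewrite /dep4 /dep6 => e4 e6 /eqP; apply.
have h3 := char0 2; have h27 := char0 26.
have f4 : a4 = a2 ^+ 2 / 3%:R by apply/eqP; rewrite -subr_eq0 e4.
have f6 : a6 = a2 * a4 / 3%:R - 2%:R * a2 ^+ 3 / 27%:R.
  by rewrite -[LHS]subr0 -e6; ring.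
rewrite /w_disc /w_b2 /w_b4 /w_b6 /w_b8 f6 f4; field.
by rewrite h3 h27.
Qed.

Lemma dep4_jinv : b4 = 0 -> jinv E = 0.
Proof.
rewrite /jinv /w_j /w_c4 /w_b2 /w_b4 /dep4 => e4.
have -> : (4%:R * ec_a2 E) ^+ 2 - 24%:R * (2%:R * ec_a4 E) = - 48%:R * (ec_a4 E - ec_a2 E ^+ 2 / 3%:R).
  by field; exact: char0 2.
by rewrite e4 mulr0 expr0n mul0r.
Qed.
End Depressed.

Section ObarAlg.
Variables (L : fieldType) (u a2 a4 a6 a2' a4' a6' : L).
Hypothesis (h3 : 3%:R != 0 :> L).
Local Notation b4 := (dep4 a2 a4).
Local Notation b6 := (dep6 a2 a4 a6).
Local Notation b4' := (dep4 a2' a4').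
Local Notation b6' := (dep6 a2' a4' a6').

(** The abscissa, in depressed coordinates, of the third point on the tangent
    X2 = u^2 X1: on this line the equation of C_u becomes linear in X1. *)
Definition obar_X := - (b6' - u ^+ 6 * b6) / (u ^+ 2 * (b4' - u ^+ 4 * b4)).
Definition obar_x := obar_X - a2 / 3%:R.
Definition obar_y := u ^+ 2 * obar_X - a2' / 3%:R.

Hypothesis u0 : u != 0.
Hypothesis d0 : b4' - u ^+ 4 * b4 != 0.

Let hd : u ^+ 2 * (b4' - u ^+ 4 * b4) != 0.
Proof. by rewrite mulf_neq0 ?expf_neq0. Qed.

Let X_eq : obar_X * (u ^+ 2 * (b4' - u ^+ 4 * b4)) = - (b6' - u ^+ 6 * b6).
Proof. by rewrite /obar_X divfK. Qed.

Lemma depressed (x c2 c4 c6 : L) : x ^+ 3 + c2 * x ^+ 2 + c4 * x + c6 =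
  (x + c2 / 3%:R) ^+ 3 + dep4 c2 c4 * (x + c2 / 3%:R) + dep6 c2 c4 c6.
Proof.
have h27 : 27%:R != 0 :> L by rewrite (natrM _ 3 9) (natrM _ 3 3) !mulf_neq0.
by rewrite /dep4 /dep6; field; rewrite h3 h27.
Qed.

Lemma obar_on : obar_y ^+ 3 + a2' * obar_y ^+ 2 + a4' * obar_y + a6' =
  u ^+ 6 * (obar_x ^+ 3 + a2 * obar_x ^+ 2 + a4 * obar_x + a6).
Proof.
rewrite !depressed /obar_x /obar_y !subrK; apply/eqP; rewrite -subr_eq0; apply/eqP.
have -> : (u ^+ 2 * obar_X) ^+ 3 + b4' * (u ^+ 2 * obar_X) + b6' - u ^+ 6 * (obar_X ^+ 3 + b4 * obar_X + b6)
  = obar_X * (u ^+ 2 * (b4' - u ^+ 4 * b4)) + (b6' - u ^+ 6 * b6) by ring.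
by rewrite X_eq; ring.
Qed.

Lemma obar_tangent : 3%:R * u ^+ 4 * obar_y - 3%:R * u ^+ 6 * obar_x + (a2' * u ^+ 4 - u ^+ 6 * a2) = 0.
Proof. by rewrite /obar_x /obar_y; field. Qed.

Lemma obar_Fy : (3%:R * obar_y ^+ 2 + 2%:R * a2' * obar_y + a4') * (b4' - u ^+ 4 * b4) ^+ 2 =
  3%:R * (b6' - u ^+ 6 * b6) ^+ 2 + b4' * (b4' - u ^+ 4 * b4) ^+ 2.
Proof.
have e : u ^+ 2 * obar_X * (b4' - u ^+ 4 * b4) = - (b6' - u ^+ 6 * b6) by rewrite -X_eq; ring.
have -> : 3%:R * obar_y ^+ 2 + 2%:R * a2' * obar_y + a4' = 3%:R * (u ^+ 2 * obar_X) ^+ 2 + b4'.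
  by rewrite /obar_y /dep4; field.
have -> : (3%:R * (u ^+ 2 * obar_X) ^+ 2 + b4') * (b4' - u ^+ 4 * b4) ^+ 2 =
  3%:R * (u ^+ 2 * obar_X * (b4' - u ^+ 4 * b4)) ^+ 2 + b4' * (b4' - u ^+ 4 * b4) ^+ 2 by ring.
by rewrite e; ring.
Qed.

Lemma obar_x_frac : obar_x * (u ^+ 2 * (b4' - u ^+ 4 * b4)) =
  - (b6' - u ^+ 6 * b6) - a2 / 3%:R * (u ^+ 2 * (b4' - u ^+ 4 * b4)).
Proof. by rewrite /obar_x mulrBl X_eq. Qed.
End ObarAlg.

Section Homogenization.
Variable R : comNzRingType.

(** The binary form of degree r with dehomogenization h, at the pair (P, Q). *)
Definition homev (r : nat) (h P Q : {poly R}) : {poly R} := \sum_(i < r.+1) h`_i *: (P ^+ i * Q ^+ (r - i)).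

Lemma horner_homev r (h P Q : {poly R}) s x : (size h <= r.+1)%N -> x * Q.[s] = P.[s] ->
  (homev r h P Q).[s] = Q.[s] ^+ r * h.[x].
Proof.
move=> sh ex; rewrite /homev horner_sum (horner_coef_wide _ sh) big_distrr.
apply: eq_bigr => i _ /=; rewrite hornerZ hornerM !horner_exp -ex exprMn.
have -> : Q.[s] ^+ r = Q.[s] ^+ i * Q.[s] ^+ (r - i) by rewrite -exprD subnKC // -ltnS ltn_ord.
by ring.
Qed.
End Homogenization.

Lemma map_homev (R S : comNzRingType) (f : {rmorphism R -> S}) r (h P Q : {poly R}) :
  map_poly f (homev r h P Q) = homev r (map_poly f h) (map_poly f P) (map_poly f Q).
Proof.
rewrite /homev rmorph_sum; apply: eq_bigr => i _.
by rewrite /= map_polyZ coef_map (rmorphM (map_poly f) (P ^+ i)) !(rmorphXn (map_poly f)).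
Qed.

Section ObarPoint.
Variables (k : fieldType) (E1 E2 : ellcurve k) (fy : ratfun k).
Variables (K : closedFieldType) (iota : {rmorphism ratfun k -> K}).
Hypothesis char0 : forall n, n.+1%:R != 0 :> k.
Hypothesis jj : jinv E1 != jinv E2.
Local Notation m := (iotaC iota).
Local Notation mp := (map_poly m).
Local Notation u0 := (iota ratX).
Local Notation F := (CuK E1 E2 iota).
Local Notation b4 := (dep4 (ec_a2 E1) (ec_a4 E1)).
Local Notation b6 := (dep6 (ec_a2 E1) (ec_a4 E1) (ec_a6 E1)).
Local Notation b4' := (dep4 (ec_a2 E2) (ec_a4 E2)).
Local Notation b6' := (dep6 (ec_a2 E2) (ec_a4 E2) (ec_a6 E2)).

Definition obarx_u : ratfun k := obar_x ratX (ratC (ec_a2 E1)) (ratC (ec_a4 E1)) (ratC (ec_a6 E1))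
  (ratC (ec_a2 E2)) (ratC (ec_a4 E2)) (ratC (ec_a6 E2)).
Definition obary_u : ratfun k := obar_y ratX (ratC (ec_a2 E1)) (ratC (ec_a4 E1)) (ratC (ec_a6 E1))
  (ratC (ec_a2 E2)) (ratC (ec_a4 E2)) (ratC (ec_a6 E2)).
Local Notation xO := (iota obarx_u).
Local Notation yO := (iota obary_u).

Lemma dep4_map (L : fieldType) (f : {rmorphism k -> L}) a c : f (dep4 a c) = dep4 (f a) (f c).
Proof. by rewrite /dep4 rmorphB fmorph_div (rmorphXn f) (rmorph_nat f). Qed.
Lemma dep6_map (L : fieldType) (f : {rmorphism k -> L}) a c d : f (dep6 a c d) = dep6 (f a) (f c) (f d).
Proof.
rewrite /dep6 rmorphD rmorphB !fmorph_div (rmorphM f a) (rmorphM f 2%:R) (rmorphXn f) !(rmorph_nat f) //.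
Qed.

Lemma u0_neq0 : u0 != 0.
Proof. by rewrite fmorph_eq0 tofrac_eq0 polyX_eq0. Qed.

Lemma char0K n : n.+1%:R != 0 :> K.
Proof. by rewrite -(rmorph_nat m) fmorph_eq0 char0. Qed.

Lemma obar_map (u a2 a4 a6 a2' a4' a6' : ratfun k) :
  iota (obar_x u a2 a4 a6 a2' a4' a6') =
    obar_x (iota u) (iota a2) (iota a4) (iota a6) (iota a2') (iota a4') (iota a6') /\
  iota (obar_y u a2 a4 a6 a2' a4' a6') =
    obar_y (iota u) (iota a2) (iota a4) (iota a6) (iota a2') (iota a4') (iota a6').
Proof.
have d4 a c : iota (dep4 a c) = dep4 (iota a) (iota c).
  by rewrite /dep4 rmorphB fmorph_div (rmorphXn iota) (rmorph_nat iota).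
have d6 a c d : iota (dep6 a c d) = dep6 (iota a) (iota c) (iota d).
  by rewrite /dep6 rmorphD rmorphB !fmorph_div (rmorphM iota a) (rmorphM iota 2%:R) (rmorphXn iota) !(rmorph_nat iota).
have X a b c d : iota (- (a - u ^+ 6 * b) / (u ^+ 2 * (c - u ^+ 4 * d))) =
    - (iota a - iota u ^+ 6 * iota b) / (iota u ^+ 2 * (iota c - iota u ^+ 4 * iota d)).
  rewrite fmorph_div rmorphN rmorphB (rmorphM iota _ b) (rmorphM iota _ (_ - _)).
  by rewrite (rmorphB iota c) (rmorphM iota _ d) !(rmorphXn iota).
split.
- by rewrite /obar_x /obar_X rmorphB X fmorph_div (rmorph_nat iota) !d4 !d6.
- by rewrite /obar_y /obar_X rmorphB (rmorphM iota _ (_ / _)) X fmorph_div (rmorph_nat iota) !d4 !d6 (rmorphXn iota).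
Qed.

Lemma xOE : xO = obar_x u0 (m (ec_a2 E1)) (m (ec_a4 E1)) (m (ec_a6 E1))
  (m (ec_a2 E2)) (m (ec_a4 E2)) (m (ec_a6 E2)).
Proof. exact: (obar_map _ _ _ _ _ _ _).1. Qed.
Lemma yOE : yO = obar_y u0 (m (ec_a2 E1)) (m (ec_a4 E1)) (m (ec_a6 E1))
  (m (ec_a2 E2)) (m (ec_a4 E2)) (m (ec_a6 E2)).
Proof. exact: (obar_map _ _ _ _ _ _ _).2. Qed.

(** Both j-invariants would be 0. *)
Lemma dep4_not_both_zero : b4 = 0 -> b4' = 0 -> False.
Proof. by move=> /(dep4_jinv char0) e /(dep4_jinv char0) e'; move: jj; rewrite e e' eqxx. Qed.

Let d4 := dep4_map m.

Lemma obar_den : m b4' - u0 ^+ 4 * m b4 != 0.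
Proof.
apply/eqP => e.
have : (mp (b4'%:P - b4%:P * 'X^4)).[u0] = 0.
  rewrite (rmorphB mp) (rmorphM mp) /= !map_polyC map_polyXn !hornerE /= -[RHS]e; ring.
move/transc_u => h; apply: dep4_not_both_zero.
- have := congr1 (fun p : {poly k} => p`_4) h.
  by rewrite /= coefB coefC coefCM coefXn coef0 /= mulr1 sub0r => /eqP; rewrite oppr_eq0 => /eqP.
- have := congr1 (fun p : {poly k} => p`_0) h.
  by rewrite /= coefB coefC coefCM coefXn coef0 /= mulr0 subr0.
Qed.

Lemma obar_den' : dep4 (m (ec_a2 E2)) (m (ec_a4 E2)) - u0 ^+ 4 * dep4 (m (ec_a2 E1)) (m (ec_a4 E1)) != 0.
Proof. by rewrite -!d4 obar_den. Qed.

(** The derivative at O-bar, up to denominators, is a polynomial in u whose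
    coefficients vanish only for singular cubics. *)
Lemma obar_Fy_neq0 : (cubK E2 m)^`().[yO] != 0.
Proof.
apply/eqP; rewrite cubK_deriv yOE => e.
have h3 := char0K 2.
have := @obar_Fy K u0 (m (ec_a2 E1)) (m (ec_a4 E1)) (m (ec_a6 E1)) (m (ec_a2 E2)) (m (ec_a4 E2)) (m (ec_a6 E2)) h3 u0_neq0 obar_den'.
rewrite e mul0r -!d4 -!(dep6_map m) => e'.
pose h := (3%:R * b6' ^+ 2 + b4' ^+ 3)%:P + (- (2%:R * b4' ^+ 2 * b4))%:P * 'X^4
  + (- (6%:R * b6' * b6))%:P * 'X^6 + (b4' * b4 ^+ 2)%:P * 'X^8 + (3%:R * b6 ^+ 2)%:P * 'X^12.
have : (mp h).[u0] = 0.
  rewrite /h !(rmorphD mp) !(rmorphM mp _%:P) /= !map_polyC !map_polyXn !hornerD !hornerCM hornerC !hornerXn /=.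
  rewrite [RHS]e' !(rmorphD m, rmorphN m, rmorphM m, rmorph_nat m); ring.
move/transc_u => h0; have c i : h`_i = 0 by rewrite h0 coef0.
have := c 12%N; have := c 8%N; have := c 0%N; rewrite /h !coefD !coefCM !coefC !coefXn /=.
rewrite !(mulr0, mulr1, addr0, add0r) => c0 c8 /eqP.
rewrite mulf_eq0 (negPf (char0 2)) expf_eq0 /= => /eqP z6.
move/eqP: c8; rewrite mulf_eq0 expf_eq0 /= => /orP[/eqP z4'|/eqP z4].
  move/eqP: c0; rewrite z4' expr0n addr0 mulf_eq0 (negPf (char0 2)) expf_eq0 /= => /eqP z6'.
  exact: (@dep_neq0 k char0 E2 z4' z6').
exact: (@dep_neq0 k char0 E1 z4 z6).
Qed.

Lemma obar_onC : (cubK E2 m).[yO] = u0 ^+ 6 * (cubK E1 m).[xO].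
Proof.
have := @obar_on K u0 (m (ec_a2 E1)) (m (ec_a4 E1)) (m (ec_a6 E1)) (m (ec_a2 E2)) (m (ec_a4 E2)) (m (ec_a6 E2)) (char0K 2) u0_neq0 obar_den'.
rewrite -xOE -yOE !cubKE => e.
by rewrite !hornerD !hornerCM !hornerC !hornerXn !hornerX.
Qed.

Local Notation P0 := (pt xO yO 1).

Lemma ptE (L : fieldType) (x y z : L) : [/\ pt x y z 0 0 = x, pt x y z 0 1 = y & pt x y z 0 2%:R = z].
Proof. by rewrite /pt !mxE. Qed.

Lemma pt_neq0 (L : fieldType) (x y : L) : pt x y 1 != 0.
Proof.
by apply/eqP => /rowP /(_ 2%:R); rewrite !mxE => /eqP; rewrite oner_eq0.
Qed.

Lemma evalp_CuK_pt x y : evalp F (pt x y 1) = (cubK E2 m).[y] - u0 ^+ 6 * (cubK E1 m).[x].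
Proof. by rewrite evalp_CuK !horner_cubK; case: (ptE x y 1) => -> -> ->. Qed.

Lemma obar_on_curve : evalp F P0 = 0.
Proof. by rewrite evalp_CuK_pt obar_onC subrr. Qed.

Lemma obar_on_tangent : evalp (tangent_line F (OptK iota)) P0 = 0.
Proof.
rewrite tangent_at_O; case: (ptE xO yO 1) => -> -> ->; rewrite mulr1 xOE yOE.
exact: obar_tangent (char0K 2).
Qed.

(** The explicit point is on C_u and on the tangent, so it has positive
    multiplicity in the intersection divisor, and it is not O. *)
Lemma is_ObarP Obar : is_Obar E1 E2 iota Obar -> exists2 c, c != 0 & Obar = c *: P0.
Proof.
case=> Ob0 /(_ P0 (pt_neq0 _ _)).
have nO : same_point P0 (OptK iota) = false.
  apply/negP => /(same_pointP (pt_neq0 _ _)) [c _ /rowP /(_ 2%:R)].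
  by rewrite !mxE /= rmorph0 mulr0 => /eqP; rewrite oner_eq0.
rewrite /= nO !add0n addn0; case h: (same_point P0 Obar).
  move=> _.
  have [c c0 e] := same_pointP (pt_neq0 _ _) h.
  by exists c^-1; rewrite ?invr_eq0 // e scalerA mulVf // scale1r.
have V1 : value_at P0 (cstF 1) 1 by exact: val_cst.
rewrite /=; case=> bb [_ /(_ (cstF 1) (val_local V1)) [c [+ _]]].
rewrite big_ord0 subr0 => I1.
have /eqP := lideal_val obar_on_curve obar_on_tangent I1 V1.
by rewrite oner_eq0.
Qed.

(** The first coordinate of O-bar is a rational function of u^2.  If it satisfied
    A(x) = +- u^3 B(x), separating the even and odd powers of u would
    give B(x) = 0. *)
Lemma obar_not_root s : (mp (fden fy)).[xO] != 0 -> (mp (fnum fy)).[xO] = eps iota s * (mp (fden fy)).[xO] -> False.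
Proof.
set A := fnum fy; set B := fden fy => B0 eAB.
pose R : {poly k} := 'X * (b4'%:P - b4%:P * 'X^2).
pose P : {poly k} := - (b6'%:P - 'X^3 * b6%:P) - (ec_a2 E1 / 3%:R)%:P * R.
have RE : (mp R).[u0 ^+ 2] = u0 ^+ 2 * (m b4' - u0 ^+ 4 * m b4).
  by rewrite /R (rmorphM mp) (rmorphB mp) (rmorphM mp) /= !map_polyC map_polyX map_polyXn !hornerE /=; ring.
have PE : xO * (mp R).[u0 ^+ 2] = (mp P).[u0 ^+ 2].
  have := @obar_x_frac K u0 (m (ec_a2 E1)) (m (ec_a4 E1)) (m (ec_a6 E1)) (m (ec_a2 E2)) (m (ec_a4 E2)) (m (ec_a6 E2)) u0_neq0 obar_den'.
  rewrite -xOE -!d4 -!(dep6_map m) -RE => ->.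
  rewrite /P (rmorphB mp) (rmorphN mp) (rmorphB mp) (rmorphM mp _ R) (rmorphM mp 'X^3) /= !map_polyC map_polyXn.
  rewrite !(hornerD, hornerN) hornerCM hornerM !hornerC hornerXn /= fmorph_div rmorph_nat; ring.
have R0 : (mp R).[u0 ^+ 2] != 0 by rewrite RE mulf_neq0 ?expf_neq0 ?u0_neq0 ?obar_den.
pose r := (size A + size B)%N.
have gh (h : {poly k}) : (size h <= r)%N -> (mp (homev r h P R)).[u0 ^+ 2] = (mp R).[u0 ^+ 2] ^+ r * (mp h).[xO].
  by move=> sh; rewrite map_homev (horner_homev _ PE) // size_map_poly leqW.
have gA := gh A (leq_addr _ _); have gB := gh B (leq_addl _ _).
pose h := homev r A P R \Po 'X^2 - ((-1) ^+ s)%:P * ('X^3 * (homev r B P R \Po 'X^2)).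
have h0 : h = 0.
  apply: (@transc_u _ _ iota); rewrite /h (rmorphB mp) (rmorphM mp) (rmorphM mp 'X^3) /= !map_comp_poly map_polyC !map_polyXn.
  rewrite hornerD hornerN hornerCM hornerM !horner_comp.
  rewrite !hornerXn. rewrite (gA : _ = _). rewrite gB. rewrite eAB /eps.
  rewrite [X in _ - X * _](rmorph_sign m) -/r.
  move: ((mp R).[_] ^+ r) (mp B).[_] ((-1) ^+ s) => z1 z2 z3; ring.
move: R0 B0; suff : homev r B P R = 0.
  move=> z; move: gB; rewrite z rmorph0 horner0 => /esym/eqP; rewrite mulf_eq0 expf_eq0 => /orP[/andP[_ ->]|->] //.
apply/polyP => i; rewrite coef0.
have := congr1 (fun p : {poly k} => p`_(i * 2 + 3)) h0.
rewrite /= /h coefB coefCM coefXnM !coef_comp_poly_Xn // coef0 ltnNge leq_addl /= addnK dvdn_mull // mulnK //.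
have -> : (2 %| i * 2 + 3)%N = false by rewrite dvdn_addr ?dvdn_mull.
move/eqP; rewrite sub0r oppr_eq0 mulf_eq0 signr_eq0 => /eqP //.
Qed.
End ObarPoint.

(** * Normal form of a curve modulo a cubic *)

Section NormalForm.
Variables (K : fieldType) (b : K).
Local Notation mpK := {mpoly K[3]}.
Local Notation line := (line_at b).

Lemma homog_var i : ('X_i : mpK) \is 1.-homog.
Proof. by rewrite dhomogX /= mdeg1. Qed.

Lemma homogXn (G : mpK) d n : G \is d.-homog -> G ^+ n \is (d * n).-homog.
Proof. by move=> hG; apply: dhomogMn. Qed.

Lemma dehomD (G H : mpK) : dehom b (G + H) = dehom b G + dehom b H.
Proof. exact: (rmorphD (dehom b)). Qed.

Lemma dehomM (G H : mpK) : dehom b (G * H) = dehom b G * dehom b H.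
Proof. exact: (rmorphM (dehom b)). Qed.

(** The form is recovered from its equation in the chart by psi_dehom. *)
Lemma dehom_unique d (G H : mpK) : G \is d.-homog -> H \is d.-homog ->
  dehom b G = dehom b H -> G = H.
Proof.
move=> hG hH e; have l0 := line_at_neq0 b.
apply/eqP; rewrite -tofrac_eq (psi_dehom b hG) (psi_dehom b hH) e //.
Qed.

(** The form with the equation c(t) in the chart: t is X_2 divided by the linear
    form, which is 1 in the chart. *)
Definition hform (l : nat) (c : {poly K}) : mpK :=
  \sum_(i < l.+1) (c`_i)%:MP * ('X_2%:R ^+ i * line ^+ (l - i)).

Lemma hform_homog l c : hform l c \is l.-homog.
Proof.
apply: rpred_sum => i _; rewrite mul_mpolyC; apply: dhomogZ.
have := dhomogM (homogXn i (homog_var 2%:R)) (homogXn (l - i) (line_at_homog b)).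
by rewrite !mul1n subnKC // -ltnS ltn_ord.
Qed.

Lemma dehom_hform l (c : {poly K}) : (size c <= l.+1)%N -> dehom b (hform l c) = c%:P.
Proof.
move=> sc; rewrite /hform (rmorph_sum (dehom b)) /=.
have ec : c = \sum_(i < l.+1) (c`_i)%:P * 'X ^+ i.
  transitivity (\poly_(i < l.+1) c`_i).
    apply/polyP => i; rewrite coef_poly; case: ltnP => // h.
    by rewrite nth_default // (leq_trans sc).
  by rewrite poly_def; apply: eq_bigr => i _; rewrite mul_polyC.
rewrite [in RHS]ec (rmorph_sum polyC) /=; apply: eq_bigr => i _.
rewrite (rmorphM (dehom b) _%:MP) (rmorphM (dehom b) ('X_2%:R ^+ i)) !(rmorphXn (dehom b)) /=.
rewrite dehom_line expr1n mulr1 dehomC dehomX polyCM polyC_exp; congr (_ * _ ^+ i).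
Qed.

Lemma evalp_hform_inf l c P : evalp line P = 0 -> P 0 2%:R = 1 -> evalp (hform l c) P = c`_l.
Proof.
move=> e0 e1.
have -> : evalp (hform l c) P = \sum_(i < l.+1) c`_i * (evalp line P ^+ (l - i)).
  rewrite /hform /evalp rmorph_sum; apply: eq_bigr => i _; rewrite -!/(evalp _ P).
  rewrite [LHS](evalpM P (c`_i)%:MP) evalpC (evalpM P ('X_2%:R ^+ i)) !evalpXn evalpX e1 expr1n mul1r //.
rewrite big_ord_recr /= subnn expr0 mulr1 e0 big1 ?add0r // => i _.
by rewrite expr0n subn_eq0 leqNgt ltn_ord mulr0.
Qed.

(** The last clause evaluates the form on the line at infinity of the chart. *)
Lemma form_of_wtop l s x c : wtop l s x c -> exists G, [/\ dehom b G = c%:P,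
  forall e A l', A \is e.-homog -> (l' + s = l + e)%N -> G * A \is l'.-homog &
  forall P, evalp line P = 0 -> P 0 2%:R = 1 -> evalp G P = x].
Proof.
case=> [[-> ->]|[sl [sc <-]]].
  exists 0; split=> [|e A l' _ _|P _ _]; rewrite ?mul0r ?rpred0 ?evalp0 //.
  by rewrite [LHS](rmorph0 (dehom b)) polyC0.
exists (hform (l - s) c); split; first exact: dehom_hform.
- move=> e A l' hA ee; have := dhomogM (hform_homog (l - s) c) hA.
  by have -> : (l - s + e = l')%N by lia.
- move=> P; exact: evalp_hform_inf.
Qed.

Variables (F : mpK) (p q r : {poly K}) (p' q' r' : K).
Hypothesis hF : F \is 3.-homog.
Hypotheses (wp : wtop 1 0 p' p) (wq : wtop 2 0 q' q) (wr : wtop 3 0 r' r).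

(** C is congruent modulo F to a form of degree at most 2 in y. *)
Definition nform l (C : mpK) := exists H b0 b1 b2, [/\ C \is l.-homog, H * F \is l.-homog,
  dehom b C = dehom b H * cub p q r + quad b0 b1 b2 &
  exists x0 x1 x2, [/\ wtop l 0 x0 b0, wtop l 1 x1 b1 & wtop l 2 x2 b2]].

Let dM := rmorphM (dehom b).
Let dD := rmorphD (dehom b).

Lemma nform1 : nform 0 1.
Proof.
exists 0, 1, 0, 0; split; rewrite ?mul0r ?dhomog1 ?rpred0 //.
  by rewrite [dehom b 1](rmorph1 (dehom b)) [dehom b 0](rmorph0 (dehom b)) mul0r quadC polyC1 add0r.
exists 1, 0, 0; split; [right | by left | by left].
by split=> //; split; rewrite ?size_poly1 ?coefC.
Qed.

Lemma nformD l C C' : nform l C -> nform l C' -> nform l (C + C').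
Proof.
move=> [H [b0 [b1 [b2 [hC hH e [x0 [x1 [x2 [w0 w1 w2]]]]]]]]].
move=> [H' [b0' [b1' [b2' [hC' hH' e' [x0' [x1' [x2' [w0' w1' w2']]]]]]]]].
exists (H + H'), (b0 + b0'), (b1 + b1'), (b2 + b2'); split.
- exact: rpredD.
- by rewrite mulrDl; apply: rpredD.
- by rewrite !dD /= e e' quad.unlock !polyCD; ring.
- by exists (x0 + x0'), (x1 + x1'), (x2 + x2'); split; apply: wtopD.
Qed.

Lemma nform0 l : nform l 0.
Proof.
exists 0, 0, 0, 0; split; rewrite ?mul0r ?rpred0 //.
  by rewrite [dehom b 0](rmorph0 (dehom b)) mul0r quadC polyC0 add0r.
by exists 0, 0, 0; split; left.
Qed.

Lemma wtop0 (c : K) : wtop 0 0 c c%:P.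
Proof. by right; split=> //; split; rewrite ?coefC // size_polyC_leq1. Qed.

Lemma nform_mul n l g G x C : G \is n.-homog -> dehom b G = g%:P -> wtop n 0 x g ->
  nform l C -> nform (n + l) (G * C).
Proof.
move=> hG eG wg [H [b0 [b1 [b2 [hC hH e [x0 [x1 [x2 [w0 w1 w2]]]]]]]]].
exists (G * H), (g * b0), (g * b1), (g * b2); split.
- exact: dhomogM.
- by rewrite -mulrA; apply: dhomogM.
- by rewrite !dM /= e eG quadZ; ring.
- by exists (x * x0), (x * x1), (x * x2); split; apply: wtop_eq (wtopM wg _) _ _ => //; eauto.
Qed.

Lemma nformZ l c C : nform l C -> nform l (c *: C).
Proof.
move=> h; rewrite -mul_mpolyC; apply: (nform_mul (n := 0) _ _ (wtop0 c) h).
- by rewrite -[_%:MP]mulr1 mul_mpolyC rpredZ ?dhomog1.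
- exact: dehomC.
Qed.

Lemma nformX0 l C : nform l C -> nform l.+1 ('X_0 * C).
Proof.
apply: (@nform_mul 1 l (1 + b *: 'X) 'X_0 b); rewrite ?homog_var ?dehomX //.
right; split=> //; split; last by rewrite coefD coefZ coefX coefC /= mulr1 add0r.
apply: leq_trans (size_polyD _ _) _; rewrite geq_max size_poly1 /=.
by apply: leq_trans (size_scale_leq _ _) _; rewrite size_polyX.
Qed.

Lemma nformX2 l C : nform l C -> nform l.+1 ('X_2%:R * C).
Proof.
apply: (@nform_mul 1 l 'X 'X_2%:R 1); rewrite ?homog_var ?dehomX //.
by right; split=> //; split; rewrite ?size_polyX // coefX.
Qed.

Lemma nformX1 l C : nform l C -> nform l.+1 ('X_1 * C).
Proof.
move=> [H [b0 [b1 [b2 [hC hH e [x0 [x1 [x2 [w0 w1 w2]]]]]]]]].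
have [G [eG hG _]] := form_of_wtop w2.
exists ('X_1 * H + G), (- (r * b2)), (b0 - q * b2), (b1 - p * b2); split.
- exact: dhomogM (homog_var 1) hC.
- rewrite mulrDl; apply: rpredD; last by apply: (hG 3) => //; lia.
  by rewrite -mulrA; apply: dhomogM (homog_var 1) hH.
- rewrite dD !dM /= e eG dehomX /chart_coord /coord /=.
  rewrite quad.unlock cub.unlock !(polyCN, polyCB, polyCM); ring.
- exists (- (r' * x2)), (x0 - q' * x2), (x1 - p' * x2); split.
  + by apply: wtopN; apply: wtop_eq (wtopM wr w2) _ _ => //; lia.
  + by apply: (wtopD' w0 (wtopN (wtopM wq w2))); lia.
  + by apply: (wtopD' w1 (wtopN (wtopM wp w2))); lia.
Qed.

(** By induction on monomials: a product by 'X_1 creates a term in y^3, which is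
    eliminated with F. *)
Lemma normal_form l C : C \is l.-homog -> nform l C.
Proof.
move=> /dhomogP hC; rewrite [C]mpolyE big_seq; elim/big_rec: _ => [|m D mC IH].
  exact: nform0.
apply: nformD IH; apply: nformZ; have <- := hC _ mC.
rewrite -[X in nform X]/(mdeg m) mpolyXE_id mdegE !big_ord_recl !big_ord0 /= mulr1 addn0.
have XnE i (H : forall l C, nform l C -> nform l.+1 ('X_i * C)) n l' C' : nform l' C' -> nform (n + l') ('X_i ^+ n * C').
  by move=> h; elim: n => [|n IHn]; rewrite ?expr0 ?mul1r // exprS -mulrA; apply: H.
have e1 : lift ord0 ord0 = 1 :> 'I_3 by apply: val_inj.
have e2 : lift ord0 (lift ord0 ord0) = 2%:R :> 'I_3 by apply: val_inj.
rewrite e1 e2.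
have h2 : nform (m 2%:R) ('X_2%:R ^+ m 2%:R) by rewrite -[X in nform X]addn0 -[X in nform _ X]mulr1; apply: XnE nform1; exact: nformX2.
exact: (XnE _ nformX0 _ _ _ (XnE _ nformX1 _ _ _ h2)).
Qed.
End NormalForm.

(** * The residual intersection of plane curves *)

Section Points.
Variables (K : fieldType).

Lemma same_point_sym (P Q : 'rV[K]_3) : same_point P Q = same_point Q P.
Proof. by rewrite /same_point andbC. Qed.

Lemma same_point_refl (P : 'rV[K]_3) : same_point P P.
Proof. by rewrite /same_point submx_refl. Qed.

Lemma same_point_eq (P Q R : 'rV[K]_3) : same_point P Q -> same_point P R = same_point Q R.
Proof.
by move=> /eqmxP e; apply/eqmxP/eqmxP; [apply: eqmx_trans (eqmx_sym e) | apply: eqmx_trans e].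
Qed.

Lemma evalp_scale d (G : {mpoly K[3]}) c P : G \is d.-homog -> evalp G (c *: P) = c ^+ d * evalp G P.
Proof.
move=> hG; rewrite /evalp /meval -(@mmap_homog _ _ _ idfun d) //.
by apply: (@mmap_eqh _ _ _ idfun) => i; rewrite mxE.
Qed.

Lemma evalp_same d (G : {mpoly K[3]}) P Q : G \is d.-homog -> Q != 0 -> same_point P Q ->
  (evalp G P == 0) = (evalp G Q == 0).
Proof.
move=> hG Q0; rewrite same_point_sym => /(same_pointP Q0) [c c0 ->].
by rewrite (evalp_scale _ _ hG) mulf_eq0 expf_eq0 (negPf c0) andbF.
Qed.

Variable b : K.
Definition cpt (P : K * K) : 'rV[K]_3 := pt (1 + b * P.1) P.2 P.1.

Lemma cptE P i : cpt P 0 i = 1 * coord (1 + b * P.1) P.2 P.1 i.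
Proof. by rewrite mul1r /cpt /pt mxE. Qed.

Lemma cpt_line P : evalp (line_at b) (cpt P) = 1.
Proof. exact: line_val (cptE P). Qed.

Lemma cpt_neq0 P : cpt P != 0.
Proof.
apply/eqP => e; have /eqP := cpt_line P; rewrite e -[0](scale0r (cpt P)).
by rewrite (evalp_scale _ _ (line_at_homog b)) expr1 mul0r eq_sym oner_eq0.
Qed.

Lemma cpt_same P Q : same_point (cpt P) (cpt Q) = (P == Q).
Proof.
apply/idP/eqP => [|->]; last exact: same_point_refl.
case/(same_pointP (cpt_neq0 P)) => c _ e.
have c1 : c = 1.
  have := cpt_line P; rewrite e (evalp_scale _ _ (line_at_homog b)) cpt_line.
  by rewrite expr1 mulr1.
move: e; rewrite c1 scale1r => /rowP e.
have := e 1; have := e 2%:R; rewrite !cptE /coord /= !mul1r.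
by case: P Q {c1 e} => [t y] [t' y'] /= -> ->.
Qed.

Lemma cpt_eval d (G : {mpoly K[3]}) P : G \is d.-homog -> evalp G (cpt P) = ev P.1 P.2 (dehom b G).
Proof. by move=> hG; rewrite (val_line_inv (cptE P) hG) expr1n mul1r. Qed.

Lemma chart_point P : evalp (line_at b) P != 0 -> exists lam t y, [/\ lam != 0,
  forall i, P 0 i = lam * coord (1 + b * t) y t i & P = lam *: cpt (t, y)].
Proof.
set lam := evalp _ P => l0; exists lam, (P 0 2%:R / lam), (P 0 1 / lam).
have el : lam = P 0 0 - b * P 0 2%:R.
  by rewrite /lam /line_at evalpD evalpN -mul_mpolyC evalpM evalpC !evalpX.
have e i : P 0 i = lam * coord (1 + b * (P 0 2%:R / lam)) (P 0 1 / lam) (P 0 2%:R / lam) i.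
  have [E0 E1 E2] : [/\ P 0 0 = lam * (1 + b * (P 0 2%:R / lam)),
     P 0 1 = lam * (P 0 1 / lam) & P 0 2%:R = lam * (P 0 2%:R / lam)].
    split; rewrite 1?mulrC ?divfK //.
    by rewrite mulrDl mul1r -mulrA divfK // el subrK.
  case: i => [[|[|[|//]]] hi]; rewrite /coord /=.
  - by rewrite -E0; congr (P 0 _); apply: val_inj.
  - by rewrite -E1; congr (P 0 _); apply: val_inj.
  - by rewrite -E2; congr (P 0 _); apply: val_inj.
by split=> //; apply/rowP => i; rewrite mxE cptE mul1r.
Qed.

Lemma count_cpt (pre : seq 'rV[K]_3) (pts : seq (K * K)) P :
  all2 (fun R S => same_point R (cpt S)) pre pts ->
  count (same_point (cpt P)) pre = count_mem P pts.
Proof.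
elim: pre pts => [|R pre IH] [|S pts] //= /andP[e /IH ->]; congr (_ + _)%N.
by rewrite same_point_sym (same_point_eq _ e) cpt_same eq_sym.
Qed.

Lemma passes_cpt d (G : {mpoly K[3]}) pre pts : G \is d.-homog ->
  all2 (fun R S => same_point R (cpt S)) pre pts ->
  passes_through G pre = all (fun S => ev S.1 S.2 (dehom b G) == 0) pts.
Proof.
move=> hG; elim: pre pts => [|R pre IH] [|S pts] //= /andP[e /IH ->]; congr (_ && _).
by rewrite (evalp_same hG (cpt_neq0 S) e) (cpt_eval _ hG).
Qed.
End Points.

Section FormAtInfinity.
Variables (K : fieldType) (b : K).
Local Notation mpK := {mpoly K[3]}.
Local Notation line := (line_at b).
Variables (l : nat) (b0 b1 b2 : {poly K}) (x0 x1 x2 : K).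
Hypotheses (v0 : wtop l 0 x0 b0) (v1 : wtop l 1 x1 b1) (v2 : wtop l 2 x2 b2).

(** The last clause says that the top coefficients are the equation on the line at
    infinity of the chart. *)
Lemma form_of_quad : exists C : mpK, [/\ C \is l.-homog, dehom b C = quad b0 b1 b2 &
  forall P, evalp line P = 0 -> P 0 2%:R = 1 -> evalp C P = (quad x0 x1 x2).[P 0 1]].
Proof.
have [G0 [e0 h0 E0]] := form_of_wtop b v0.
have [G1 [e1 h1 E1]] := form_of_wtop b v1.
have [G2 [e2 h2 E2]] := form_of_wtop b v2.
exists (G0 * 1 + G1 * 'X_1 + G2 * 'X_1 ^+ 2); split.
- apply: rpredD; first apply: rpredD.
  + by apply: (h0 0%N); rewrite ?dhomog1.
  + by apply: (h1 1%N); rewrite ?homog_var ?addn1.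
  + by apply: (h2 2%N); rewrite ?addn2 //; apply: (@homogXn _ _ 1 2); exact: homog_var.
- rewrite !(rmorphD (dehom b)) (rmorphM (dehom b) G0) (rmorphM (dehom b) G1) (rmorphM (dehom b) G2) (rmorphXn (dehom b)) (rmorph1 (dehom b)) /=.
  by rewrite e0 e1 e2 dehomX quad.unlock mulr1.
- move=> P l0 l1; rewrite !evalpD (evalpM P G0) (evalpM P G1) (evalpM P G2) evalpXn evalpX evalp1 E0 // E1 // E2 //.
  by rewrite quad.unlock !hornerE ?mulr1.
Qed.

End FormAtInfinity.

Lemma nrm_common_root (K : fieldType) (p q r c0 c1 c2 y : K) :
  (cub p q r).[y] = 0 -> (quad c0 c1 c2).[y] = 0 -> nrm p q r c0 c1 c2 = 0.
Proof.
move=> eF eC; have := congr1 (fun h : {poly K} => h.[y]) (quad_adj p q r c0 c1 c2).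
by rewrite /= hornerM eC mul0r hornerD hornerM eF mul0r addr0 hornerC.
Qed.

(** C and C' generate the same ideal modulo F. *)
Lemma inI_transport (K : fieldType) (F C C' : {poly {poly K}}) H a t y g : a != 0 ->
  C' = H * F + a%:P%:P * C -> inI F C t y g <-> inI F C' t y g.
Proof.
move=> a0 eC; split=> -[e [A [B [e0 h]]]].
  exists e, (A - a^-1%:P%:P * B * H), (a^-1%:P%:P * B); split=> //; rewrite h eC.
  have ea : a^-1%:P%:P * a%:P%:P = 1 :> {poly {poly K}} by rewrite -!polyCM mulVf.
  by rewrite -[B * C]mul1r -ea; ring.
by exists e, (A + B * H), (B * a%:P%:P); split=> //; rewrite h eC; ring.
Qed.

Section CoreCurve.
Variables (K : closedFieldType) (b : K).
Local Notation mpK := {mpoly K[3]}.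
Local Notation line := (line_at b).
Variables (F : mpK) (p q r c0 c1 c2 : {poly K}) (l : nat) (pts : seq (K * K)) (nu tQ : K).
Variables (p' q' r' c0' c1' c2' : K).
Hypothesis hF : F \is 3.-homog.
Hypothesis eF : dehom b F = cub p q r.
Hypothesis Finf : forall P, evalp line P = 0 -> P 0 2%:R = 1 -> evalp F P = (cub p' q' r').[P 0 1].
Hypothesis Finf0 : forall P, P != 0 -> evalp line P = 0 -> evalp F P = 0 -> P 0 2%:R != 0.
Hypotheses (wp : wtop 1 0 p' p) (wq : wtop 2 0 q' q) (wr : wtop 3 0 r' r).
Hypotheses (w0 : wtop l 0 c0' c0) (w1 : wtop l 1 c1' c1) (w2 : wtop l 2 c2' c2).
Hypothesis Ninf : nrm p' q' r' c0' c1' c2' != 0.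
Hypothesis nu0 : nu != 0.
Hypothesis eN : nrm p q r c0 c1 c2 = nu%:P * \prod_(P <- pts) ('X - P.1%:P) * ('X - tQ%:P).
Hypothesis upts : uniq [seq P.1 | P <- pts].
Hypothesis cpts : forall P, P \in pts -> common P.1 P.2 (cub p q r) (quad c0 c1 c2).
Hypothesis spts : forall P, P \in pts -> (fib P.1 (cub p q r))^`().[P.2] != 0.
Hypothesis szpts : (size pts).+1 = (3 * l)%N.
Variable pre : seq 'rV[K]_3.
Hypothesis hpre : all2 (fun R S => same_point R (cpt b S)) pre pts.

(** The curve C_u meets the line at infinity of the chart, and there the form
    does not vanish, because its norm does not. *)
Lemma core_exists : exists C, [/\ plane_curve l C, passes_through C pre & ~ contains_curve C F].
Proof.
have [C [hC eC infC]] := form_of_quad b w0 w1 w2.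
have nc : ~ contains_curve C F.
  move=> cC; have /closed_rootP [y ry] : size (cub p' q' r') != 1 by rewrite size_cub.
  pose P := pt b y 1.
  have P2 : P 0 2%:R = 1 by rewrite /P /pt mxE.
  have P1 : P 0 1 = y by rewrite /P /pt mxE.
  have l0 : evalp line P = 0.
    by rewrite /line_at evalpD evalpN -mul_mpolyC evalpM evalpC !evalpX P2 /P /pt mxE /= mulr1 subrr.
  have P0 : P != 0 by apply/eqP => e; move/eqP: P2; rewrite e mxE eq_sym oner_eq0.
  have F0 : evalp F P = 0 by rewrite Finf // P1; apply/rootP.
  have := cC P P0 F0; rewrite infC // P1 => C0.
  by move: Ninf; rewrite (nrm_common_root (rootP ry) C0) eqxx.
exists C; split=> //; first split=> //.
  by apply/eqP => C0; apply: nc => P _ _; rewrite C0 evalp0.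
rewrite (passes_cpt hC hpre) eC; apply/allP => P /cpts /andP[_ h] //.
Qed.

(** Modulo F, every admissible form is a constant a times the given one by
    unique_up_to_scalar.  If a = 0 the curve contains C_u; otherwise the local
    ideals are those of the given form, and no common point lies on the
    line at infinity since the norm does not vanish there. *)
Lemma core_residual : exists yQ, [/\
  ((adj2 p q r c0 c1 c2).[tQ] != 0 /\
     yQ = (adj1 p q r c0 c1 c2).[tQ] / (adj2 p q r c0 c1 c2).[tQ] - p.[tQ]) \/
  (exists P, [/\ P \in pts, P.1 = tQ & yQ = - (c1.[tQ] / c2.[tQ]) - P.2]),
  evalp F (cpt b (tQ, yQ)) = 0 &
  forall C, plane_curve l C -> passes_through C pre ->
    evalp C (cpt b (tQ, yQ)) = 0 /\
    (~ contains_curve C F -> intersection_divisor F C (rcons pre (cpt b (tQ, yQ))))].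
Proof.
have [yQ [cQ fQ mQ]] := residual_point nu0 eN upts cpts spts.
exists yQ; split=> //.
  by case/andP: cQ => /eqP e _; rewrite (cpt_eval _ _ hF) eF.
move=> C [C0 hC] pC.
have [H [b0 [b1 [b2 [_ hHF eC [x0 [x1 [x2 [v0 v1 v2]]]]]]]]] := normal_form b hF wp wq wr hC.
have ev_b P : ev P.1 P.2 (cub p q r) = 0 -> ev P.1 P.2 (dehom b C) = ev P.1 P.2 (quad b0 b1 b2).
  by move=> e; rewrite eC evD evM e mulr0 add0r.
have bpts P : P \in pts -> ev P.1 P.2 (quad b0 b1 b2) = 0.
  move=> Pp; have /andP[/eqP eP _] := cpts Pp; rewrite -ev_b //.
  by move: pC; rewrite (passes_cpt hC hpre) => /allP /(_ P Pp) /eqP.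
have [a [ea0 ea1 ea2]] := unique_up_to_scalar nu0 eN upts cpts spts wp wq wr w0 w1 w2 v0 v1 v2 szpts bpts.
have eB : quad b0 b1 b2 = a%:P%:P * quad c0 c1 c2 by rewrite ea0 ea1 ea2 quadZ.
rewrite eB in eC.
have CQ : evalp C (cpt b (tQ, yQ)) = 0.
  rewrite (cpt_eval _ _ hC) eC evD !evM /=; case/andP: cQ => /eqP -> /eqP ->.
  by rewrite !mulr0 addr0.
split=> // nC.
have a0 : a != 0.
  apply/eqP => z; apply: nC => P _ FP.
  suff -> : C = H * F by rewrite evalpM FP mulr0.
  apply: (@dehom_unique _ b _ _ _ hC hHF); rewrite dehomM eC eF z polyC0 mul0r addr0 //.
have hpre' : all2 (fun R S => same_point R (cpt b S)) (rcons pre (cpt b (tQ, yQ))) (rcons pts (tQ, yQ)).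
  elim: pre pts hpre => [|R pr IH] [|S ps] //=; first by rewrite same_point_refl.
  by case/andP => -> /IH.
have vanish G d : G \is d.-homog -> passes_through G pre -> evalp G (cpt b (tQ, yQ)) = 0 ->
    forall P, P != 0 -> evalp G P != 0 -> count (same_point P) (rcons pre (cpt b (tQ, yQ))) = 0.
  move=> hG pG GQ P P0 GP; apply/eqP; rewrite -leqn0 leqNgt -has_count -all_predC.
  have : all (fun R => evalp G R == 0) (rcons pre (cpt b (tQ, yQ))) by rewrite all_rcons GQ eqxx.
  apply: sub_all => R /= GR; apply: contra GP; rewrite same_point_sym => e.
  by rewrite -(evalp_same hG P0 e).
have pF : passes_through F pre.
  by rewrite (passes_cpt hF hpre) eF; apply/allP => P /cpts /andP[].
have FQ : evalp F (cpt b (tQ, yQ)) = 0 by case/andP: cQ => /eqP e _; rewrite (cpt_eval _ _ hF) eF.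
move=> P P0.
have [FP|FP] := eqVneq (evalp F P) 0; last first.
  by rewrite (vanish F 3) //; apply: (mult_zero hF hC); left.
have [CP|CP] := eqVneq (evalp C P) 0; last first.
  by rewrite (vanish C l) //; apply: (mult_zero hF hC); right.
have lP : evalp line P != 0.
  apply/eqP => lP; have P2 := Finf0 P0 lP FP.
  pose P' := (P 0 2%:R)^-1 *: P.
  have P'2 : P' 0 2%:R = 1 by rewrite mxE mulVf.
  have zero G d : G \is d.-homog -> evalp G P = 0 -> evalp G P' = 0.
    by move=> hG e; rewrite (evalp_scale _ _ hG) e mulr0.
  have l' := zero _ _ (line_at_homog b) lP.
  have F' := zero _ _ hF FP; rewrite Finf // in F'.
  have wa s x c : wtop l s x c -> wtop l s (a * x) (a%:P * c).
    by move=> w; apply: wtop_eq (wtopM (wtop0 a) w) _ _ => //; lia.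
  have [G [hG eG infG]] := form_of_quad b (wa _ _ _ w0) (wa _ _ _ w1) (wa _ _ _ w2).
  have eCG : C = H * F + G.
    apply: (@dehom_unique _ b _ _ _ hC (rpredD hHF hG)); rewrite dehomD dehomM eG eC eF quadZ //.
  have := infG P' l' P'2.
  have -> : evalp G P' = 0.
    by have := zero _ _ hC CP; rewrite eCG evalpD evalpM (zero _ _ hF FP) mulr0 add0r.
  rewrite quadZ hornerM hornerC.
  move=> /esym/eqP; rewrite mulf_eq0 (negPf a0) /= => /eqP C'.
  by move: Ninf; rewrite (nrm_common_root F' C') eqxx.
have [lam [t [y [lam0 eP eP']]]] := chart_point lP.
have tr g := inI_transport t y g a0 eC.
have cC : common t y (cub p q r) (quad c0 c1 c2).
  have := val_line_inv eP hF; rewrite FP eF => /esym/eqP.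
  rewrite mulf_eq0 expf_eq0 (negPf lam0) /= => /eqP Ft.
  have := val_line_inv eP hC; rewrite CP eC => /esym/eqP.
  rewrite mulf_eq0 expf_eq0 (negPf lam0) andbF /= evD !evM Ft mulr0 add0r evC hornerC mulf_eq0 (negPf a0) /= => Ct.
  by rewrite /common Ft Ct eqxx.
have -> : count (same_point P) (rcons pre (cpt b (tQ, yQ))) = count_mem (t, y) (rcons pts (tQ, yQ)).
  rewrite -(count_cpt _ hpre'); apply: eq_count => R.
  exact: same_point_eq (same_pointZ lam0 eP').
have [[-> [m1 m2]]|[-> [m1 [h m2] m3]]] := mQ _ _ cC.
  by apply: (mult_one_local lam0 eP hF hC FP CP); rewrite eF; apply/tr.
apply: (mult_two_local lam0 eP hF hC FP CP (h := h)); rewrite eF; try exact/tr.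
Qed.
End CoreCurve.

(** * Irreducibility of C_u *)

(** If N = 0, F divides C D, so it divides C, which has smaller degree, or D = 0;
    but D = 0 gives F a root. *)
Lemma nrm_irreducible (L : fieldType) (p q r c0 c1 c2 : L) :
  (forall x, ~~ root (cub p q r) x) -> quad c0 c1 c2 != 0 -> nrm p q r c0 c1 c2 != 0.
Proof.
move=> nr C0; apply/eqP => n0.
have irr : irreducible_poly (cub p q r) by apply: cubic_irreducible => //; rewrite size_cub.
have ndv b0 b1 b2 : cub p q r %| quad b0 b1 b2 -> [/\ b0 = 0, b1 = 0 & b2 = 0].
  by case/dvdpP => h; rewrite mulrC => /quad_cub0.
have cop : coprimep (cub p q r) (quad c0 c1 c2).
  rewrite /coprimep; apply/negPn/negP => sg.
  have := irr.2 _ sg (dvdp_gcdl _ _) => /andP[_ h].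
  have [z0 z1 z2] := ndv _ _ _ (dvdp_trans h (dvdp_gcdr _ _)).
  by move: C0; rewrite z0 z1 z2 quadC polyC0 eqxx.
have := quad_adj p q r c0 c1 c2; rewrite n0 add0r => e.
have /ndv[d0 d1 d2] : cub p q r %| quad (adj0 p q r c0 c1 c2) (adj1 p q r c0 c1 c2) (adj2 p q r c0 c1 c2).
  by rewrite -(Gauss_dvdpr _ cop) e dvdp_mulr.
have [_ eF] := adj_eq0_factor d0 d1 d2 C0.
by have := nr (c1 / c2 - p); rewrite eF rootM root_XsubC eqxx.
Qed.

Lemma nrm_morph (R S : comNzRingType) (f : {rmorphism R -> S}) p q r c0 c1 c2 :
  nrm (f p) (f q) (f r) (f c0) (f c1) (f c2) = f (nrm p q r c0 c1 c2).
Proof.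
rewrite nrm.unlock adj0.unlock adj1.unlock adj2.unlock.
by rewrite !(rmorphD f, rmorphN f, rmorphB f, rmorphM f).
Qed.

Lemma cub_homogenize (R : comNzRingType) (p q r w d n : R) : w * d = n -> (cub p q r).[w] = 0 ->
  n * (n * n) + p * (n * n) * d + q * n * (d * d) + r * (d * (d * d)) = 0.
Proof.
move=> <-; rewrite cub.unlock !hornerE /= => e.
by rewrite -[RHS](mul0r (d * (d * d))) -e; ring.
Qed.

Lemma adj1_morph (R S : comNzRingType) (f : {rmorphism R -> S}) p q r c0 c1 c2 :
  adj1 (f p) (f q) (f r) (f c0) (f c1) (f c2) = f (adj1 p q r c0 c1 c2).
Proof. by rewrite adj1.unlock !(rmorphD f, rmorphN f, rmorphB f, rmorphM f). Qed.

Lemma adj2_morph (R S : comNzRingType) (f : {rmorphism R -> S}) p q r c0 c1 c2 :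
  adj2 (f p) (f q) (f r) (f c0) (f c1) (f c2) = f (adj2 p q r c0 c1 c2).
Proof. by rewrite adj2.unlock !(rmorphD f, rmorphN f, rmorphB f, rmorphM f). Qed.

(** The denominator of a root is prime to its numerator and divides its cube. *)
Lemma integral_root (K : fieldType) (p q r : {poly K}) (w : ratfun K) :
  root (cub p%:F q%:F r%:F) w -> exists g : {poly K}, (cub p q r).[g] = 0.
Proof.
move=> /rootP; set N := fnum w; set D := fden w.
have D0 : D%:F != 0 :> ratfun K by rewrite tofrac_eq0 fden_neq0.
have ew : w * D%:F = N%:F by rewrite (fnum_fdenE w) divfK.
move=> /(cub_homogenize ew) ec.
have e : N * (N * N) + p * (N * N) * D + q * N * (D * D) + r * (D * (D * D)) = 0.
  by apply/eqP; rewrite -tofrac_eq0 !(tofracD, tofracM) ec.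
have DN : D %| 1.
  have cND : coprimep D N by rewrite coprimep_sym coprimep_fnum_fden.
  rewrite -(Gauss_dvdpr _ cND) -(Gauss_dvdpr _ cND) -(Gauss_dvdpr _ cND) mulr1.
  apply/dvdpP; exists (- (p * (N * N) + q * N * D + r * (D * D))).
  by rewrite -[LHS]subr0 -e; ring.
move: DN; rewrite dvdp1 => /size_poly1P [d d0 eD].
have [g eg] : exists g : {poly K}, N = d%:P * g.
  by exists (d^-1 *: N); rewrite mul_polyC scalerA divff // scale1r.
have dP0 : d%:P != 0 :> {poly K} by rewrite polyC_eq0.
exists g; apply: (mulfI (expf_neq0 3 dP0)); rewrite mulr0 -[RHS]e eD eg cub.unlock.
by rewrite !hornerE /=; ring.
Qed.

Section NonIsotrivial.
Variables (k : fieldType) (E1 E2 : ellcurve k).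
Variables (K : closedFieldType) (iota : {rmorphism ratfun k -> K}).
Hypothesis char0 : forall n, n.+1%:R != 0 :> k.
Hypothesis jj : jinv E1 != jinv E2.
Local Notation m := (iotaC iota).
Local Notation mp := (map_poly m).
Local Notation u0 := (iota ratX).
Local Notation b4 := (dep4 (ec_a2 E1) (ec_a4 E1)).
Local Notation b6 := (dep6 (ec_a2 E1) (ec_a4 E1) (ec_a6 E1)).
Local Notation b4' := (dep4 (ec_a2 E2) (ec_a4 E2)).
Local Notation b6' := (dep6 (ec_a2 E2) (ec_a4 E2) (ec_a6 E2)).

Lemma transc_mono n (a c : k) : (0 < n)%N -> m a = u0 ^+ n * m c -> a = 0 /\ c = 0.
Proof.
move=> n0 e; have : (mp (a%:P - c%:P * 'X^n)).[u0] = 0.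
  by rewrite (rmorphB mp) (rmorphM mp) /= !map_polyC map_polyXn hornerD hornerN hornerM !hornerC hornerXn /= e mulrC subrr.
move/transc_u => h.
have co i : (a%:P - c%:P * 'X^n : {poly k})`_i = 0 by rewrite h coef0.
have := co 0%N; have := co n; rewrite !coefB !coefCM !coefXn !coefC.
rewrite (gtn_eqF n0) (ltn_eqF n0) !eqxx /= mulr0 mulr1 subr0 sub0r.
by move=> /eqP; rewrite oppr_eq0 => /eqP.
Qed.

Lemma depressed_horner (E : ellcurve k) x : (cubK E m).[x] =
  (x + m (ec_a2 E) / 3%:R) ^+ 3 + m (dep4 (ec_a2 E) (ec_a4 E)) * (x + m (ec_a2 E) / 3%:R)
  + m (dep6 (ec_a2 E) (ec_a4 E) (ec_a6 E)).
Proof.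
rewrite (dep4_map m) (dep6_map m) -(depressed (char0K iota char0 2)).
by rewrite horner_cubK /ec_cubic !expr1n !mulr1.
Qed.

(** By degrees, g is linear, g = al x + be.  Completing the cube on both sides and
    comparing coefficients gives al^3 = u^6, dep4' al = u^6 dep4 and
    dep6' = u^6 dep6, hence dep4 = dep4' = 0 as u is transcendental. *)
Lemma no_linear_map (g : {poly K}) : (cubK E2 m) \Po g = u0 ^+ 6 *: cubK E1 m -> False.
Proof.
move=> e; have u60 : u0 ^+ 6 != 0 by rewrite expf_neq0 // u0_neq0.
have h3 := char0K iota char0 2.
have sg : size g = 2.
  have := size_comp_poly (cubK E2 m) g; rewrite e size_scale // !size_cubK /=.
  by case: (size g) => [|[|[|n]]] //; lia.
have [al [be eg]] : exists al be, g = al *: 'X + be%:P.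
  exists g`_1, g`_0; apply/polyP => i; rewrite coefD coefZ coefX coefC.
  case: i => [|[|i]]; rewrite ?mulr0 ?mulr1 ?addr0 ?add0r //= nth_default // sg //.
have ev x : (cubK E2 m).[al * x + be] = u0 ^+ 6 * (cubK E1 m).[x].
  have := congr1 (fun h : {poly K} => h.[x]) e; rewrite /= horner_comp hornerZ eg.
  by rewrite hornerD hornerZ hornerX hornerC.
have sh : be + m (ec_a2 E2) / 3%:R = al * (m (ec_a2 E1) / 3%:R) /\ al ^+ 3 = u0 ^+ 6.
  pose d x := (cubK E2 m).[al * x + be] - u0 ^+ 6 * (cubK E1 m).[x].
  have d0 x : d x = 0 by rewrite /d ev subrr.
  have h6 : 6%:R != 0 :> K := char0K iota char0 5.
  have dE x : d x = (al * x + be + m (ec_a2 E2) / 3%:R) ^+ 3 + m b4' * (al * x + be + m (ec_a2 E2) / 3%:R) + m b6'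
    - u0 ^+ 6 * ((x + m (ec_a2 E1) / 3%:R) ^+ 3 + m b4 * (x + m (ec_a2 E1) / 3%:R) + m b6).
    by rewrite /d !depressed_horner.
  move: (m (ec_a2 E1) / 3%:R) (m (ec_a2 E2) / 3%:R) (m b4) (m b4') (m b6) (m b6') (u0 ^+ 6) u60 dE => v w z4 z4' z6 z6' U U0 dE.
  have al3 : al ^+ 3 = U.
    apply/eqP; rewrite -subr_eq0; apply/eqP; apply: (mulfI h6); rewrite mulr0.
    transitivity (d 2%:R - 3%:R * d 1 + 3%:R * d 0 - d (-1)); first by rewrite !dE; ring.
    by rewrite !d0; ring.
  split=> //.
  have al0 : al != 0 by apply: contraNneq U0 => z; rewrite -al3 z expr0n.
  apply/eqP; rewrite -subr_eq0; apply/eqP; apply: (mulfI h6); apply: (mulfI (expf_neq0 2 al0)); rewrite !mulr0.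
  transitivity (d 1 - 2%:R * d 0 + d (-1)); first by rewrite !dE -al3; ring.
  by rewrite !d0; ring.
case: sh => sh al3.
have ev' z : (al * z) ^+ 3 + m b4' * (al * z) + m b6' = u0 ^+ 6 * (z ^+ 3 + m b4 * z + m b6).
  have := ev (z - m (ec_a2 E1) / 3%:R); rewrite !depressed_horner subrK.
  have -> : al * (z - m (ec_a2 E1) / 3%:R) + be + m (ec_a2 E2) / 3%:R = al * z by rewrite -addrA sh; ring.
  by [].
have e6 : m b6' = u0 ^+ 6 * m b6.
  have := ev' 0; rewrite !(mulr0, expr0n, add0r) //.
have e4 : m b4' * al = u0 ^+ 6 * m b4.
  have := ev' 1; rewrite !mulr1 expr1n al3 e6 => h.
  transitivity (u0 ^+ 6 + m b4' * al + u0 ^+ 6 * m b6 - u0 ^+ 6 - u0 ^+ 6 * m b6); first by ring.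
  by rewrite h; ring.
have e4' : m (b4' ^+ 3) = u0 ^+ 12 * m (b4 ^+ 3).
  apply: (mulIf u60); rewrite -{1}al3 !(rmorphXn m) -exprMn e4; ring.
have [z4 z4'] := transc_mono (isT : (0 < 12)%N) e4'.
by apply: (dep4_not_both_zero char0 jj); apply/eqP; rewrite -[_ == 0](expf_eq0 _ 3) ?z4 ?z4' eqxx.
Qed.

(** The norm in the coordinates x1, x2 of the plane. *)
Definition normx (c0 c1 c2 : {poly K}) : {poly K} :=
  nrm (m (ec_a2 E2))%:P (m (ec_a4 E2))%:P ((m (ec_a6 E2))%:P - u0 ^+ 6 *: cubK E1 m) c0 c1 c2.

(** A zero of F over K(x1) would be a polynomial in x1, excluded by
    no_linear_map. *)
Lemma normx_neq0 c0 c1 c2 : quad c0 c1 c2 != 0 -> normx c0 c1 c2 != 0.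
Proof.
move=> C0; rewrite -tofrac_eq0 -nrm_morph; apply: nrm_irreducible.
  move=> w; apply/negP => /integral_root [g]; rewrite cub.unlock !hornerE /= => e.
  apply: (@no_linear_map g); rewrite cubKE !comp_polyD !(comp_polyM _%:P) !comp_polyC !comp_Xn_poly comp_polyX.
  by apply/eqP; rewrite -subr_eq0 -[X in _ == X]e; apply/eqP; ring.
apply: contraNneq C0 => /quad_eq0 [] /eqP + /eqP + /eqP.
by rewrite !tofrac_eq0 => /eqP -> /eqP -> /eqP ->; rewrite quadC polyC0.
Qed.
End NonIsotrivial.

(** * Linear conditions and change of chart *)

(** There are 3 l coefficients in all. *)
Lemma exists_triple (L : fieldType) l n (f : nat -> {poly L} -> {poly L} -> {poly L} -> L) :
  (n < 3 * l)%N ->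
  (forall i a c0 c1 c2 c0' c1' c2', f i (a *: c0 + c0') (a *: c1 + c1') (a *: c2 + c2') =
     a * f i c0 c1 c2 + f i c0' c1' c2') ->
  exists c0 c1 c2 : {poly L}, [/\ (size c0 <= l.+1)%N, (size c1 <= l)%N, (size c2 <= l.-1)%N,
    quad c0 c1 c2 != 0 & forall i, (i < n)%N -> f i c0 c1 c2 = 0].
Proof.
move=> nl lf; pose N := (l.+1 + (l + l.-1))%N.
have eN : N = (3 * l)%N by rewrite /N; lia.
pose P0 (v : 'rV[L]_N) := rVpoly (lsubmx v).
pose P1 (v : 'rV[L]_N) := rVpoly (lsubmx (rsubmx v)).
pose P2 (v : 'rV[L]_N) := rVpoly (rsubmx (rsubmx v)).
pose g (v : 'rV[L]_N) : 'rV[L]_n := \row_i f i (P0 v) (P1 v) (P2 v).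
have lg : linear g.
  by move=> a v w; apply/rowP => i; rewrite !mxE /P0 /P1 /P2 !linearP lf.
pose gL : {linear 'rV[L]_N -> 'rV[L]_n} := HB.pack g (GRing.isLinear.Build L _ _ _ g lg).
have [v] : exists2 v : 'rV[L]_N, (v <= kermx (lin1_mx gL))%MS & v != 0.
  apply/rowV0Pn; rewrite -mxrank_eq0 mxrank_ker -lt0n subn_gt0.
  by apply: leq_ltn_trans (rank_leq_col _) _; rewrite eN.
move=> /sub_kermxP; rewrite mul_rV_lin1 => gv v0.
exists (P0 v), (P1 v), (P2 v); split; try exact: size_poly.
- apply: contraNneq v0 => /quad_eq0 [z0 z1 z2].
  have zz d (w : 'rV[L]_d) : rVpoly w = 0 -> w = 0.
    by move=> e; rewrite -[w]rVpolyK e linear0.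
  rewrite -[v]hsubmxK (zz _ _ z0) -[rsubmx v]hsubmxK (zz _ _ z1) (zz _ _ z2).
  by rewrite !row_mx0.
move=> i ni; have /rowP/(_ (Ordinal ni)) := gv.
by rewrite !mxE.
Qed.

Section ChartTops.
Variable K : fieldType.
Variable b : K.
Local Notation x1 := (1 + b *: 'X : {poly K}).

Lemma topd_chart_x : topd 1 b x1.
Proof.
split; last by rewrite coefD coefZ coefX coefC /= mulr1 add0r.
apply: leq_trans (size_polyD _ _) _; rewrite geq_max size_poly1 /=.
by apply: leq_trans (size_scale_leq _ _) _; rewrite size_polyX.
Qed.

Lemma topdXn m n x (f : {poly K}) : topd m x f -> topd (m * n) (x ^+ n) (f ^+ n).
Proof.
move=> h; elim: n => [|n IH]; first by rewrite muln0 !expr0; split; rewrite ?size_poly1 ?coefC.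
by rewrite mulnS !exprS; apply: topdM.
Qed.

(** The form takes the value c(b) at (b : 1), the point at infinity of the chart. *)
Lemma topd_homev n (c : {poly K}) : (size c <= n.+1)%N -> topd n c.[b] (homev n c x1 'X).
Proof.
move=> sc; rewrite (horner_coef_wide _ sc) /homev.
elim/big_ind2: _ => [|x1 f1 x2 f2 h1 h2|i _]; first exact: topd0.
  exact: topdD.
have h : topd (1 * i + 1 * (n - i)) (b ^+ i * 1 ^+ (n - i)) (x1 ^+ i * 'X ^+ (n - i)).
  apply: topdM; first exact: topdXn topd_chart_x.
  by apply: topdXn; split; rewrite ?size_polyX ?coefX.
rewrite !mul1n subnKC -1?ltnS ?ltn_ord // expr1n mulr1 in h; case: h => hs hc.
split; first exact: leq_trans (size_scale_leq _ _) hs.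
by rewrite coefZ hc.
Qed.

Lemma wtop_homev l s (c : {poly K}) : (size c + s <= l.+1)%N \/ c = 0 ->
  wtop l s c.[b] (homev (l - s) c x1 'X).
Proof.
have [->|c0] := eqVneq c 0.
  move=> _; left; rewrite horner0; split=> //.
  by rewrite /homev big1 // => i _; rewrite coef0 scale0r.
case=> [sc|/eqP]; last by rewrite (negPf c0).
have h : (s <= l)%N by move: c0 sc; rewrite -size_poly_gt0; case: (size c) => // z _; lia.
by right; split=> //; apply: topd_homev; lia.
Qed.

Lemma homev_at0 n (c : {poly K}) : (homev n c x1 'X).[0] = c`_n.
Proof.
rewrite /homev horner_sum big_ord_recr /= subnn expr0 mulr1 hornerZ horner_exp.
rewrite big1 => [|i _]; last first.
  by rewrite hornerZ hornerM [X in _ * (_ * X)]horner_exp hornerX expr0n subn_eq0 leqNgt ltn_ord !mulr0.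
by rewrite add0r !hornerE expr1n mulr1.
Qed.

Lemma homev_affine n (c : {poly K}) x : (size c <= n.+1)%N -> x != b ->
  (homev n c x1 'X).[(x - b)^-1] = (x - b) ^- n * c.[x].
Proof.
move=> sc xb; have d0 : x - b != 0 by rewrite subr_eq0.
rewrite (@horner_homev _ _ _ _ _ _ x) // hornerX ?exprVn // !hornerE.
by rewrite -{1}[x](subrK b) mulrDl mulfV //; ring.
Qed.
End ChartTops.

(** * Rationality and the equation of C_u in a chart *)

Lemma last_root (K : fieldType) (rs : seq K) (N : {poly K}) nu : uniq rs ->
  (forall t, t \in rs -> N.[t] = 0) -> topd (size rs).+1 nu N -> nu != 0 ->
  exists a tQ, a != 0 /\ N = a%:P * \prod_(t <- rs) ('X - t%:P) * ('X - tQ%:P).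
Proof.
move=> urs rN [sN eN] nu0.
have : \prod_(t <- rs) ('X - t%:P) %| N.
  apply: uniq_roots_dvdp; last by rewrite uniq_rootsE.
  by apply/allP => t /rN /rootP.
case/dvdpP => h eh; have N0 : N != 0 by apply: contraNneq nu0 => z; rewrite -eN z coef0.
have szN : size N = (size rs).+2.
  by apply/eqP; rewrite eqn_leq sN ltnNge; apply: contra nu0 => s; rewrite -eN nth_default.
have h0 : h != 0 by apply: contraNneq N0 => z; rewrite eh z mul0r.
have sh : size h = 2.
  move: szN; rewrite eh size_Mmonic ?monic_prod_XsubC // size_prod_XsubC.
  by move: h0; rewrite -size_poly_gt0; move: (size h) => x; lia.
have h1 : h`_1 != 0 by have := h0; rewrite -lead_coef_eq0 /lead_coef sh.
exists h`_1, (- (h`_0 / h`_1)); split=> //.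
rewrite eh -mulrA [in RHS]mulrCA [LHS]mulrC; congr (_ * _).
rewrite mulrBr -polyCM mulrN mulrCA divff // mulr1 polyCN opprK.
apply/polyP => i; rewrite coefD coefCM coefX coefC.
by case: i => [|[|i]] /=; rewrite ?mulr0 ?mulr1 ?addr0 ?add0r // nth_default // sh.
Qed.

(** The quotient of NU by GU is a linear polynomial over F. *)
Lemma rational_last_root (F K : fieldType) (f : {rmorphism F -> K}) (NU GU : {poly F}) (Pi : {poly K}) a g t :
  a != 0 -> g != 0 -> Pi != 0 -> map_poly f GU = g *: Pi -> map_poly f NU = a%:P * Pi * ('X - t%:P) ->
  exists tU, t = f tU.
Proof.
move=> a0 g0 Pi0 eG eN.
have : GU %| NU.
  rewrite -(dvdp_map f) eG eN dvdpZl //; apply: dvdp_mulr; exact: dvdp_mull.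
case/dvdpP => h eh.
have e : map_poly f h = (a / g) *: ('X - t%:P).
  have GK0 : map_poly f GU != 0 by rewrite eG scaler_eq0 (negPf g0).
  have e2 : map_poly f h * map_poly f GU = map_poly f NU by rewrite eh rmorphM.
  apply: (mulIf GK0); rewrite e2 eN eG -!mul_polyC polyCM.
  have eg : (g^-1)%:P * g%:P = 1 :> {poly K} by rewrite -polyCM mulVf.
  by rewrite -[a%:P in LHS]mulr1 -eg; ring.
have ag0 : a / g != 0 by rewrite mulf_neq0 ?invr_eq0.
have e1 : f h`_1 = a / g by rewrite -coef_map e coefZ coefB coefX coefC subr0 mulr1.
have e0 : f h`_0 = - (a / g * t) by rewrite -coef_map e coefZ coefB coefX coefC sub0r mulrN.
by exists (- (h`_0 / h`_1)); rewrite rmorphN fmorph_div /= e1 e0 mulNr opprK mulrC mulKf.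
Qed.

Lemma avoid_roots (K : fieldType) (B : {poly K}) : (forall n, n.+1%:R != 0 :> K) -> B != 0 ->
  exists n, B.[n%:R] != 0.
Proof.
move=> ch B0; have inj : injective (fun n => n%:R : K).
  have le i j : (i <= j)%N -> i%:R = j%:R :> K -> i = j.
    move=> ij e; have := subnKC ij; case d: (j - i)%N => [|d']; first by rewrite addn0.
    move=> ej; have /eqP := ch d'; case.
    by apply: (addrI i%:R); rewrite -natrD ej addr0 e.
  by move=> i j e; case/orP: (leq_total i j) => h; [apply: le | apply/esym/le].
pose rs : seq K := [seq i%:R | i <- iota 0 (size B)].
have us : uniq rs by rewrite map_inj_uniq ?iota_uniq.
have := max_poly_roots B0 _ us; rewrite size_map size_iota ltnn => h.
have /allPn [x /mapP [n _ ->] nr] : ~~ all (root B) rs by apply/negP => /h.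
by exists n.
Qed.

Section InChart.
Variables (k : fieldType) (E1 E2 : ellcurve k).
Variables (K : closedFieldType) (iota : {rmorphism ratfun k -> K}).
Local Notation m := (iotaC iota).
Local Notation mi := (map_poly iota).
Local Notation u0 := (iota ratX).
Local Notation F := (CuK E1 E2 iota).
Variable bu : ratfun k.
Local Notation b := (iota bu).

(** In the chart, C_u is y^3 + chart_p y^2 + chart_q y + chart_r. *)
Definition chart_p (R : comNzRingType) (f : k -> R) : {poly R} := (f (ec_a2 E2))%:P * 'X.
Definition chart_q (R : comNzRingType) (f : k -> R) : {poly R} := (f (ec_a4 E2))%:P * 'X^2.
Definition chart_r (R : comNzRingType) (f : k -> R) (u b : R) : {poly R} :=
  (f (ec_a6 E2))%:P * 'X^3 - (u ^+ 6)%:P * ec_cubic E1 (polyC \o f) (1 + b *: 'X) 'X.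

Local Notation p := (chart_p m).
Local Notation q := (chart_q m).
Local Notation r := (chart_r m u0 b).
Local Notation pU := (chart_p (@ratC k)).
Local Notation qU := (chart_q (@ratC k)).
Local Notation rU := (chart_r (@ratC k) ratX bu).

Lemma map_chart_x : mi (1 + bu *: 'X) = 1 + b *: 'X.
Proof. by rewrite (rmorphD mi) (rmorph1 mi) /= map_polyZ map_polyX. Qed.

Lemma map_chart_p : mi pU = p.
Proof. by rewrite (rmorphM mi) /= map_polyC map_polyX. Qed.
Lemma map_chart_q : mi qU = q.
Proof. by rewrite (rmorphM mi) /= map_polyC map_polyXn. Qed.
Lemma map_chart_r : mi rU = r.
Proof.
apply: etrans (rmorphB mi _ _) _; apply: f_equal2.
  by apply: etrans (rmorphM mi _ _) _; apply: f_equal2; [exact: map_polyC | exact: map_polyXn].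
congr (- _); apply: etrans (rmorphM mi _ _) _; apply: f_equal2.
  by apply: etrans (map_polyC _ _) _; congr (_%:P); exact: (rmorphXn iota).
have hC c : mi ((polyC \o @ratC k) c) = (polyC \o m) c by exact: map_polyC.
by apply: etrans (ec_cubic_morph (f := mi) E1 _ _ hC) _; apply: f_equal2; [exact: map_chart_x | exact: map_polyX].
Qed.

Lemma ec_cubicE (R : comNzRingType) (E : ellcurve k) (f : k -> R) x z : ec_cubic E f x z =
  x * (x * x) + f (ec_a2 E) * (x * x) * z + f (ec_a4 E) * x * (z * z) + f (ec_a6 E) * (z * (z * z)).
Proof. by rewrite /ec_cubic; ring. Qed.

Lemma dehom_ec (E : ellcurve k) (x z : {mpoly K[3]}) : dehom b (ec_cubic E (fun c => (m c)%:MP) x z) =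
  ec_cubic E (fun c => (m c)%:P%:P) (dehom b x) (dehom b z).
Proof.
have hC (c : k) : dehom b (m c)%:MP = (m c)%:P%:P by rewrite dehomC.
have fD : forall G H, dehom b (G + H) = dehom b G + dehom b H := @dehomD K b.
have fM : forall G H, dehom b (G * H) = dehom b G * dehom b H := @dehomM K b.
by rewrite !ec_cubicE !fD !fM !hC.
Qed.

Lemma dehom_CuK : dehom b F = cub p q r.
Proof.
have h1 := dehom_ec E1 'X_0 'X_2%:R; have h2 := dehom_ec E2 'X_1 'X_2%:R.
rewrite !dehomX /chart_coord /coord /= in h1 h2.
rewrite CuKE -mulNr -mpolyCN dehomD dehomM h1 h2 dehomC.
rewrite !ec_cubicE cub.unlock /chart_p /chart_q /chart_r ec_cubicE /=.
rewrite !(polyCB, polyCD, polyCM, polyCN, polyC_exp); ring.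
Qed.
End InChart.

(** * Curves through a rational family of points *)

Lemma evalp_map (k : fieldType) (K : fieldType) (f : {rmorphism k -> K}) (G : {mpoly k[3]}) (Q : 'rV[k]_3) :
  evalp (map_mpoly f G) (map_mx f Q) = f (evalp G Q).
Proof.
rewrite /evalp /meval (mmap_morph _ f) /map_mpoly.
rewrite (mmap_morph _ (mmap idfun (fun i => map_mx f Q 0 i))) /mmap.
apply: eq_bigr => i _; congr (_ * _); first exact: mmapC.
by apply: mmap1_eq => j; apply: etrans (mevalXU _ _) _; rewrite mxE.
Qed.

Section Prescribed.
Variables (k : fieldType) (E1 E2 : ellcurve k).
Variables (K : closedFieldType) (iota : {rmorphism ratfun k -> K}).
Hypothesis char0 : forall n, n.+1%:R != 0 :> k.
Local Notation ku := (ratfun k).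
Local Notation m := (iotaC iota).
Local Notation mi := (map_poly iota).
Local Notation u0 := (iota ratX).
Local Notation F := (CuK E1 E2 iota).

(** The prescribed points: Some (x, y) is the point (x : y : 1), and None is O. *)
Definition plane_point (Z : option (K * K)) : 'rV[K]_3 :=
  if Z is Some P then pt P.1 P.2 1 else OptK iota.

Variables (l : nat) (c0 c1 c2 A : {poly ku}) (Z0 : seq (option (K * K))).
Hypothesis l0 : (0 < l)%N.
Hypotheses (s0 : (size c0 <= l.+1)%N) (s1 : (size c1 <= l)%N) (s2 : (size c2 <= l.-1)%N).
Hypothesis C0 : quad c0 c1 c2 != 0.
Hypotheses (A0 : A != 0) (sA : (size A <= 3 * l)%N).
Hypothesis some_point : forall P, Some P \in Z0 ->
  [/\ (cubK E2 m).[P.2] = u0 ^+ 6 * (cubK E1 m).[P.1], (cubK E2 m)^`().[P.2] != 0,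
      (mi c0).[P.1] + (mi c1).[P.1] * P.2 + (mi c2).[P.1] * P.2 ^+ 2 = 0,
      (mi A).[P.1] = 0 & forall x, P.1 = iota x -> exists y, P.2 = iota y].
Hypothesis none_point : None \in Z0 ->
  c0`_l + c1`_(l - 1) * ratX ^+ 2 + c2`_(l - 2) * ratX ^+ 4 = 0 /\ A`_(3 * l - 1) = 0.
Hypothesis uS : uniq [seq omap fst Z | Z <- Z0].
Hypothesis szS : (size Z0).+1 = (3 * l)%N.
Variable pre : seq 'rV[K]_3.
Hypothesis hpre : all2 (@same_point K) pre [seq plane_point Z | Z <- Z0].

Section InChart.
Variable bu : ku.
Local Notation b := (iota bu).
Hypothesis nb : (normx E1 E2 iota (mi c0) (mi c1) (mi c2)).[b] != 0.
Hypothesis nA : (mi A).[b] != 0.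
Local Notation p := (chart_p E2 m).
Local Notation q := (chart_q E2 m).
Local Notation r := (chart_r E1 E2 m u0 b).
Local Notation x1 := (1 + b *: 'X : {poly K}).
Local Notation d0 := (homev l (mi c0) x1 'X).
Local Notation d1 := (homev (l - 1) (mi c1) x1 'X).
Local Notation d2 := (homev (l - 2) (mi c2) x1 'X).

Definition chart_of (Z : option (K * K)) : K * K :=
  if Z is Some P then ((P.1 - b)^-1, P.2 / (P.1 - b)) else (0, u0 ^+ 2).
Local Notation pts := [seq chart_of Z | Z <- Z0].

Lemma affine_neq_b P : Some P \in Z0 -> P.1 - b != 0.
Proof.
by case/some_point => _ _ _ z _; rewrite subr_eq0; apply: contraNneq nA => <-; rewrite z.
Qed.

Lemma plane_chart Z : Z \in Z0 -> same_point (plane_point Z) (cpt b (chart_of Z)).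
Proof.
case: Z => [P|] h.
  have d := affine_neq_b h; apply: (same_pointZ d); apply/rowP => i.
  rewrite [RHS]mxE cptE mul1r /pt mxE /coord; case: i => [[|[|[|//]]] hi] /=.
  - by rewrite mulrDr mulr1 mulrCA divff // mulr1 subrK.
  - by rewrite mulrC divfK.
  - by rewrite divff.
have -> : plane_point None = cpt b (chart_of None); last exact: same_point_refl.
apply/rowP => i; rewrite cptE mul1r /coord; case: i => [[|[|[|//]]] hi];
 by rewrite /plane_point /OptK /Opt /pt !mxE /= ?mulr0 ?addr0 ?rmorph1 ?rmorph0 // (rmorphXn iota).
Qed.

Lemma pre_chart : all2 (fun R Z => same_point R (cpt b Z)) pre pts.
Proof.
have : {subset Z0 <= Z0} by [].
move: hpre; move: {1 2 4}Z0 => T; elim: pre T => [|R pr IH] [|Z T] //= /andP[e1 e2] sT.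
have SS : Z \in Z0 by apply: sT; rewrite inE eqxx.
rewrite (same_point_eq _ e1) plane_chart //=; apply: IH => // x xT.
by apply: sT; rewrite inE xT orbT.
Qed.

Lemma uniq_chart : uniq [seq P.1 | P <- pts].
Proof.
pose h (o : option K) := if o is Some x then (x - b)^-1 else 0.
have -> : [seq P.1 | P <- pts] = [seq h o | o <- [seq omap fst Z | Z <- Z0]].
  by rewrite -!map_comp; apply: eq_map => -[].
rewrite map_inj_in_uniq // => o o' /mapP[Z hZ ->] /mapP[Z' hZ' ->].
case: Z hZ => [P|] hZ; case: Z' hZ' => [P'|] hZ' //=.
- by move=> /invr_inj /addIr ->.
- by move/eqP; rewrite invr_eq0 (negPf (affine_neq_b hZ)).
- by move/eqP; rewrite eq_sym invr_eq0 (negPf (affine_neq_b hZ')).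
Qed.

Lemma curve_point Z : Z \in Z0 -> ev (chart_of Z).1 (chart_of Z).2 (cub p q r) = 0.
Proof.
move=> hZ; rewrite -dehom_CuK -(cpt_eval _ _ (CuK_homog _ _ _)); apply/eqP.
rewrite -(evalp_same (CuK_homog _ _ _) (cpt_neq0 _ _) (plane_chart hZ)).
case: Z hZ => [P|] hZ; rewrite /plane_point.
  by rewrite evalp_CuK_pt; case/some_point: hZ => -> _ _ _ _; rewrite subrr.
rewrite evalp_CuK /OptK /Opt /pt !mxE /= rmorph0 rmorph1 (rmorphXn iota) /ec_cubic.
apply/eqP; ring.
Qed.

Lemma smooth_point Z : Z \in Z0 -> (fib (chart_of Z).1 (cub p q r))^`().[(chart_of Z).2] != 0.
Proof.
move=> hZ; rewrite fib_cub cub.unlock !derivD !mul_polyC !derivZ !derivXn derivX derivC !hornerE /=.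
case: Z hZ => [P|] hZ /=.
  have d := affine_neq_b hZ; case/some_point: hZ => _ + _ _ _.
  rewrite cubK_deriv => h.
  have d' : (P.1 - b)^-1 ^+ 2 != 0 by rewrite expf_neq0 // invr_eq0.
  apply: contraNneq h => e; apply/eqP; apply: (mulfI d'); rewrite mulr0 -[RHS]e; field.
  by rewrite d.
have h : 3%:R * u0 ^+ 4 != 0 by rewrite mulf_neq0 ?(char0K iota char0 2) // expf_neq0 // u0_neq0.
apply: contraNneq h => e; apply/eqP; rewrite -[RHS]e /chart_p /chart_q !hornerE /=; ring.
Qed.

Let z1 : (size (mi c1) <= (l - 1).+1)%N.
Proof. by rewrite size_map_poly; move: l0 s1; move: (size c1) => x; lia. Qed.
Let z2 : (size (mi c2) <= (l - 2).+1)%N.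
Proof. by rewrite size_map_poly; move: l0 s2; move: (size c2) => x; lia. Qed.
Let z0 : (size (mi c0) <= l.+1)%N.
Proof. by rewrite size_map_poly. Qed.
Let c2_or : c2 = 0 \/ (2 <= l)%N.
Proof.
case: l l0 s2 => [|[|n]] //= _; [|by right].
by rewrite size_poly_leq0 => /eqP; left.
Qed.

Lemma ev_quad t y (a0 a1 a2 : {poly K}) : ev t y (quad a0 a1 a2) = a0.[t] + a1.[t] * y + a2.[t] * y ^+ 2.
Proof. by rewrite /ev fib_quad quad.unlock !hornerE. Qed.

Lemma quad_point Z : Z \in Z0 -> ev (chart_of Z).1 (chart_of Z).2 (quad d0 d1 d2) = 0.
Proof.
move=> hZ; rewrite ev_quad; case: Z hZ => [P|] hZ /=.
  have d := affine_neq_b hZ; have xb : P.1 != b by rewrite -subr_eq0.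
  rewrite !homev_affine // -!exprVn.
  case/some_point: hZ => _ _ e _ _; set x := (P.1 - b)^-1; rewrite -[RHS](mulr0 (x ^+ l)) -e.
  have el : x ^+ l = x * x ^+ (l - 1) by rewrite -exprS subn1 prednK.
  rewrite el; case: c2_or => [-> | l2].
    by rewrite rmorph0 horner0 !(mulr0, mul0r, addr0) -/x; ring.
  have el' : x ^+ (l - 1) = x * x ^+ (l - 2) by rewrite -exprS; congr (_ ^+ _); lia.
  by rewrite el' -/x; ring.
case: (none_point hZ) => e _; rewrite !homev_at0 !coef_map /=.
apply: etrans (etrans _ (congr1 iota e)) (rmorph0 iota).
by rewrite -exprM !(rmorphD iota) (rmorphM iota c1`_ _) (rmorphM iota c2`_ _) !(rmorphXn iota).
Qed.

Lemma common_point P : P \in pts -> common P.1 P.2 (cub p q r) (quad d0 d1 d2).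
Proof. by case/mapP => Z hZ ->; rewrite /common curve_point // quad_point // eqxx. Qed.

Let wX : wtop 1 0 1 ('X : {poly K}).
Proof. by right; split=> //; split; rewrite ?size_polyX ?coefX. Qed.
Let wXn n : wtop n 0 1 ('X^n : {poly K}).
Proof. by right; split=> //; split; rewrite subn0 ?size_polyXn // coefXn eqxx. Qed.

Let wp : wtop 1 0 (m (ec_a2 E2)) p.
Proof. by apply: wtop_eq (wtopM (wtop0 _) wX) _ _; rewrite ?mulr1. Qed.
Let wq : wtop 2 0 (m (ec_a4 E2)) q.
Proof. by apply: wtop_eq (wtopM (wtop0 _) (wXn 2)) _ _; rewrite ?mulr1. Qed.
Let w1x : wtop 1 0 b x1.
Proof. by right; split=> //; exact: topd_chart_x. Qed.
Let wr : wtop 3 0 (m (ec_a6 E2) - u0 ^+ 6 * (cubK E1 m).[b]) r.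
Proof.
have c a n x (f : {poly K}) : wtop n 0 x f -> wtop n 0 (a * x) (a%:P * f) by move=> h; exact: wtopM (wtop0 a) h.
have h : wtop 3 0 (cubK E1 m).[b] (ec_cubic E1 (polyC \o m) x1 'X).
  rewrite horner_cubK !ec_cubicE.
  apply: wtopD; last exact: c (wtopM wX (wtopM wX wX)).
  apply: wtopD; last exact: wtopM (c _ _ _ _ w1x) (wtopM wX wX).
  apply: wtopD; last exact: wtopM (c _ _ _ _ (wtopM w1x w1x)) wX.
  exact: wtopM w1x (wtopM w1x w1x).
apply: wtopD; last exact: wtopN (c _ _ _ _ h).
by rewrite -[X in wtop _ _ X]mulr1; exact: c (wXn 3).
Qed.

Let w0 : wtop l 0 (mi c0).[b] d0.
Proof. by rewrite -[X in homev X]subn0; apply: wtop_homev; left; rewrite addn0. Qed.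
Let w1 : wtop l 1 (mi c1).[b] d1.
Proof. by apply: wtop_homev; left; rewrite addn1 ltnS size_map_poly. Qed.
Let w2 : wtop l 2 (mi c2).[b] d2.
Proof.
apply: wtop_homev; rewrite size_map_poly; case: c2_or => [->|l2]; first by right; rewrite rmorph0.
by left; move: l2 s2; move: (size c2) => x; lia.
Qed.

Let top_nrm : nrm (m (ec_a2 E2)) (m (ec_a4 E2)) (m (ec_a6 E2) - u0 ^+ 6 * (cubK E1 m).[b])
  (mi c0).[b] (mi c1).[b] (mi c2).[b] != 0.
Proof. by move: nb; rewrite /normx horner_nrm !hornerE. Qed.

Let eN : exists nu tQ, nu != 0 /\
  nrm p q r d0 d1 d2 = nu%:P * \prod_(P <- pts) ('X - P.1%:P) * ('X - tQ%:P).
Proof.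
have wN := wtop_nrm wp wq wr w0 w1 w2.
have tN : topd (size [seq P.1 | P <- pts]).+1 (nrm (m (ec_a2 E2)) (m (ec_a4 E2)) (m (ec_a6 E2) - u0 ^+ 6 * (cubK E1 m).[b])
  (mi c0).[b] (mi c1).[b] (mi c2).[b]) (nrm p q r d0 d1 d2).
  rewrite !size_map szS; case: wN => [[_ z]|[_]]; last by rewrite subn0.
  by move: top_nrm; rewrite z eqxx.
have rN t : t \in [seq P.1 | P <- pts] -> (nrm p q r d0 d1 d2).[t] = 0.
  by case/mapP => P hP ->; exact: common_nrm (common_point hP).
have [nu [tQ [nu0 e]]] := last_root uniq_chart rN tN top_nrm.
by exists nu, tQ; split=> //; rewrite e (big_map fst xpredT (fun t => 'X - t%:P)).
Qed.

Let GU := homev (3 * l - 1) A (1 + bu *: 'X) 'X.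
(** The binary form of degree 3 l - 1 defined by A has the prescribed t_i as its
    zeros: a drop in the degree of A produces the zero t = 0 of O. *)
Lemma prescribed_rational : exists2 g, g != 0 & mi GU = g *: \prod_(P <- pts) ('X - P.1%:P).
Proof.
have e1 : (3 * l - 1).+1 = (3 * l)%N by move: l0; lia.
have eG : mi GU = homev (3 * l - 1) (mi A) x1 'X by rewrite /GU map_homev map_chart_x map_polyX.
have sA' : (size (mi A) <= (3 * l - 1).+1)%N by rewrite size_map_poly e1.
have [sG tG] := topd_homev b sA'; rewrite -eG in sG tG.
exists (mi A).[b] => //.
have sG' : size (mi GU) = (size [seq P.1 | P <- pts]).+1.
  rewrite !size_map szS; apply/eqP; rewrite eqn_leq -{1}e1 sG /= -e1 ltnNge; apply: contra nA => s.
  by rewrite -tG nth_default.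
have := all_roots_prod_XsubC sG'; rewrite (big_map fst xpredT (fun t => 'X - t%:P)) => ->.
- by rewrite -tG lead_coefE sG' !size_map szS subn1.
- apply/allP => t /mapP[P /mapP[Z hZ ->] ->]; apply/rootP; rewrite eG.
  case: Z hZ => [Q|] hZ /=.
    have xb : Q.1 != b by rewrite -subr_eq0 affine_neq_b.
    rewrite homev_affine //.
    by case/some_point: hZ => _ _ _ -> _; rewrite mulr0.
  by rewrite homev_at0 coef_map; case: (none_point hZ) => _ eA; apply: etrans (congr1 iota eA) (rmorph0 iota).
- by rewrite uniq_rootsE uniq_chart.
Qed.

Let hpts P : P \in pts -> exists2 Z, Z \in Z0 & P = chart_of Z.
Proof. by case/mapP => Z hZ ->; exists Z. Qed.

Let Finf P : evalp (line_at b) P = 0 -> P 0 2%:R = 1 ->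
  evalp F P = (cub (m (ec_a2 E2)) (m (ec_a4 E2)) (m (ec_a6 E2) - u0 ^+ 6 * (cubK E1 m).[b])).[P 0 1].
Proof.
rewrite /line_at evalpD evalpN -mul_mpolyC evalpM evalpC !evalpX => e0 e1.
move: e0; rewrite e1 mulr1 => /eqP; rewrite subr_eq0 => /eqP e0.
rewrite evalp_CuK e0 e1 horner_cubK /ec_cubic cub.unlock !expr1n !mulr1 !hornerE /=; ring.
Qed.

Let Finf0 P : P != 0 -> evalp (line_at b) P = 0 -> evalp F P = 0 -> P 0 2%:R != 0.
Proof.
move=> P0; rewrite /line_at evalpD evalpN -mul_mpolyC evalpM evalpC !evalpX => e0 eF.
apply: contraNneq P0 => e2.
move: e0 eF; rewrite e2 mulr0 subr0 evalp_CuK => e0; rewrite e0 e2 /ec_cubic.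
have -> a c d g : a ^+ 3 + m c * a ^+ 2 * 0 + m d * a * 0 ^+ 2 + m g * 0 ^+ 3 = a ^+ 3 by ring.
have -> c d g : (0 : K) ^+ 3 + m c * 0 ^+ 2 * 0 + m d * 0 * 0 ^+ 2 + m g * 0 ^+ 3 = 0 by ring.
rewrite mulr0 subr0 => /eqP; rewrite expf_eq0 /= => /eqP e1.
apply/eqP/rowP => i; rewrite mxE; case: i => [[|[|[|//]]] hi].
- by rewrite -[RHS]e0; congr (P 0 _); apply: val_inj.
- by rewrite -[RHS]e1; congr (P 0 _); apply: val_inj.
- by rewrite -[RHS]e2; congr (P 0 _); apply: val_inj.
Qed.

Let cpts P : P \in pts -> common P.1 P.2 (cub p q r) (quad d0 d1 d2) := @common_point P.
Let spts P : P \in pts -> (fib P.1 (cub p q r))^`().[P.2] != 0.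
Proof. by case/hpts => Z hZ ->; exact: smooth_point. Qed.
Let szpts : (size pts).+1 = (3 * l)%N.
Proof. by rewrite size_map. Qed.

Lemma chart_exists : exists C, [/\ plane_curve l C, passes_through C pre & ~ contains_curve C F].
Proof.
exact: (core_exists Finf w0 w1 w2 top_nrm cpts pre_chart).
Qed.

Local Notation pU := (chart_p E2 (@ratC k)).
Local Notation qU := (chart_q E2 (@ratC k)).
Local Notation rU := (chart_r E1 E2 (@ratC k) ratX bu).
Local Notation y1 := (1 + bu *: 'X : {poly ku}).
Local Notation g0 := (homev l c0 y1 'X).
Local Notation g1 := (homev (l - 1) c1 y1 'X).
Local Notation g2 := (homev (l - 2) c2 y1 'X).

Let map_g n c : mi (homev n c y1 'X) = homev n (mi c) x1 'X.
Proof. by rewrite map_homev map_chart_x map_polyX. Qed.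

Let map_nrm : mi (nrm pU qU rU g0 g1 g2) = nrm p q r d0 d1 d2.
Proof. by rewrite -map_chart_p -map_chart_q -map_chart_r -!map_g nrm_morph. Qed.

Let map_adj1 : mi (adj1 pU qU rU g0 g1 g2) = adj1 p q r d0 d1 d2.
Proof. by rewrite -map_chart_p -map_chart_q -map_chart_r -!map_g adj1_morph. Qed.
Let map_adj2 : mi (adj2 pU qU rU g0 g1 g2) = adj2 p q r d0 d1 d2.
Proof. by rewrite -map_chart_p -map_chart_q -map_chart_r -!map_g adj2_morph. Qed.

(** The first coordinate x1 = b + 1 / t is rational too. *)
Lemma rational_point P t : P \in pts -> P.1 = iota t -> exists y, P.2 = iota y.
Proof.
case/hpts => -[Q|] hQ -> /=; last by exists (ratX ^+ 2); rewrite (rmorphXn iota).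
move=> e; have d := affine_neq_b hQ.
have ex : Q.1 = iota (bu + t^-1) by rewrite (rmorphD iota) fmorphV /= -e invrK addrC subrK.
have [_ _ _ _ /(_ _ ex) [y ->]] := some_point hQ.
by exists (y * t); rewrite (rmorphM iota) /= -e.
Qed.

Lemma chart_residual : exists Q : 'rV[ku]_3, [/\ Q != 0, evalp (Cu E1 E2) Q = 0 &
  forall C, plane_curve l C -> passes_through C pre ->
    evalp C (map_mx iota Q) = 0 /\
    (~ contains_curve C F -> intersection_divisor F C (rcons pre (map_mx iota Q)))].
Proof.
have [nu [tQ [nu0 eN']]] := eN; have [g g0' eG] := prescribed_rational.
have Pi0 : \prod_(P <- pts) ('X - P.1%:P) != 0 by apply/monic_neq0/monic_prod_XsubC.
have [tU et] : exists tU, tQ = iota tU.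
  by apply: (rational_last_root nu0 g0' Pi0 eG (NU := nrm pU qU rU g0 g1 g2)); rewrite map_nrm.
have [yQ [fQ FQ resQ]] := core_residual (CuK_homog E1 E2 iota) (dehom_CuK E1 E2 iota bu)
  Finf Finf0 wp wq wr w0 w1 w2 top_nrm nu0 eN' uniq_chart cpts spts szpts pre_chart.
have hm (f : {poly ku}) : (mi f).[tQ] = iota f.[tU] by rewrite et horner_map.
have [yU ey] : exists yU, yQ = iota yU.
  case: fQ => [[_ ->]|[P [hP eP ->]]].
    rewrite -map_adj1 -map_adj2 -map_chart_p !hm.
    by eexists; rewrite -fmorph_div -(rmorphB iota).
  rewrite et in eP; have [y ->] := rational_point hP eP.
  rewrite -!map_g !hm.
  by eexists; rewrite -fmorph_div -(rmorphN iota) -(rmorphB iota).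
pose Q : 'rV[ku]_3 := cpt bu (tU, yU).
have eQ : map_mx iota Q = cpt b (tQ, yQ).
  apply/rowP => i; rewrite mxE !cptE !mul1r et ey /coord.
  case: i => [[|[|[|//]]] hi] //=.
  by rewrite (rmorphD iota) (rmorphM iota) (rmorph1 iota).
exists Q; rewrite eQ; split; [exact: cpt_neq0 | | exact: resQ].
apply: (fmorph_inj iota); rewrite rmorph0 -[RHS]FQ -eQ.
exact/esym/evalp_map.
Qed.
End InChart.

Hypothesis jj : jinv E1 != jinv E2.

(** The chart is chosen with b avoiding the zeros of the norm and of A. *)
Lemma prescribed_curves :
  (exists C, [/\ plane_curve l C, passes_through C pre & ~ contains_curve C F]) /\
  exists Q : 'rV[ku]_3, [/\ Q != 0, evalp (Cu E1 E2) Q = 0 &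
    forall C, plane_curve l C -> passes_through C pre ->
    evalp C (map_mx iota Q) = 0 /\
    (~ contains_curve C F -> intersection_divisor F C (rcons pre (map_mx iota Q)))].
Proof.
have C0' : quad (mi c0) (mi c1) (mi c2) != 0.
  apply: contraNneq C0 => /quad_eq0 [] /eqP + /eqP + /eqP.
  by rewrite !map_poly_eq0 => /eqP -> /eqP -> /eqP ->; rewrite quadC polyC0.
have nx := normx_neq0 iota char0 jj C0'.
have B0 : normx E1 E2 iota (mi c0) (mi c1) (mi c2) * mi A != 0.
  by rewrite mulf_neq0 // map_poly_eq0.
have [n] := avoid_roots (char0K iota char0) B0.
rewrite -(rmorph_nat iota) hornerM mulf_eq0 negb_or => /andP[nb nA].
by split; [exact: chart_exists nb nA | exact: chart_residual nb nA].
Qed.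
End Prescribed.

(** * The prescribed points *)

Section Assembly.
Variables (k : fieldType) (E1 E2 : ellcurve k) (fx fy : ratfun k) (d : nat).
Variables (K : closedFieldType) (iota : {rmorphism ratfun k -> K}) (Obar : 'rV[K]_3).
Hypothesis iso : is_isogeny E1 E2 fx fy.
Hypothesis hd : d = (size (fnum fx)).-1.
Hypothesis d2 : (2 <= d)%N.
Hypothesis tors : ~~ odd d -> ~ two_torsion_in_kernel E1 fx (iotaC iota).
Local Notation ku := (ratfun k).
Local Notation m := (iotaC iota).
Local Notation mp := (map_poly m).
Local Notation mi := (map_poly iota).
Local Notation up := (map_poly (@ratC k)).
Local Notation u0 := (iota ratX).
Local Notation N := (fnum fx).
Local Notation D := (fden fx).
Local Notation A := (fnum fy).
Local Notation B := (fden fy).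

Let szN : size N = d.+1.
Proof. by move: d2; rewrite hd; case: (size N). Qed.

Lemma size_phi_y : [/\ (size B <= size A)%N, (1 < size A)%N,
   odd d -> (2 * (size A).-1 = 3 * d - 3)%N & ~~ odd d -> (2 * (size A).-1 = 3 * d - 2)%N].
Proof.
have [sBA A0 ho he] := isog_sizes iso m.
rewrite szN /= in ho he.
have ho' : odd d -> (2 * (size A).-1 = 3 * d - 3)%N by move=> o; apply: ho; rewrite o.
have he' : ~~ odd d -> (2 * (size A).-1 = 3 * d - 2)%N by move=> o; apply: he => //; apply: tors.
split=> //; have := odd_double_half d.
by case: (boolP (odd d)) => o; [move: (ho' o) | move: (he' o)]; move: d2; move: (size A) (half d) => x y; lia.
Qed.

Let sBA : (size B <= size A)%N. Proof. by case: size_phi_y. Qed.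
Let sA1 : (1 < size A)%N. Proof. by case: size_phi_y. Qed.

Lemma size_ppm_phi s : (size (ppm fy s)).-1 = (size A).-1.
Proof. by rewrite (size_ppm iota sBA sA1). Qed.

Hypothesis char0 : forall n, n.+1%:R != 0 :> k.
Hypothesis jj : jinv E1 != jinv E2.
Hypothesis hO : is_Obar E1 E2 iota Obar.
Variables (s : bool) (l : nat).
Hypothesis hl : d = (2 * l)%N \/ (d + 1)%N = (2 * l)%N.
Local Notation r := (size A).-1.
Local Notation phix := (ratfun_eval m fx).
Local Notation roots := (ppm_roots fy iota s).
Local Notation xU := (obarx_u E1 E2).
Local Notation yU := (obary_u E1 E2).

(** The linear conditions on a triple.  Since the second coordinate of a Q_i is
    N(x1) / D(x1), vanishing at all of them is divisibility by p^+-; the two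
    other conditions are vanishing at O and at O-bar. *)
Definition condition (i : nat) (c0 c1 c2 : {poly ku}) : ku :=
  if (i < r)%N then ((up D ^+ 2 * c0 + up N * up D * c1 + up N ^+ 2 * c2) %% ppm fy s)`_i
  else if i == r then c0`_l + c1`_(l - 1) * ratX ^+ 2 + c2`_(l - 2) * ratX ^+ 4
  else c0.[xU] + c1.[xU] * yU + c2.[xU] * yU ^+ 2.

Lemma condition_linear i a c0 c1 c2 c0' c1' c2' :
  condition i (a *: c0 + c0') (a *: c1 + c1') (a *: c2 + c2') =
  a * condition i c0 c1 c2 + condition i c0' c1' c2'.
Proof.
rewrite /condition; case: ifP => _; last case: ifP => _.
- have -> : up D ^+ 2 * (a *: c0 + c0') + up N * up D * (a *: c1 + c1') + up N ^+ 2 * (a *: c2 + c2') =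
    a *: (up D ^+ 2 * c0 + up N * up D * c1 + up N ^+ 2 * c2) +
    (up D ^+ 2 * c0' + up N * up D * c1' + up N ^+ 2 * c2').
    by rewrite -!mul_polyC; ring.
  by rewrite modpD modpZl coefD coefZ.
- by rewrite !coefD !coefZ; ring.
- by rewrite !hornerD !hornerZ; ring.
Qed.

Definition marked : seq (option (K * K)) :=
  [seq Some (x, phix x) | x <- roots] ++ (if odd d then [:: None; Some (iota xU, iota yU)] else [::]).

(** The polynomial whose zeros are the first coordinates of the prescribed
    points other than O. *)
Definition abscissae : {poly ku} := if odd d then ppm fy s * ('X - xU%:P) else ppm fy s.

Let l0 : (0 < l)%N. Proof. by move: d2 hl; lia. Qed.
Let odd_l : if odd d then (d + 1 = 2 * l /\ r = 3 * l - 3)%N else (d = 2 * l /\ r = 3 * l - 1)%N.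
Proof.
case: size_phi_y => _ _; case: ifP => o /= h h'.
  have e := h isT; have /= := odd_double_half d; rewrite o => ed.
  by move: hl d2 e ed; move: r (half d) => x y; lia.
have e := h' isT; have /= := odd_double_half d; rewrite o => ed.
by move: hl d2 e ed; move: r (half d) => x y; lia.
Qed.

Lemma size_marked : (size marked).+1 = (3 * l)%N.
Proof.
rewrite size_cat size_map (size_ppm_roots iota sBA sA1) .
by move: odd_l l0; case: (odd d) => /= -[_ ->]; lia.
Qed.

Lemma prescribed_marked : all2 (@same_point K) (prescribed fx fy iota d Obar s)
  [seq plane_point iota Z | Z <- marked].
Proof.
rewrite /prescribed /marked map_cat -map_comp.
have -> : [seq (plane_point iota \o (fun x => Some (x, phix x))) x | x <- roots] = Qpts fx fy iota s by [].
have h (P Q : seq 'rV[K]_3) : all2 (@same_point K) P Q -> all2 (@same_point K) (Qpts fx fy iota s ++ P) (Qpts fx fy iota s ++ Q).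
  by move=> hPQ; elim: (Qpts _ _ _ _) => [|R T IH] //=; rewrite same_point_refl.
have h0 : all2 (@same_point K) (Qpts fx fy iota s) (Qpts fx fy iota s).
  by elim: (Qpts _ _ _ _) => [|R T IH] //=; rewrite same_point_refl.
case: ifP => o; last by rewrite cats0.
apply: h => /=; rewrite same_point_refl /= andbT.
have [c c0 ->] := is_ObarP char0 jj hO; exact: same_pointZ c0 erefl.
Qed.

Lemma uniq_marked : uniq [seq omap fst Z | Z <- marked].
Proof.
rewrite /marked map_cat -map_comp.
have -> : [seq (omap fst \o (fun x => Some (x, phix x))) x | x <- roots] = [seq Some x | x <- roots] by [].
have us : uniq [seq Some x | x <- roots].
  by rewrite map_inj_uniq; [exact: uniq_ppm_roots iota char0 sBA sA1 s | move=> x y []].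
case: ifP => o; last by rewrite cats0.
rewrite cat_uniq us /= orbF andbT negb_or; apply/andP; split.
  by apply/mapP => -[].
apply/mapP => -[x hx [ex]]; rewrite -ex in hx.
have [_ B0 _ _ _] := ppm_root_point char0 iso sBA sA1 hx.
rewrite (ppm_rootE iota sBA sA1) in hx.
exact: (@obar_not_root k E1 E2 fy K iota char0 jj s B0 (eqP hx)).
Qed.

Lemma assembly : (exists C, [/\ plane_curve l C, passes_through C (prescribed fx fy iota d Obar s) &
     ~ contains_curve C (CuK E1 E2 iota)]) /\
  exists Q : 'rV[ku]_3, [/\ Q != 0, evalp (Cu E1 E2) Q = 0 &
    forall C, plane_curve l C -> passes_through C (prescribed fx fy iota d Obar s) ->
    evalp C (map_mx iota Q) = 0 /\
    (~ contains_curve C (CuK E1 E2 iota) -> intersection_divisor (CuK E1 E2 iota) C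
       (rcons (prescribed fx fy iota d Obar s) (map_mx iota Q)))].
Proof.
have nl : (3 * l - 1 < 3 * l)%N by move: l0; lia.
have [c0 [c1 [c2 [s0 s1 s2 C0 hc]]]] := exists_triple nl condition_linear.
have sp : size (ppm fy s) = r.+1 by rewrite (size_ppm iota sBA sA1) prednK // ltnW.
have p0 : ppm fy s != 0 by rewrite -size_poly_gt0 sp.
have rl : (r <= 3 * l - 1)%N by move: odd_l; case: ifP => _ -[_ ->]; lia.
have mod0 : (up D ^+ 2 * c0 + up N * up D * c1 + up N ^+ 2 * c2) %% ppm fy s = 0.
  apply/polyP => i; rewrite coef0; have [ir|ri] := ltnP i r.
    by have := hc i (leq_trans ir rl); rewrite /condition ir.
  by rewrite nth_default // (leq_trans _ ri) // -ltnS -sp ltn_modp.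
have rootsA x : x \in roots -> (mi (ppm fy s)).[x] = 0.
  rewrite (ppm_rootE iota sBA sA1) => /eqP e.
  have [c _ ->] := iota_ppm fy iota s.
  by rewrite hornerZ !hornerE e subrr mulr0.
have A0 : abscissae != 0.
  by rewrite /abscissae; case: ifP => // _; rewrite mulf_neq0 ?polyXsubC_eq0.
have sAb : size abscissae = (if odd d then 3 * l - 1 else 3 * l)%N.
  rewrite /abscissae; move: odd_l l0; case: ifP => _ -[_ er].
    by rewrite size_Mmonic ?monicXsubC // size_XsubC sp er; lia.
  by rewrite sp er; lia.
apply: (@prescribed_curves _ E1 E2 _ iota char0 l c0 c1 c2 abscissae marked) => //.
- by rewrite sAb; case: ifP => _; lia.
- move=> P; rewrite mem_cat => /orP[/mapP[x hx [->]]|] /=.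
    have [D0 B0 tr eC eF] := ppm_root_point char0 iso sBA sA1 hx.
    split=> //.
    + have /dvdpP[h eh] : ppm fy s %| up D ^+ 2 * c0 + up N * up D * c1 + up N ^+ 2 * c2.
        by rewrite /dvdp mod0.
      have yD : phix x * (mp D).[x] = (mp N).[x] by rewrite /ratfun_eval divfK.
      have := congr1 (fun p : {poly ku} => (mi p).[x]) eh.
      rewrite /= (rmorphM mi h) hornerM rootsA // mulr0 !(rmorphD mi) (rmorphM mi _ c0) (rmorphM mi _ c1) (rmorphM mi _ c2).
      rewrite !(rmorphXn mi) (rmorphM mi (up N)) /= !(mp_up iota) !hornerD !hornerM -yD => e.
      by apply: (mulfI (expf_neq0 2 D0)); rewrite mulr0 -[RHS]e; ring.
    + rewrite /abscissae; case: ifP => _; last exact: rootsA.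
      by rewrite (rmorphM mi) hornerM rootsA // mul0r.
    + move=> x' ->; exists ((up N).[x'] / (up D).[x']).
      by rewrite /ratfun_eval -!(mp_up iota) !horner_map fmorph_div.
  case: ifP => o //; rewrite !inE => /eqP [->] /=.
  split.
  + exact: obar_onC iota char0 jj.
  + exact: obar_Fy_neq0 iota char0 jj.
  + have i1 : (r.+1 < 3 * l - 1)%N by move: odd_l l0; rewrite o => -[_ ->]; move: d2 hl; lia.
    have := hc _ i1; rewrite /condition ltnNge leqnSn /= gtn_eqF //= => e.
    apply: etrans (etrans _ (congr1 iota e)) (rmorph0 iota).
    by rewrite !horner_map (rmorphD iota (_ + _)) (rmorphD iota c0.[_]) (rmorphM iota c1.[_]) (rmorphM iota c2.[_]) (rmorphXn iota).
  + by rewrite /abscissae o (rmorphM mi) hornerM /= map_polyXsubC !hornerE subrr mulr0.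
  + by move=> x _; exists yU.
- rewrite mem_cat => /orP[/mapP[x _ //]|]; case: ifP => // o _.
  have i1 : (r < 3 * l - 1)%N by move: odd_l l0; rewrite o => -[_ ->]; move: d2 hl; lia.
  split; first by have := hc _ i1; rewrite /condition ltnn eqxx.
  by rewrite nth_default // sAb o.
- exact: uniq_marked.
- exact: size_marked.
- exact: prescribed_marked.
Qed.
End Assembly.

(** * The theorem *)

Lemma rat_algebra_char0 (k : fieldExtType rat) n : n.+1%:R != 0 :> k.
Proof. by rewrite -(rmorph_nat (in_alg k)) fmorph_eq0 Num.Theory.pnatr_eq0. Qed.

Theorem theorem5p1 (k : fieldExtType rat) (E1 E2 : ellcurve k)
    (phi_x phi_y : ratfun k) (d : nat)
    (K : closedFieldType) (iota : {rmorphism ratfun k -> K})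
    (Obar : 'rV[K]_3) :
  jinv E1 != jinv E2 ->
  is_isogeny E1 E2 phi_x phi_y ->
  isogeny_degree E1 phi_x phi_y d ->
  (2 <= d)%N ->
  (~~ odd d ->
     ~ two_torsion_in_kernel E1 phi_x (fun c : k => iota (ratC c))) ->
  integralRange iota ->
  is_Obar E1 E2 iota Obar ->
  [/\ odd d -> forall s : bool,
        (size (ppm phi_y s)).-1 = ((3 * d - 3) %/ 2)%N /\
        exists C : {mpoly K[3]},
          plane_curve ((d + 1) %/ 2) C /\
          passes_through C (Qpts phi_x phi_y iota s ++ [:: OptK iota; Obar]),
      ~~ odd d -> forall s : bool,
        (size (ppm phi_y s)).-1 = ((3 * d - 2) %/ 2)%N /\
        exists C : {mpoly K[3]},
          plane_curve (d %/ 2) C /\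
          passes_through C (Qpts phi_x phi_y iota s)
    & forall (l : nat) (s : bool), d = (2 * l)%N \/ (d + 1)%N = (2 * l)%N ->
        (exists C : {mpoly K[3]},
           [/\ plane_curve l C,
               passes_through C (prescribed phi_x phi_y iota d Obar s)
             & ~ contains_curve C (CuK E1 E2 iota)]) /\
        exists Q : 'rV[ratfun k]_3,
          [/\ Q != 0, evalp (Cu E1 E2) Q = 0
            & forall C : {mpoly K[3]},
                plane_curve l C ->
                passes_through C (prescribed phi_x phi_y iota d Obar s) ->
                evalp C (map_mx iota Q) = 0 /\
                (~ contains_curve C (CuK E1 E2 iota) ->
                 intersection_divisor (CuK E1 E2 iota) C
                   (rcons (prescribed phi_x phi_y iota d Obar s)
                          (map_mx iota Q)))]].

Proof.
move=> jj iso degd d2 tors _ hO.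
have char0 := @rat_algebra_char0 k; have hd := isog_degree iso degd.
have main l s (hl : d = (2 * l)%N \/ (d + 1)%N = (2 * l)%N) := assembly iso hd d2 tors char0 jj hO s hl.
have [_ _ ro re] := size_phi_y iso hd d2 tors.
have sp := size_ppm_phi iso hd d2 tors.
split=> [o s|o s|l s hl]; last exact: main.
- split; first by rewrite sp -(ro o) mulKn.
  have hl : (d + 1)%N = (2 * ((d + 1) %/ 2))%N.
    by rewrite mulnC divnK // dvdn2 addn1 /= o.
  have [[C [hC pC _]] _] := main _ s (or_intror hl).
  by exists C; split=> //; rewrite /prescribed o in pC.
- split; first by rewrite sp -(re o) mulKn.
  have hl : d = (2 * (d %/ 2))%N by rewrite mulnC divnK // dvdn2.
  have [[C [hC pC _]] _] := main _ s (or_introl hl).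
  by exists C; split=> //; rewrite /prescribed (negPf o) in pC.
Qed.
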